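(* For every $q\in[0,1]$ and $\beta>0$, the pyramids $\mathcal G_q$, $\mathcal H_\beta$, and $\mathcal S_{\rhd}$ are pairwise distinct. More precisely, for every $q\in[0,1]$, $$\Lambda^+(\mathcal G_q)=+\infty,\qquad \Lambda^+(\mathcal S_{\rhd})=\tfrac12,\qquad \mathbf V^{\to}(\mathcal S_{\rhd})=4,\qquad \mathbf V^{\to}(\mathcal H_{1/2})\ge\tfrac{\pi^2}{2}.$$
   Context: **Qm-spaces and pyramids.** A qm-space is a triple $(X,d_X,\mu_X)$ (written $X$) where $d_X\colon X\times X\to[0,+\infty)$ satisfies $d_X(x,x)=0$ and the triangle inequality (symmetry is not required), $d_X^{\mathrm s}(x,y):=\max\{d_X(x,y),d_X(y,x)\}$ is a complete separable metric, and $\mu_X$ is a Borel probability measure on $(X,d_X^{\mathrm s})$ with full support. Two qm-spaces are isomorphic if a measure-preserving bijection preserves the directed distance; collections of qm-spaces consist of isomorphism classes. Write $Y\preceq X$ if there is a Borel map $p\colon X\to Y$ with $p_*\mu_X=\mu_Y$ and $d_Y(p(x),p(y))\le d_X(x,y)$ for all $x,y$. Let $\operatorname{Lip}^+_1(X,d_X)$ be the set of $f\colon X\to\mathbb R$ with $f(y)-f(x)\le d_X(x,y)$ for all $x,y$. For closed $S\subset X\times Y$ let $d^S_\infty(h,k):=\sup_{S}|h-k|$ (zero if $S=\emptyset$), with induced Hausdorff pseudometric $(d^S_\infty)_H$ on families of functions. The Box distance is $\Box(X,Y):=\inf\max\{1-\pi(S),\,2(d_\infty^S)_H(\operatorname{Lip}^+_1(X)\circ\mathrm{pr}_1,\operatorname{Lip}^+_1(Y)\circ\mathrm{pr}_2)\}$,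 over couplings $\pi$ of $\mu_X,\mu_Y$ and closed $S\subset X\times Y$. A pyramid is a nonempty set of qm-spaces that is downward closed under $\preceq$, in which every two members have a common dominator in the set, and which is $\Box$-closed. $\mathcal P(X):=\{Y: Y\preceq X\}$. $\overline{\,\cdot\,}^{\,\Box}$ is closure in Box distance. **Invariants.** For $N\ge1$, $d_N^+(u,v):=\max_{j}(v_j-u_j)_+$ on $\mathbb R^N$. For $R>0$, $\mathcal M(X;N,R)$ is the set of $F_*\mu_X$ for Borel $F\colon X\to[-R,R]^N$ with $d_N^+(F(x),F(y))\le d_X(x,y)$ for all $x,y$; for a pyramid $\mathcal P$, $\mathcal M(\mathcal P;N,R):=\bigcup_{X\in\mathcal P}\mathcal M(X;N,R)$. Put $\mathbf V^{\to}(\mathcal P):=\sup_{R>0}\sup_{\nu\in\mathcal M(\mathcal P;1,R)}\operatorname{Var}(\nu)$. With $\operatorname{Med}(\nu)$ the closed median interval of $\nu$ and $\lambda>0$, put $\mathsf E_\lambda(\mathcal P):=\sup_{R>0}\sup_{\nu\in\mathcal M(\mathcal P;1,R)}\inf_{m\in\operatorname{Med}(\nu)}\int_{\mathbb R}e^{\lambda(t-m)_+}\,d\nu(t)$ and $\Lambda^+(\mathcal P):=\sup\{\lambda>0:\mathsf E_\lambda(\mathcal P)<+\infty\}$. **The pyramids.** - For $q\in[0,1]$, $k\ge0$: $G_q^k:=(\mathbb R\times\mathbb R^k,D_q,N(0,1/2)\otimes N(0,I_k))$ with $D_q((u,z),(v,z')):=\sqrt{(u-v)^2+|z-z'|^2}+q(v-u)$;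 $\mathcal G_q:=\overline{\bigcup_{k\ge0}\mathcal P(G_q^k)}^{\,\Box}$. - For $\beta>0$, $k\ge0$: $H_\beta^k:=(\mathbb R^k\times(0,+\infty),D^{\mathrm{hor}},N(0,I_k)\otimes\chi_{2\beta})$, where $\chi_{2\beta}$ has density $\frac{2^{1-\beta}}{\Gamma(\beta)}y^{2\beta-1}e^{-y^2/2}$ on $y>0$ and $D^{\mathrm{hor}}((z,y),(z',y')):=\operatorname{arcosh}\frac{|z-z'|^2+y^2+y'^2}{2yy'}+\log\frac{y}{y'}$; $\mathcal H_\beta:=\overline{\bigcup_{k\ge0}\mathcal P(H_\beta^k)}^{\,\Box}$. - For $m\ge1$, $p_i>0$, $\sum_{i=1}^m p_i=1$: $T_m^{\rhd}(p_1,\dots,p_m)$ is $[0,+\infty)\times\{1,\dots,m\}$ with all points $(0,i)$ identified, directed distance $d_{\rhd}((s,i),(t,j)):=2(t-s)_+$ if $i=j$ and $:=2t$ if $i\ne j$, and measure $e^{-s}ds\otimes\sum_ip_i\delta_i$; $\mathcal S_{\rhd}:=\overline{\bigcup_{m,p_1,\dots,p_m}\mathcal P(T_m^{\rhd}(p_1,\dots,p_m))}^{\,\Box}$. All are pyramids. *)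

(* Defs.v *)
From HB Require Import structures.
From mathcomp Require Import all_boot all_order all_algebra.
From mathcomp Require Import all_classical all_reals all_analysis.
From mathcomp Require Import measurable_realfun lra.

Set Implicit Arguments.
Unset Strict Implicit.
Unset Printing Implicit Defensive.

Import Order.TTheory GRing.Theory Num.Theory.
Import numFieldNormedType.Exports.

Local Open Scope classical_set_scope.
Local Open Scope ring_scope.

(** * Directed distances *)

Section directed_distance.
Context {R : realType} {T : Type}.
Implicit Types d : T -> T -> R.

Definition dsym d (x y : T) : R := Num.max (d x y) (d y x).

Definition dopen d : set (set T) :=
  [set U | forall x, U x -> exists2 e : R, 0 < e &
                     forall y, dsym d x y < e -> U y].

Definition dcomplete d : Prop :=
  forall u : nat -> T,
    (forall e : R, 0 < e -> exists N, forall m n, (N <= m)%N -> (N <= n)%N ->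
      dsym d (u m) (u n) < e) ->
    exists x, (fun n => dsym d (u n) x) @ \oo --> (0 : R).

Definition dseparable d : Prop :=
  exists2 D : set T, countable D &
    forall x (e : R), 0 < e -> exists2 y, D y & dsym d x y < e.

Definition Lip1 d : set (T -> R) := [set f | forall x y, f y - f x <= d x y].

End directed_distance.

(* closedness for the product topology on T * U of the two symmetrizations *)
Definition dclosed2 {R : realType} {T U : Type} (d : T -> T -> R)
    (d' : U -> U -> R) : set (set (T * U)) :=
  [set S | forall z, ~ S z -> exists2 e : R, 0 < e &
     forall z', dsym d z.1 z'.1 < e -> dsym d' z.2 z'.2 < e -> ~ S z'].

(** * Qm-spaces *)

(* The data of a qm-space; the axioms are in [is_qm_space]. The model spaces
   G_q^k, H_beta^k and T_m below are given by their data only, which is all that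
   P(X) depends on; members of families are always genuine qm-spaces. *)
Record qm_data (R : realType) := QmData {
  qm_disp : measure_display ;
  qm_sort :> measurableType qm_disp ;
  qm_dist : qm_sort -> qm_sort -> R ;
  qm_meas : {measure set qm_sort -> \bar R} }.

Arguments qm_dist {R} X : rename.
Arguments qm_meas {R} X : rename.

Record is_qm_space (R : realType) (X : qm_data R) : Prop := IsQmSpace {
  qm_dist_ge0 : forall x y, 0 <= qm_dist X x y ;
  qm_distxx : forall x, qm_dist X x x = 0 ;
  qm_dist_triangle : forall x y z,
    qm_dist X x z <= qm_dist X x y + qm_dist X y z ;
  qm_dist_sep : forall x y, dsym (qm_dist X) x y = 0 -> x = y ;
  qm_complete : dcomplete (qm_dist X) ;
  qm_separable : dseparable (qm_dist X) ;
  qm_borel : (measurable : set (set X)) = <<s dopen (qm_dist X) >> ;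
  qm_meas_setT : qm_meas X [set: X] = 1%E ;
  qm_full_support : forall U : set X,
    dopen (qm_dist X) U -> U !=set0 -> (0 < qm_meas X U)%E }.

(* Isomorphism classes are not formed: all the families of qm-spaces below
   are invariant under isomorphism, so comparing them as families of qm-spaces
   or as sets of isomorphism classes amounts to the same. *)
Record qm_space (R : realType) := QmSpace {
  qm_space_data :> qm_data R ;
  qm_spaceP : is_qm_space qm_space_data }.

(* [set (qm_space R)] is ruled out by the universe constraints of [set]. *)
Definition qm_family (R : realType) : Type := qm_space R -> Prop.

Section qm_spaces.
Context {R : realType}.
Local Open Scope ereal_scope.
Implicit Types X Y : qm_data R.

(* [qm_le Y X] is Y \preceq X *)
Definition qm_le Y X : Prop :=
  exists p : X -> Y,
  [/\ measurable_fun [set: X] p,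
      forall A, measurable A -> qm_meas Y A = qm_meas X (p @^-1` A) &
      forall x y, (qm_dist Y (p x) (p y) <= qm_dist X x y)%R].

Definition qm_down X : qm_family R := fun Y : qm_space R => qm_le Y X.

Definition dist_sup {T : Type} (S : set T) (h k : T -> R) : \bar R :=
  maxe 0 (ereal_sup [set `|h z - k z|%:E | z in S]).

Definition hausdorff {T : Type} (dist : T -> T -> \bar R) (A B : set T) :
    \bar R :=
  maxe (ereal_sup [set ereal_inf [set dist h k | k in B] | h in A])
       (ereal_sup [set ereal_inf [set dist h k | h in A] | k in B]).

Definition coupling X Y (pi : probability (X * Y)%type R) : Prop :=
  (forall A, measurable A -> pi (A `*` [set: Y]) = qm_meas X A) /\
  (forall B, measurable B -> pi ([set: X] `*` B) = qm_meas Y B).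

Definition box_dist X Y : \bar R :=
  ereal_inf [set c | exists (pi : probability (X * Y)%type R)
                            (S : set (X * Y)),
    [/\ coupling pi, dclosed2 (qm_dist X) (qm_dist Y) S &
        c = maxe (1 - pi S)
              (2%:E * hausdorff (dist_sup S)
                        [set f \o fst | f in Lip1 (qm_dist X)]
                        [set g \o snd | g in Lip1 (qm_dist Y)])]].

Definition box_closure (P : qm_family R) : qm_family R :=
  fun X : qm_space R => forall e : R, (0 < e)%R -> exists2 Y : qm_space R, P Y & box_dist X Y < e%:E.

Definition pyramid (P : qm_family R) : Prop :=
  [/\ exists X : qm_space R, P X,
      forall X Y : qm_space R, P X -> qm_le Y X -> P Y,
      forall X Y : qm_space R, P X -> P Y ->
        exists Z : qm_space R,
        [/\ P Z, qm_le X Z & qm_le Y Z] &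
      forall X : qm_space R, box_closure P X -> P X].

(** * Invariants *)

(* M(X; 1, r), with R^1 identified with R *)
Definition qm_M1 X (r : R) : set (probability (measurableTypeR R) R) :=
  [set nu | exists F : X -> measurableTypeR R,
    [/\ measurable_fun [set: X] F,
        forall x, (- r <= F x <= r)%R,
        forall x y, (Num.max (F y - F x) 0 <= qm_dist X x y)%R &
        forall A, measurable A -> nu A = qm_meas X (F @^-1` A)]].

Definition pyr_M1 (P : qm_family R) (r : R) :
    set (probability (measurableTypeR R) R) :=
  [set nu | exists2 X : qm_space R, P X & qm_M1 X r nu].

Definition Vdir (P : qm_family R) : \bar R :=
  ereal_sup [set ereal_sup [set 'V_nu[idfun] | nu in pyr_M1 P r]
            | r in [set r : R | (0 < r)%R]].

Definition Med (nu : probability (measurableTypeR R) R) : set R :=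
  [set m | (2^-1)%:E <= nu [set` `]-oo, m]] /\ (2^-1)%:E <= nu [set` `[m, +oo[]].

Definition Eexp (lam : R) (P : qm_family R) : \bar R :=
  ereal_sup
    [set ereal_sup
      [set ereal_inf
        [set \int[nu]_t (expR (lam * Num.max (t - m) 0))%:E | m in Med nu]
      | nu in pyr_M1 P r]
    | r in [set r : R | (0 < r)%R]].

Definition Lambda (P : qm_family R) : \bar R :=
  ereal_sup [set lam%:E | lam in [set lam : R | (0 < lam)%R /\
                                                Eexp lam P < +oo]].

End qm_spaces.

(** * Gaussian pyramids *)

Section gaussian.
Context {R : realType}.
Local Notation mR := (measurableTypeR R).

Definition tcons k (x : mR * k.-tuple mR) : k.+1.-tuple mR :=
  [tuple of x.1 :: x.2].

Let measurable_tcons k : measurable_fun [set: mR * k.-tuple mR] (@tcons k).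
Proof.
apply: (@measurable_cons _ _ _ _ fst k snd).
  exact: measurable_fst.
exact: measurable_snd.
Qed.

HB.instance Definition _ k :=
  @isMeasurableFun.Build _ _ _ _ (@tcons k) (@measurable_tcons k).

(* N(0, I_k), with R^k represented by k.-tuple R *)
Fixpoint std_gauss (k : nat) : probability (k.-tuple mR) R :=
  match k with
  | 0%N => \d_([tuple] : 0.-tuple mR)
  | k'.+1 => distribution (normal_prob 0 1 \x std_gauss k')%E (@tcons k')
  end.

Definition sqdist k (z z' : k.-tuple R) : R :=
  \sum_(i < k) (tnth z i - tnth z' i) ^+ 2.

Definition gauss_dist (q : R) k (x y : mR * k.-tuple mR) : R :=
  Num.sqrt ((x.1 - y.1) ^+ 2 + sqdist x.2 y.2) + q * (y.1 - x.1).

(* [normal_prob] takes the standard deviation as second parameter *)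
Definition gauss_qm (q : R) (k : nat) : qm_data R :=
  QmData (@gauss_dist q k)
    (normal_prob 0 (Num.sqrt 2^-1) \x std_gauss k)%E.

Definition pyrG (q : R) : qm_family R :=
  box_closure (fun Y => exists k, qm_down (gauss_qm q k) Y).

End gaussian.

(** * Hyperbolic pyramids *)

Section hyperbolic.
Context {R : realType}.
Local Notation mR := (measurableTypeR R).

Definition posreal : Type := {y : R | 0 < y}.

HB.instance Definition _ := Choice.on posreal.

Definition pos1 : posreal := Sub (1 : R) ltr01.

HB.instance Definition _ := isPointed.Build posreal pos1.

Definition posval (y : posreal) : mR := val y.

Definition mposreal := g_sigma_algebra_preimageType posval.

HB.instance Definition _ := Measurable.on mposreal.

Definition Gamma (b : R) : R :=
  \int[lebesgue_measure]_(t in `]0, +oo[) (t `^ (b - 1) * expR (- t)).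

Definition chi_pdf (b y : R) : R :=
  2 `^ (1 - b) / Gamma b * y `^ (2 * b - 1) * expR (- (y ^+ 2 / 2)).

(* the law chi_{2b} on the positive reals *)
Definition chi_law (b : R) (A : set mposreal) : \bar R :=
  (\int[lebesgue_measure]_(y in posval @` A) (chi_pdf b y)%:E)%E.

Let Gamma_ge0 b : 0 <= Gamma b.
Proof.
by apply: Rintegral_ge0 => t _; rewrite mulr_ge0 ?powR_ge0 ?expR_ge0.
Qed.

Let chi_pdf_ge0 b y : 0 <= chi_pdf b y.
Proof. by rewrite !mulr_ge0 ?powR_ge0 ?expR_ge0 ?invr_ge0. Qed.

Let measurable_chi_pdf b : measurable_fun [set: mR] (chi_pdf b).
Proof.
apply: measurable_funM; last first.
  apply: measurableT_comp => //; apply: measurableT_comp => //.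
  by apply: measurable_funM => //; exact: measurable_funX.
by apply: measurable_funM.
Qed.

Let measurable_posval_image (A : set mposreal) :
  measurable A -> measurable (posval @` A : set mR).
Proof.
move=> [B mB <-]; rewrite setTI.
rewrite (_ : _ @` _ = B `&` [set` `]0, +oo[]); first exact: measurableI.
apply/seteqP; split=> [_ [y By <-]|y [By /=]].
  by split=> //=; rewrite in_itv/= andbT; exact: (valP y).
rewrite in_itv/= andbT => y0.
by exists (Sub y y0 : posreal).
Qed.

Let chi_law0 b : chi_law b set0 = 0%E.
Proof. by rewrite /chi_law image_set0 integral_set0. Qed.

Let chi_law_ge0 b A : (0 <= chi_law b A)%E.
Proof. by apply: integral_ge0 => y _; rewrite lee_fin. Qed.

Let chi_law_sigma_additive b : semi_sigma_additive (chi_law b).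
Proof.
move=> F mF tF mUF; rewrite /chi_law image_bigcup ge0_integral_bigcup//=.
- by apply: is_cvg_ereal_nneg_natsum_cond => n _ _; exact: chi_law_ge0.
- by move=> n; exact: measurable_posval_image.
- apply/measurable_EFinP; apply: measurable_funTS; exact: measurable_chi_pdf.
- by move=> x _; rewrite lee_fin.
- apply/trivIsetP => i j _ _ ij; rewrite -subset0.
  move=> _ [[x Fx <-] [y Fy /val_inj yx]]; rewrite yx in Fy.
  have : (F i `&` F j) x by [].
  by move/trivIsetP : tF => /(_ i j I I ij) ->.
Qed.

HB.instance Definition _ b := isMeasure.Build _ _ _ (chi_law b)
  (chi_law0 b) (chi_law_ge0 b) (@chi_law_sigma_additive b).

Definition arcosh (x : R) : R := ln (x + Num.sqrt (x ^+ 2 - 1)).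

Definition hor_dist k (x y : k.-tuple mR * mposreal) : R :=
  arcosh ((sqdist x.1 y.1 + posval x.2 ^+ 2 + posval y.2 ^+ 2)
          / (2 * posval x.2 * posval y.2))
  + ln (posval x.2 / posval y.2).

(* [\x] wants its second factor, [\x^] its first factor, to be sigma-finite *)
Definition hor_qm (b : R) (k : nat) : qm_data R :=
  QmData (@hor_dist k) (std_gauss k \x^ chi_law b)%E.

Definition pyrH (b : R) : qm_family R :=
  box_closure (fun Y => exists k, qm_down (hor_qm b k) Y).

End hyperbolic.

(** * Pyramid of the directed stars *)

Section star.
Context {R : realType}.
Local Notation mR := (measurableTypeR R).

(* The star with m.+1 legs: the only pair of height 0 that is kept, (0, ord0),
   represents the common point of the legs. *)
Definition star (m : nat) : Type :=
  {x : R * 'I_m.+1 | (0 <= x.1) && ((x.1 == 0) ==> (x.2 == ord0))}.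

HB.instance Definition _ m := Choice.on (star m).

Lemma star_centerP m :
  (0 <= (0 : R, ord0 : 'I_m.+1).1) &&
  (((0 : R, ord0 : 'I_m.+1).1 == 0) ==>
   ((0 : R, ord0 : 'I_m.+1).2 == ord0)).
Proof. by rewrite /= lexx !eqxx. Qed.

Definition star_center m : star m := Sub (0 : R, ord0) (star_centerP m).

HB.instance Definition _ m := isPointed.Build (star m) (star_center m).

Definition height m (x : star m) : R := (val x).1.
Definition leg m (x : star m) : 'I_m.+1 := (val x).2.

Definition star_dist m (x y : star m) : R :=
  if leg x == leg y then 2 * Num.max (height y - height x) 0
  else 2 * height y.

Definition mstar m := g_sigma_algebraType (dopen (@star_dist m)).

HB.instance Definition _ m := Measurable.on (mstar m).

(* The class of (s, i) for s >= 0; the negative half-line goes to the center. *)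
Definition star_proj m (i : 'I_m.+1) (s : R) : mstar m :=
  insubd (star_center m) (s, i).

Lemma star_projE m (i : 'I_m.+1) s : height (star_proj i s) = Num.max s 0.
Proof.
rewrite /height /star_proj val_insubd /=.
by case: (ltgtP s 0) => s0 //=; case: ifP.
Qed.

Lemma star_proj_leg m (i : 'I_m.+1) s :
  leg (star_proj i s) = if 0 < s then i else ord0.
Proof.
rewrite /leg /star_proj val_insubd /=.
by case: (ltgtP s 0) => s0 //=; case: eqP.
Qed.

Lemma dsym_star_proj m (i : 'I_m.+1) s t :
  dsym (@star_dist m) (star_proj i s) (star_proj i t) <= 2 * `|s - t|.
Proof.
rewrite /dsym /star_dist !star_projE !star_proj_leg.
have s0 : Num.max s 0 = if 0 < s then s else 0 by case: (ltgtP s 0).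
have t0 : Num.max t 0 = if 0 < t then t else 0 by case: (ltgtP t 0).
rewrite s0 t0 {s0 t0}; have := ler_norm (s - t); have := ler_norm (t - s).
rewrite (distrC t s).
case: (ltP 0 s) => ?; case: (ltP 0 t) => ?; rewrite ?eqxx 1?(eq_sym ord0);
  do ?[case: ifP => _]; rewrite !maxEle; do ?[case: ifP => _]; lra.
Qed.

Lemma measurable_star_proj m (i : 'I_m.+1) :
  measurable_fun [set: mR] (@star_proj m i).
Proof.
apply: (@measurability _ _ _ (mstar m) setT _ (dopen (@star_dist m))) => //.
move=> _ [U oU <-]; rewrite setTI; apply: open_measurable.
rewrite openE => s /= Us; have [e e0 He] := oU _ Us.
apply/nbhs_ballP; exists (e / 2) => /=; first by rewrite divr_gt0.
move=> t /= st; apply: He; apply: le_lt_trans (dsym_star_proj i s t) _.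
by rewrite -ltr_pdivlMl// mulrC.
Qed.

(* the image in the star of the measure e^{-s}ds (x) \sum_i p_i delta_i *)
Definition star_law m (p : 'I_m.+1 -> {posnum R}) (A : set (mstar m)) : \bar R :=
  (\sum_(i < m.+1)
     (p i)%:num%:E * exponential_prob 1 (@star_proj m i @^-1` A))%E.

Section star_law_measure.
Variables (m : nat) (p : 'I_m.+1 -> {posnum R}).

Let exp_measure : exists E : {measure set mR -> \bar R},
  forall A, exponential_prob 1 A = E A.
Proof.
by unshelve eexists (exponential_prob 1 : {measure set mR -> \bar R}).
Qed.

Let star_law0 : star_law p set0 = 0%E.
Proof.
have [E EE] := exp_measure.
by rewrite /star_law big1// => i _; rewrite preimage_set0 EE measure0 mule0.
Qed.

Let star_law_ge0 A : (0 <= star_law p A)%E.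
Proof.
have [E EE] := exp_measure.
by apply: sume_ge0 => i _; apply: mule_ge0 => //; rewrite EE.
Qed.

Let star_law_sigma_additive : semi_sigma_additive (star_law p).
Proof.
have [E EE] := exp_measure.
move=> F mF tF mUF; rewrite [X in _ --> X](_ : _ =
    lim ((fun n => \sum_(0 <= i < n) star_law p (F i)) @ \oo)%E).
  by apply: is_cvg_ereal_nneg_natsum => k _; exact: star_law_ge0.
rewrite nneseries_sum//; last first.
  by move=> i j _; apply: mule_ge0 => //; rewrite EE.
apply: eq_bigr => /= i _; rewrite nneseriesZl//; last first.
  by move=> k _; rewrite EE measure_ge0.
congr (_ * _)%E; rewrite preimage_bigcup EE.
under eq_eseriesr do rewrite EE.
have mF' k : measurable (@star_proj m i @^-1` F k).
  by rewrite -[X in measurable X]setTI; exact: measurable_star_proj.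
apply: measure_semi_bigcup => //; last exact: bigcupT_measurable.
apply/trivIsetP => j k _ _ jk; rewrite -preimage_setI.
by move/trivIsetP : tF => /(_ _ _ _ _ jk) ->//; rewrite preimage_set0.
Qed.

HB.instance Definition _ := isMeasure.Build _ _ _ (star_law p)
  star_law0 star_law_ge0 star_law_sigma_additive.

End star_law_measure.

(* the m of the usual notation T_m(p_1, ..., p_m) is here m.+1 *)
Definition star_qm m (p : 'I_m.+1 -> {posnum R}) : qm_data R :=
  QmData (@star_dist m : mstar m -> mstar m -> R) (star_law p).

Definition pyrS : qm_family R :=
  box_closure (fun Y => exists (m : nat) (p : 'I_m.+1 -> {posnum R}),
    \sum_(i < m.+1) (p i)%:num = 1 /\ qm_down (star_qm p) Y).

End star.

(* Main.v *)
(* Bounded 1-Lipschitz observables of a space in a Box closure have, up to small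
   errors, the laws of observables of the models, so that bounds on exponential
   moments and variances pass from the models to the pyramids.  For Gaussian models
   property (tau), a consequence of the Prekopa-Leindler inequality on the line
   which tensorizes, bounds all exponential moments.  On a star, f(s, i) grows from
   its value at the center by at most 2 s, and s is exponential of parameter 1: hence
   exponential moments up to 1/2 and variances at most 4, and the leg coordinate 2 s
   is extremal.  On the hyperbolic models - 2 ln y is 1-Lipschitz; up to a constant it
   is minus the logarithm of a Gamma variable of parameter beta.  Its exponential
   moment of order beta is infinite, which separates H_beta from G_q; the lower tail
   of its law is too long for a star; and its variance is the sum of the
   1 / (beta + n)^2, which is pi^2 / 2 for beta = 1/2. *)

(* Upper and lower bounds use the models differently. An upper bound only needs integrals on the
   model data, since it is a target of domination. A lower bound needs a genuine qm-space inside the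
   pyramid: it is the support of the law of one observable, with the distance (y - x)_+, which is a
   quotient of the model.

   A median is not stable under Box limits: an error e moves the level by e and loses mass e. The
   bounds on the models are therefore proved for every level m such that {G <= m} has mass above a
   fixed threshold smaller than 1/2, namely 1/4 for Gaussians and 0 for stars.

   The threshold 0 also serves to separate H_beta from the stars. For large beta neither the
   infinite moment of order beta nor the variance of the logarithm does it: stars have infinite
   moments of every order from 1/2 on, and that variance becomes small. But an observable of a star
   is minimal at the center, so its exponential moment above any level of positive mass, however
   low, has the same bound. The logarithm in H_beta charges every interval of the line, so its
   truncations at -r, seen from the level -r, violate this bound as r grows. *)
Require Import Defs.
From HB Require Import structures.
From mathcomp Require Import all_boot all_order all_algebra.
From mathcomp Require Import all_classical all_reals all_analysis.
From mathcomp Require Import measurable_realfun lra ring zify.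

Set Implicit Arguments.
Unset Strict Implicit.
Unset Printing Implicit Defensive.

Import Order.TTheory GRing.Theory Num.Theory.
Import numFieldNormedType.Exports.
Local Open Scope ring_scope.

(** * Observables and Box closures *)

Section measure_tools.
Local Open Scope classical_set_scope.
Local Open Scope ereal_scope.

Lemma ge0_integral_image {R : realType} d d' (T : measurableType d)
    (U : measurableType d') (mu : {measure set T -> \bar R})
    (nu : {measure set U -> \bar R}) (p : T -> U) (f : U -> \bar R) :
  measurable_fun setT p ->
  (forall A, measurable A -> nu A = mu (p @^-1` A)) ->
  measurable_fun setT f -> (forall u, 0 <= f u) ->
  \int[nu]_u f u = \int[mu]_t f (p t).
Proof.
move=> mp numu mf f0.
rewrite (eq_measure_integral (pushforward mu p)) => [|A mA _]; last exact: numu.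
by rewrite ge0_integral_pushforward.
Qed.

Lemma bigcup_countable_measurable d (T : measurableType d) I (D : set I)
    (F : I -> set T) :
  countable D -> (forall i, D i -> measurable (F i)) ->
  measurable (\bigcup_(i in D) F i).
Proof.
move=> /countable_injP[f injf] mF.
rewrite [X in measurable X](_ : _ =
    \bigcup_n \bigcup_(i in D `&` [set i | f i = n]) F i); last first.
  apply/seteqP; split=> [x [i Di Fix]|x [n _ [i [Di _] Fix]]]; last by exists i.
  by exists (f i) => //; exists i.
apply: bigcup_measurable => n _.
have [[i [Di fin]]|nex] := pselect (exists i, D i /\ f i = n).
  rewrite [X in measurable X](_ : _ = F i); first exact: mF.
  apply/seteqP; split=> [x [j [Dj fjn] Fjx]|x Fix]; last by exists i.
  by rewrite (injf i j) ?inE// fin.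
rewrite [X in measurable X](_ : _ = set0); first exact: measurable0.
by apply/seteqP; split=> // x [i [Di fin] _]; case: nex; exists i.
Qed.

End measure_tools.

Section transfer.
Local Open Scope classical_set_scope.
Context {R : realType}.
Implicit Types X Y : qm_space R.

Lemma dsymC T (d : T -> T -> R) x y : dsym d x y = dsym d y x.
Proof. exact: maxC. Qed.

Lemma dsym_triangle X (x y z : X) :
  dsym (qm_dist X) x z <= dsym (qm_dist X) x y + dsym (qm_dist X) y z.
Proof.
have tri := qm_dist_triangle (qm_spaceP X).
rewrite {1}/dsym ge_max; apply/andP; split.
  by apply: le_trans (tri x y z) _; rewrite lerD// /dsym le_max lexx.
rewrite addrC; apply: le_trans (tri z y x) _.
by rewrite lerD// /dsym le_max lexx orbT.
Qed.

Lemma measurable_dopen X (U : set X) : dopen (qm_dist X) U -> measurable U.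
Proof. by move=> oU; rewrite (qm_borel (qm_spaceP X)); exact: sub_gen_smallest. Qed.

Lemma measurable_dball X (a : X) e : measurable [set x | dsym (qm_dist X) a x < e].
Proof.
apply: measurable_dopen => x /= axe.
exists (e - dsym (qm_dist X) a x); first by rewrite subr_gt0.
move=> y xy; apply: le_lt_trans (dsym_triangle a x y) _.
by rewrite addrC -ltrBrDr.
Qed.

(** Couplings live on the product sigma-algebra, while S is closed for the product topology. By
    separability the complement of S is a countable union of products of balls with centers in the
    dense sets and radii 1 / (n + 1). *)
Lemma measurable_dclosed2 X Y (S : set (X * Y)) :
  dclosed2 (qm_dist X) (qm_dist Y) S -> measurable S.
Proof.
move=> cS.
have [D cD dD] := qm_separable (qm_spaceP X).
have [D' cD' dD'] := qm_separable (qm_spaceP Y).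
pose B (i : X * Y * nat) := [set x | dsym (qm_dist X) i.1.1 x < i.2.+1%:R^-1] `*`
                            [set y | dsym (qm_dist Y) i.1.2 y < i.2.+1%:R^-1].
pose I := ((D `*` D') `*` [set: nat]) `&` [set i | B i `<=` ~` S].
suff -> : S = ~` \bigcup_(i in I) B i.
  apply: measurableC; apply: bigcup_countable_measurable => [|i _].
    apply: (@sub_countable _ _ _ ((D `*` D') `*` [set: nat])).
      by apply: subset_card_le; exact: subIsetl.
    by apply: countableX => //; exact: countableX.
  by apply: measurableX; exact: measurable_dball.
rewrite -[LHS]setCK; congr (~` _); apply/seteqP; split=> [z nSz|z [i [_ Bi] /Bi//]].
have [e e0 ze] := cS z nSz.
pose n := Num.truncn (2 / e).
have ne : n.+1%:R^-1 < e / 2.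
  rewrite -[e / 2]invrK ltf_pV2 ?posrE ?invr_gt0 ?divr_gt0// invfM invrK mulrC.
  by rewrite truncnS_gt.
have n0 : 0 < n.+1%:R^-1 :> R by [].
have [a Da za] := dD z.1 _ n0; have [b Db zb] := dD' z.2 _ n0.
exists ((a, b), n) => /=; last by split=> /=; rewrite dsymC.
split=> // z' [/= az' bz']; apply: ze.
  apply: le_lt_trans (dsym_triangle _ a _) _.
  by rewrite (splitr e) ltrD// (lt_trans _ ne).
apply: le_lt_trans (dsym_triangle _ b _) _.
by rewrite (splitr e) ltrD// (lt_trans _ ne).
Qed.

Lemma Lip1_dsym T (d : T -> T -> R) (f : T -> R) x y :
  Lip1 d f -> `|f x - f y| <= dsym d x y.
Proof.
move=> Lf; rewrite /dsym le_max ler_norml lerNl opprB.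
have := Lf x y; have := Lf y x.
have [//|] := lerP (f x) (f y); lra.
Qed.

(** Stated for bare data whose open sets are measurable, so that it applies to the star model as
    well as to qm-spaces. *)
Lemma measurable_Lip1_dopen (A : qm_data R) (f : A -> R) :
  (forall U : set A, dopen (qm_dist A) U -> measurable U) ->
  Lip1 (qm_dist A) f -> measurable_fun [set: A] (f : A -> measurableTypeR R).
Proof.
move=> mU Lf.
apply: (measurability _ (RGenOpens.measurableE R)).
move=> _ [_ [a [b ->]] <-]; rewrite setTI; apply: mU => x Ux.
have /nbhs_ballP[e /= e0 He] : nbhs (f x) `]a, b[%classic.
  by apply: open_nbhs_nbhs; split => //; exact: interval_open.
exists e => // y xy; apply: He; rewrite /ball/=.
exact: le_lt_trans (Lip1_dsym x y Lf) xy.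
Qed.

Lemma measurable_Lip1 X (f : X -> R) :
  Lip1 (qm_dist X) f -> measurable_fun [set: X] (f : X -> measurableTypeR R).
Proof. by apply: measurable_Lip1_dopen => U; exact: measurable_dopen. Qed.

Definition clip (r s : R) := Num.max (- r) (Num.min r s).

Lemma clip_itv r s : 0 <= r -> - r <= clip r s <= r.
Proof.
by move=> r0; rewrite /clip le_max lexx/= ge_max ge_min lexx/= andbT ge0_cp.
Qed.

Lemma clip_id r s : - r <= s <= r -> clip r s = s.
Proof. by move=> /andP[rs sr]; rewrite /clip min_r// max_r. Qed.

Lemma clip_mono r s t : s <= t -> clip r s <= clip r t.
Proof.
move=> st; rewrite /clip ge_max !le_max lexx/= le_min !ge_min lexx st/=.
by rewrite !orbT.
Qed.

Lemma clip_le r s t : s <= t -> clip r t - clip r s <= t - s.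
Proof.
rewrite /clip => st; case: (leP r s) => ?; case: (leP r t) => ?;
  case: (leP (- r) r) => ?; case: (leP (- r) s) => ?; case: (leP (- r) t) => ?;
  lra.
Qed.

Lemma clip_dist r s t : `|clip r s - clip r t| <= `|s - t|.
Proof.
wlog st : s t / s <= t => [th|].
  by have /orP[/th//|/th] := le_total s t; rewrite distrC (distrC t).
by rewrite distrC (distrC s) !ger0_norm ?subr_ge0 ?clip_mono// clip_le.
Qed.

Lemma Lip1_clip T (d : T -> T -> R) r f : (forall x y, 0 <= d x y) ->
  Lip1 d f -> Lip1 d (clip r \o f).
Proof.
move=> d0 Lf x y /=; have [fxy|/ltW fyx] := leP (f x) (f y).
  by apply: le_trans (clip_le _ fxy) _; exact: Lf.
by apply: le_trans (d0 x y); rewrite subr_le0 clip_mono.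
Qed.

Lemma measurable_clip r : measurable_fun [set: R] (clip r).
Proof. by apply: measurable_maxr => //; exact: measurable_minr. Qed.

Lemma hausdorff_lt T (dist : T -> T -> \bar R) (A B : set T) h c :
  (hausdorff dist A B < c)%E -> A h -> exists2 k, B k & (dist h k < c)%E.
Proof.
rewrite /hausdorff gt_max => /andP[supA _] Ah.
have /ereal_inf_lt[_ [k Bk <-] hk] :
    (ereal_inf [set dist h k | k in B] < c)%E.
  by apply: le_lt_trans supA; apply: ereal_sup_ubound; exists h.
by exists k.
Qed.

Lemma dist_sup_lt T (S : set T) (h k : T -> R) e z :
  (dist_sup S h k < e%:E)%E -> S z -> `|h z - k z| < e.
Proof.
rewrite /dist_sup gt_max => /andP[_ supS] Sz; rewrite -lte_fin.
by apply: le_lt_trans supS; apply: ereal_sup_ubound; exists z.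
Qed.

(* Up to an error [e], laws of functions into [-r, r] are compared by testing
   them against pairs of functions which are ordered at distance [e]. *)
Definition dominated_upto (r e : R) (A B : qm_data R) (F : A -> R) (G : B -> R)
    : Prop :=
  forall (phi psi : R -> \bar R) (M : R),
    measurable_fun setT phi -> measurable_fun setT psi ->
    (forall s, 0 <= phi s)%E -> (forall s, 0 <= psi s)%E ->
    (forall s, - r <= s <= r -> (phi s <= M%:E)%E) ->
    (forall s t, - r <= s <= r -> - r <= t <= r -> `|s - t| <= e ->
       (phi s <= psi t)%E) ->
    (\int[qm_meas A]_x phi (F x) <=
     \int[qm_meas B]_y psi (G y) + (M * e)%:E)%E.

Definition observable (r : R) (A : qm_data R) (F : A -> R) : Prop :=
  [/\ measurable_fun [set: A] F, Lip1 (qm_dist A) F & forall x, - r <= F x <= r].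

(** A coupling and a set S realizing a Box distance below e give g in [Lip1] within e / 2 of F on S,
    and G is g truncated to [-r, r]. On S the two test functions compare pointwise; off S, a set of
    mass less than e, the first one is at most M. *)
Lemma box_transfer (P : qm_family R) X (F : X -> R) (r e : R) :
  box_closure P X -> observable r F -> 0 < e ->
  exists2 Y : qm_space R, P Y & exists2 G : Y -> R,
    observable r G & dominated_upto r e F G.
Proof.
move=> clX [_ LF Fr] e0; have [Y PY] := clX e e0.
move=> /ereal_inf_lt[_ [pi [S [[pi1 pi2] cS ->]]]].
rewrite gt_max => /andP[piS].
rewrite -lte_pdivlMl// -EFinM => haus.
have [|_ [g Lg <-] Fg] := hausdorff_lt (h := F \o fst) haus; first by exists F.
exists Y => //.
have r0 : 0 <= r.
  by move: (Fr point) => /andP[+ +]; move=> /le_trans /[apply]; lra.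
have d0 := qm_dist_ge0 (qm_spaceP Y).
have Lcg := Lip1_clip r d0 Lg.
exists (clip r \o g).
  by split=> // [|y]; [exact: measurable_Lip1|exact: clip_itv].
move=> phi psi M mphi mpsi phi0 psi0 phiM phipsi.
have mS := measurable_dclosed2 cS.
have mF : measurable_fun [set: X] (F : X -> measurableTypeR R).
  exact: measurable_Lip1.
have mG : measurable_fun [set: Y] (clip r \o g : Y -> measurableTypeR R).
  exact: measurable_Lip1.
rewrite (@ge0_integral_image _ _ _ _ _ pi (qm_meas X) fst)//; last 2 first.
- by move=> A mA; rewrite -pi1//; congr (pi _); apply/seteqP; split=> z // [].
- exact: measurableT_comp.
rewrite (@ge0_integral_image _ _ _ _ _ pi (qm_meas Y) snd)//; last 2 first.
- by move=> A mA; rewrite -pi2//; congr (pi _); apply/seteqP; split=> z // [].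
- exact: measurableT_comp.
have mf : measurable_fun [set: X * Y] (fun z => phi (F z.1)).
  apply: (measurableT_comp mphi); exact: (measurableT_comp mF).
have mg : measurable_fun [set: X * Y] (fun z => psi (clip r (g z.2))).
  apply: (measurableT_comp mpsi); exact: (measurableT_comp mG).
rewrite -[in leLHS](setUv S) ge0_integral_setU//=; last 3 first.
- exact: measurableC.
- by rewrite setUv.
- exact/disj_setPCl.
apply: leeD.
  apply: (@le_trans _ _ (\int[pi]_(z in S) psi (clip r (g z.2)))%E).
    apply: ge0_le_integral => //; [exact: measurable_funTS..|].
    move=> z Sz; apply: phipsi => //; first exact: clip_itv.
    rewrite -(clip_id (Fr z.1)); apply: le_trans (clip_dist _ _ _) _.
    by apply/ltW; apply: lt_le_trans (dist_sup_lt Fg Sz) _; lra.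
  exact: ge0_subset_integral.
apply: (@le_trans _ _ (\int[pi]_(z in ~` S) M%:E)%E).
  apply: ge0_le_integral => //; [exact: measurableC|exact: measurable_funTS|].
  by move=> z _; exact: phiM.
rewrite integral_cst//; last exact: measurableC.
have M0 : 0 <= M.
  by rewrite -lee_fin; apply: le_trans (phi0 (F point)) _; exact: phiM.
rewrite EFinM; apply: lee_pmul; rewrite ?lee_fin//.
by move: piS => /ltW; rewrite -probability_setC.
Qed.

Lemma qm_le_observable (A B : qm_data R) (F : A -> R) r :
  qm_le A B -> observable r F ->
  exists2 G : B -> R, observable r G &
    forall phi, measurable_fun setT phi -> (forall s, 0 <= phi s)%E ->
      (\int[qm_meas A]_x phi (F x) = \int[qm_meas B]_y phi (G y))%E.
Proof.
move=> [p [mp pA Lp]] [mF LF Fr]; exists (F \o p).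
  split=> [|x y|x]; [exact: measurableT_comp| |exact: Fr].
  by apply: le_trans (Lp x y); exact: LF.
move=> phi mphi phi0; apply: (ge0_integral_image mp pA) => //.
exact: measurableT_comp.
Qed.

Lemma model_transfer (C : qm_data R -> Prop) (P : qm_family R) X (F : X -> R)
    (r e : R) :
  (forall Y : qm_space R, P Y -> exists2 Z, C Z & qm_le Y Z) ->
  box_closure P X -> observable r F -> 0 < e ->
  exists2 Z : qm_data R, C Z & exists2 G : Z -> R,
    observable r G & dominated_upto r e F G.
Proof.
move=> PC clX oF e0; have [Y PY [G oG FG]] := box_transfer clX oF e0.
have [Z CZ YZ] := PC Y PY; have [H oH GH] := qm_le_observable YZ oG.
exists Z => //; exists H => // phi psi M mphi mpsi phi0 psi0 phiM phipsi.
by rewrite -GH//; exact: FG.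
Qed.

End transfer.

(** * First two moments and the variance of the law of a real function *)

Section second_moment.
Local Open Scope classical_set_scope.
Context {R : realType} d (T : measurableType d) (mu : {measure set T -> \bar R}).
Hypothesis mu1 : mu [set: T] = 1%E.

Lemma bounded_integrable (F : T -> R) r :
  measurable_fun [set: T] F -> (forall x, - r <= F x <= r) ->
  mu.-integrable [set: T] (EFin \o F).
Proof.
move=> mF Fr; apply: measurable_bounded_integrable => //; first by rewrite mu1 ltry.
exists r; split; first exact: num_real.
by move=> M rM x _ /=; rewrite (le_trans _ (ltW rM))// ler_norml.
Qed.

Lemma cst_integrable (c : R) : mu.-integrable [set: T] (EFin \o (fun=> c)).
Proof.
by apply: (@bounded_integrable _ `|c|) => // _; rewrite -ler_norml.
Qed.

Lemma bounded_integrable_sqr (F : T -> R) r :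
  measurable_fun [set: T] F -> (forall x, - r <= F x <= r) ->
  mu.-integrable [set: T] (EFin \o (fun x => F x ^+ 2)).
Proof.
move=> mF Fr; apply: (@bounded_integrable _ (r ^+ 2)); first exact: measurable_funX.
by move=> x; have /andP[? ?] := Fr x; apply/andP; split; nra.
Qed.

Lemma integral_sqrB (F : T -> R) c :
  mu.-integrable [set: T] (EFin \o F) ->
  mu.-integrable [set: T] (EFin \o (fun x => F x ^+ 2)) ->
  (\int[mu]_x ((F x - c) ^+ 2)%:E)%E =
  (\int[mu]_x (F x ^+ 2) - 2 * c * \int[mu]_x F x + c ^+ 2)%:E.
Proof.
move=> iF iF2.
have icst := cst_integrable (c ^+ 2).
have icF : mu.-integrable [set: T] (EFin \o (fun x => (- 2 * c) * F x)).
  by apply: eq_integrable (integrableZl measurableT (- 2 * c) iF).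
have iD := integrableD measurableT iF2 icF.
have -> : (\int[mu]_x ((F x - c) ^+ 2)%:E =
           \int[mu]_x (F x ^+ 2 + (- 2 * c) * F x + c ^+ 2)%:E)%E.
  by apply: eq_integral => x _; congr EFin; ring.
transitivity (\int[mu]_x (F x ^+ 2 + (- 2 * c) * F x + c ^+ 2))%:E.
  rewrite /Rintegral fineK//; apply: integrable_fin_num => //.
  by apply: eq_integrable (integrableD measurableT iD icst).
congr EFin; rewrite RintegralD//.
rewrite RintegralD// RintegralZl// Rintegral_cst// mu1 mulr1; ring.
Qed.

Lemma variance_image (F : T -> R) (nu : probability (measurableTypeR R) R) :
  measurable_fun [set: T] F ->
  mu.-integrable [set: T] (EFin \o F) ->
  mu.-integrable [set: T] (EFin \o (fun x => F x ^+ 2)) ->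
  (forall A, measurable A -> nu A = mu (F @^-1` A)) ->
  ('V_nu[idfun] = (\int[mu]_x (F x ^+ 2) - (\int[mu]_x F x) ^+ 2)%:E)%E.
Proof.
move=> mF iF iF2 nuF; rewrite /variance unlock.
have EE : ('E_nu[idfun])%E = (\int[mu]_x (F x)%:E)%E.
  rewrite unlock.
  transitivity (\int[pushforward mu (F : T -> measurableTypeR R)]_t t%:E)%E.
    by apply: eq_measure_integral => A mA _; exact: nuF.
  by rewrite integral_pushforward.
rewrite EE unlock.
set E1 := \int[mu]_x F x.
rewrite (@ge0_integral_image _ _ _ T _ mu nu (F : T -> measurableTypeR R)
  (fun t => ((t - E1) ^+ 2)%:E))//=.
- by rewrite integral_sqrB// -/(Rintegral _ _ _) -/E1; congr EFin; ring.
- apply/measurable_EFinP; apply: measurable_funX; exact: measurable_funB.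
- by move=> u; rewrite lee_fin sqr_ge0.
Qed.

End second_moment.

(** * Exponential moments under Box closure *)

Section closure_bounds.
Local Open Scope classical_set_scope.
Context {R : realType}.
Variables (C : qm_data R -> Prop) (P : qm_family R).
Hypothesis PC : forall Y : qm_space R, P Y -> exists2 Z, C Z & qm_le Y Z.

(** Lets the Box error e tend to 0 in a bound valid for all small e, so that the constants of the
    models are kept exactly. *)
Lemma le_at_right0 (x : \bar R) (g : R -> R) (e0 : R) :
  0 < e0 -> {for 0, continuous g} ->
  (forall e, 0 < e -> e < e0 -> (x <= (g e)%:E)%E) -> (x <= (g 0)%:E)%E.
Proof.
move=> e00 cg xg; apply/lee_addgt0Pr => h h0.
have /cvgrPdist_lt/(_ h h0)/nbhs_ballP[d /= d0 gd] := cg.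
pose e := Num.min d e0 / 2.
have m0 : 0 < Num.min d e0 by rewrite lt_min d0.
have eP : 0 < e by rewrite divr_gt0.
have ltm : e < Num.min d e0 by rewrite ltr_pdivrMr// ltr_pMr// ltr1n.
move: ltm; rewrite lt_min => /andP[ed ee0].
apply: (le_trans (xg e eP ee0)); rewrite -EFinD lee_fin.
have := gd e; rewrite /ball/= sub0r normrN gtr0_norm// => /(_ ed).
by rewrite ltr_norml => /andP[? ?]; lra.
Qed.

Lemma measurable_expmax (lam m : R) :
  measurable_fun setT (fun t : R => (expR (lam * Num.max (t - m) 0))%:E).
Proof.
apply/measurable_EFinP; apply: measurableT_comp => //.
apply: measurable_funM => //; apply: measurable_maxr => //.
exact: measurable_funB.
Qed.

(** The mass condition is strict, so some mass e0 can be lost: for e < e0 the transferred observable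
    G still has mass above delta below the level m + e. The bound K then applies at this level, and
    e tends to 0. *)
Lemma closure_exp_le (lam delta K : R) (X : qm_space R) (F : X -> R) r m :
  0 <= lam ->
  (forall (Z : qm_data R) (G : Z -> R) m', C Z -> observable r G ->
     (delta%:E < qm_meas Z [set z | (G z <= m')%R])%E ->
     (\int[qm_meas Z]_z (expR (lam * Num.max (G z - m') 0))%:E <= K%:E)%E) ->
  box_closure P X -> observable r F ->
  (delta%:E < qm_meas X [set x | (F x <= m)%R])%E ->
  (\int[qm_meas X]_x (expR (lam * Num.max (F x - m) 0))%:E <= K%:E)%E.
Proof.
move=> lam0 CK clX oF dF.
have [mF LF Fr] := oF.
have indE (A : qm_data R) (H : A -> R) t : measurable_fun [set: A] H ->
    (\int[qm_meas A]_x (\1_[set s : R | (s <= t)%R] (H x))%:E =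
     qm_meas A [set x | (H x <= t)%R])%E.
  move=> mH.
  transitivity (\int[qm_meas A]_x (\1_[set x | (H x <= t)%R] x)%:E)%E.
    by apply: eq_integral => x _; rewrite !indicE !mem_setE.
  rewrite integral_indic ?setIT// -[X in measurable X]setTI.
  by apply: (mH _ [set s | s <= t]) => //; rewrite -set_itvNyc.
have [e0 [e00 de0]] : exists e0, 0 < e0 /\
    (delta%:E + e0%:E < qm_meas X [set x | (F x <= m)%R])%E.
  move: dF; case: (qm_meas X _) => [p| |] // dp.
    by exists ((p - delta) / 2); rewrite -EFinD !lte_fin in dp *; lra.
  by exists 1; rewrite ltr01 ltry.
(* The exponent 2 e collects the displacement of the values and that of the level from m to m + e.
   The last term is the maximum of the integrand on [-r, r] times the exceptional mass. *)
have := @le_at_right0 (\int[qm_meas X]_x (expR (lam * Num.max (F x - m) 0))%:E)%E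
  (fun e => expR (lam * (2 * e)) * K + expR (lam * Num.max (r - m) 0) * e) e0 e00.
rewrite !mulr0 expR0 mul1r addr0; apply.
  apply: differentiable_continuous; apply/derivable1_diffP.
  exact: ex_derive.
move=> e egt0 ee0.
have [Z CZ [G oG FG]] := model_transfer PC clX oF egt0.
have [mG LG Gr] := oG.
have mind t : measurable_fun [set: R] (fun s : R => (\1_[set s | s <= t] s)%:E : \bar R).
  apply/measurable_EFinP; apply: measurable_indic.
  by rewrite -set_itvNyc.
have PG : (delta%:E < qm_meas Z [set z | (G z <= m + e)%R])%E.
  have : (qm_meas X [set x | (F x <= m)%R] <=
          qm_meas Z [set z | (G z <= m + e)%R] + e%:E)%E.
    have := FG (fun s => (\1_[set s : R | s <= m] s)%:E)
      (fun s => (\1_[set s : R | s <= m + e] s)%:E) 1.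
    rewrite !indE// mul1r; apply=> //.
    - by move=> s _; rewrite lee_fin indicE; case: (_ \in _).
    - move=> s t _ _ st; rewrite lee_fin !indicE.
      have [sm|//] := boolP (s \in _).
      rewrite mem_set//=; move: sm; rewrite inE/= => sm.
      by move: st; rewrite ler_norml => /andP[? ?]; lra.
  move=> /(lt_le_trans de0); rewrite -lteBlDr// => /(lt_trans _); apply.
  by rewrite -[ltRHS]/((delta + e0 - e)%:E) lte_fin; lra.
apply: (@le_trans _ _
  (\int[qm_meas Z]_z (expR (lam * (2 * e)) *
      expR (lam * Num.max (G z - (m + e)) 0))%:E +
    (expR (lam * Num.max (r - m) 0) * e)%:E)%E).
  have := FG (fun s => (expR (lam * Num.max (s - m) 0))%:E)
    (fun s => (expR (lam * (2 * e)) * expR (lam * Num.max (s - (m + e)) 0))%:E)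
    (expR (lam * Num.max (r - m) 0)).
  apply.
  - exact: measurable_expmax.
  - apply/measurable_EFinP; apply: measurable_funM => //.
    by have /measurable_EFinP := measurable_expmax lam (m + e).
  - by move=> s; rewrite lee_fin expR_ge0.
  - by move=> s; rewrite lee_fin mulr_ge0// expR_ge0.
  - move=> s /andP[_ sr]; rewrite lee_fin ler_expR ler_wpM2l//.
    by rewrite ge_max !le_max lexx orbT andbT lerB.
  - move=> s t _ _; rewrite ler_norml => /andP[? ?].
    rewrite lee_fin -expRD ler_expR -mulrDr ler_wpM2l//.
    case: (leP (s - m) 0) => ?; case: (leP (t - (m + e)) 0) => ?; lra.
rewrite EFinD leeD2r//.
under eq_integral do rewrite EFinM.
rewrite ge0_integralZl//; last first.
  exact: (measurableT_comp (measurable_expmax lam (m + e)) mG).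
rewrite EFinM lee_wpmul2l ?lee_fin ?expR_ge0//; exact: CK PG.
Qed.
End closure_bounds.

(** * Laws, medians, and bounds on the invariants of a pyramid *)

Section pyramid_invariants.
Local Open Scope classical_set_scope.
Context {R : realType}.
Implicit Types X Y : qm_space R.

Lemma exists_law d d' (T : measurableType d) (U : measurableType d')
    (mu : {measure set T -> \bar R}) (F : T -> U) :
  mu [set: T] = 1%E -> measurable_fun [set: T] F ->
  exists nu : probability U R, forall A, nu A = mu (F @^-1` A).
Proof.
move=> mu1 mF.
have muF1 : pushforward mu F [set: U] = 1%E by rewrite /pushforward preimage_setT.
pose nu := HB.pack_for (probability U R) (pushforward mu F)
  (Measure_isProbability.Build _ _ R (pushforward mu F) muF1).
by exists (nu mF mF mF mF mF mF).
Qed.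

Lemma qm_M1_law X (F : X -> R) r : observable r F ->
  exists2 nu, qm_M1 X r nu & forall A, nu A = qm_meas X (F @^-1` A).
Proof.
move=> [mF LF Fr].
have [nu nuE] := exists_law (qm_meas_setT (qm_spaceP X))
  (mF : measurable_fun _ (F : X -> measurableTypeR R)).
exists nu => //; exists F; split=> // x y.
by rewrite ge_max (qm_dist_ge0 (qm_spaceP X)) andbT; exact: LF.
Qed.

Lemma qm_M1_observable X r nu : qm_M1 X r nu ->
  exists2 F : X -> R, observable r F &
    forall A, measurable A -> nu A = qm_meas X (F @^-1` A).
Proof.
move=> [F [mF Fr LF nuE]]; exists F => //; split=> // x y.
by have := LF x y; rewrite ge_max => /andP[].
Qed.

Lemma observable_clip X (F : X -> R) r : 0 <= r -> Lip1 (qm_dist X) F ->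
  observable r (clip r \o F).
Proof.
move=> r0 LF.
have LcF := Lip1_clip r (qm_dist_ge0 (qm_spaceP X)) LF.
by split=> // [|x]; [exact: measurable_Lip1|exact: clip_itv].
Qed.

(** The Box distance of X to itself is 0: take the diagonal coupling and the diagonal for S, on
    which [f \o fst] and [f \o snd] agree. The diagonal is closed because [dsym] separates
    points. *)
Lemma sub_box_closure (P : qm_family R) X : P X -> box_closure P X.
Proof.
move=> PX e e0; exists X => //.
have mdiag : measurable_fun [set: X] (fun x : X => (x, x)) by exact: measurable_fun_pair.
have X1 := qm_meas_setT (qm_spaceP X).
have [pi piE] := exists_law X1 mdiag.
pose S := [set z : X * X | z.1 = z.2].
suff : (box_dist X X <= 0)%E by move=> /le_lt_trans; apply; rewrite lte_fin.
apply: ge_ereal_inf; eexists.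
  exists pi, S; split; last reflexivity.
    split=> A mA; rewrite piE; congr (qm_meas X _); apply/seteqP; split=> x //=.
    - by case.
    - by case.
  move=> [x y] /= nxy; exists (dsym (qm_dist X) x y / 2).
    rewrite divr_gt0// lt_neqAle eq_sym; apply/andP; split.
      by apply/eqP => /(qm_dist_sep (qm_spaceP X)).
    by rewrite /dsym le_max (qm_dist_ge0 (qm_spaceP X)).
  move=> [x' y'] /= xx' yy'; rewrite /S/= => exy; subst x'.
  have := dsym_triangle x y' y; rewrite (dsymC (qm_dist X) y' y) leNgt => /negP; apply.
  by rewrite [ltRHS]splitr ltrD.
have dist0 (f : X -> R) : (dist_sup S (f \o fst) (f \o snd) <= 0)%E.
  rewrite /dist_sup ge_max lexx/=; apply: ge_ereal_sup => _ [[x y] + <-].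
  rewrite /S/= => <-.
  by rewrite subrr normr0.
have piS : pi S = 1%E.
  by rewrite piE -X1; congr (qm_meas X _); apply/seteqP; split.
rewrite ge_max piS subee// lexx/= mule_ge0_le0// /hausdorff ge_max.
apply/andP; split; apply: ge_ereal_sup => _ [_ [f Lf <-] <-];
  apply: ge_ereal_inf; exists (dist_sup S (f \o fst) (f \o snd)) => //.
  by exists (f \o snd) => //; exists f.
by exists (f \o fst) => //; exists f.
Qed.

(** The witness is the smallest median, the infimum of the t with nu of ]-oo, t] at least 1/2. Both
    conditions follow by continuity from above, along half-lines decreasing to the two closed
    half-lines. *)
Lemma exists_Med (nu : probability (measurableTypeR R) R) r :
  nu `]-oo, r] = 1%E -> (forall t, t < - r -> nu `]-oo, t] = 0%E) ->
  exists m, Med nu m.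
Proof.
move=> nur nuNr.
pose S := [set t : R | ((2^-1)%:E <= nu `]-oo, t])%E].
have half1 : ((2^-1)%:E <= 1 :> \bar R)%E by rewrite lee_fin; lra.
have Sr : S r by rewrite /S/= nur.
have lbS : lbound S (- r).
  move=> t /= St; rewrite leNgt; apply/negP => /nuNr nut.
  by move: St; rewrite /S/= nut lee_fin; lra.
have infS : has_inf S by split; [exists r|exists (- r)].
have mono (s t : R) : s <= t -> (nu `]-oo, s] <= nu `]-oo, t])%E.
  move=> st; apply: le_measure; rewrite ?inE//.
  by apply: subset_itvl; rewrite bnd_simp.
have n0 k : 0 < k.+1%:R^-1 :> R by [].
have invle (k l : nat) : (k <= l)%N -> l.+1%:R^-1 <= k.+1%:R^-1 :> R.
  by move=> kl; rewrite lef_pV2 ?posrE// ler_nat.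
exists (inf S); split.
  rewrite (itvNycEbigcap false).
  apply: (cvge_ge _ (nonincreasing_cvg_mu _ _ _ _)) => //.
  - apply: nearW => k /=; have [s Ss sk] := inf_adherent (n0 k) infS.
    by apply: le_trans Ss _; apply: mono; exact: ltW.
  - by rewrite (le_lt_trans (probability_le1 _ _))// ltry.
  - by apply: bigcapT_measurable => k.
  - move=> k l kl; apply/subsetPset/subset_itvl; rewrite bnd_simp.
    by rewrite lerD2l invle.
rewrite itvcyEbigcap.
apply: (cvge_ge _ (nonincreasing_cvg_mu _ _ _ _)) => //.
- apply: nearW => k /=; rewrite -setCitvl probability_setC//.
  set t := inf S - k.+1%:R^-1.
  have : (nu `]-oo, t] < (2^-1)%:E)%E.
    rewrite ltNge; apply/negP => St; have : inf S <= t.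
      by apply: ge_inf => //; case: infS.
    by rewrite /t lerDl oppr_ge0 leNgt n0.
  move: (nu `]-oo, t]) (fin_num_measure nu `]-oo, t] (measurable_itv _)).
  move=> [p| |]// _.
  by rewrite -EFinB !(lte_fin, lee_fin); lra.
- by rewrite (le_lt_trans (probability_le1 _ _))// ltry.
- by apply: bigcapT_measurable => k.
- move=> k l kl; apply/subsetPset/subset_itvr; rewrite bnd_simp.
  by rewrite lerD2l lerN2 invle.
Qed.

Lemma Eexp_le (lam K : R) (P : qm_family R) :
  (forall X (F : X -> R) r m, P X -> observable r F ->
     ((2^-1)%:E <= qm_meas X [set x | (F x <= m)%R])%E ->
     (\int[qm_meas X]_x (expR (lam * Num.max (F x - m) 0))%:E <= K%:E)%E) ->
  (Eexp lam P <= K%:E)%E.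
Proof.
move=> PK; apply: ge_ereal_sup => _ [r /= r0 <-].
apply: ge_ereal_sup => _ [nu [X PX /qm_M1_observable[F oF nuE]] <-].
have [mF LF Fr] := oF.
have [m mm] : exists m, Med nu m.
  apply: (@exists_Med _ r); rewrite ?nuE//.
    rewrite -(qm_meas_setT (qm_spaceP X)); congr (qm_meas X _).
    by apply/seteqP; split=> // x _ /=; rewrite in_itv/=; have /andP[] := Fr x.
  move=> t tr; rewrite nuE// -[RHS](measure0 (qm_meas X)); congr (qm_meas X _).
  apply/seteqP; split=> // x /=; rewrite in_itv/= => Ft.
  by have /andP[] := Fr x; lra.
apply: ge_ereal_inf; exists (\int[nu]_t (expR (lam * Num.max (t - m) 0))%:E)%E.
  by exists m.
rewrite (@ge0_integral_image _ _ _ X _ (qm_meas X) nu F)//; last exact: measurable_expmax.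
by apply: (PK _ _ r) => //; case: mm; rewrite nuE.
Qed.

Lemma tail_lt (d : measure_display) (T : measurableType d)
    (mu : {measure set T -> \bar R}) (F : T -> R) (c : R) :
  mu [set: T] = 1%E -> measurable_fun [set: T] F -> 0 < c ->
  exists M : R, 0 <= M /\ (mu [set x | (M <= F x)%R] < c%:E)%E.
Proof.
move=> mu1 mF c0.
pose A n := [set x | (n%:R <= F x)%R].
have mA n : measurable (A n).
  rewrite /A -[X in measurable X]setTI.
  by apply: (mF _ [set s | n%:R <= s]) => //; rewrite -set_itvcy.
have : mu \o A @ \oo --> mu (\bigcap_n A n).
  apply: nonincreasing_cvg_mu => //.
  - have : (mu (A 0%N) <= mu [set: T])%E by apply: le_measure; rewrite ?inE.
    by move=> /le_lt_trans; apply; rewrite mu1 ltry.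
  - by apply: bigcapT_measurable.
  - move=> k l kl; apply/subsetPset => x /=; apply: le_trans.
    by rewrite ler_nat.
have -> : \bigcap_n A n = set0.
  apply/seteqP; split=> // x /(_ (Num.truncn (F x)).+1 I) /=.
  by rewrite /A/= leNgt truncnS_gt.
rewrite measure0 => /fine_cvgP[Afin /cvgrPdist_lt/(_ c c0) Ac].
have [n [fA cA]] : exists n, mu (A n) \is a fin_num /\ `|0 - fine (mu (A n))| < c.
  near \oo => n; exists n; split; [near: n; exact: Afin|near: n; exact: Ac].
exists n%:R; split=> //; move: cA; rewrite sub0r normrN ger0_norm ?fine_ge0//.
by rewrite -lte_fin fineK.
Unshelve. all: by end_near. Qed.

(** The infimum over medians must not hide the divergence. If {F >= M0} has mass below 1/2, then
    every median of every truncation of F is at most M0, so that passing to the median costs at most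
    the factor exp (lam M0). Monotone convergence then removes the truncation. *)
Lemma Eexp_infty (lam : R) (P : qm_family R) X (F : X -> R) :
  0 <= lam -> P X -> Lip1 (qm_dist X) F ->
  (\int[qm_meas X]_x (expR (lam * F x))%:E = +oo)%E ->
  Eexp lam P = +oo%E.
Proof.
move=> lam0 PX LF Foo; apply/eqP; rewrite -leye_eq leNgt; apply/negP => Eoo.
have X1 := qm_meas_setT (qm_spaceP X).
have mF := measurable_Lip1 LF.
have [M0 [M00 FM0]] := tail_lt (c := 2^-1) X1 mF ltac:(lra).
have clipE n : (\int[qm_meas X]_x (expR (lam * Num.min n%:R (F x)))%:E <=
    (expR (lam * M0))%:E * Eexp lam P)%E.
  set r : R := n.+1%:R.
  have r0 : 0 < r by [].
  have oF := observable_clip (ltW r0) LF.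
  have mcF : measurable_fun [set: X] (clip r \o F : X -> measurableTypeR R) by case: oF.
  have [nu nuM nuE] := qm_M1_law oF.
  apply: (@le_trans _ _ ((expR (lam * M0))%:E *
    ereal_inf [set \int[nu]_t (expR (lam * Num.max (t - m) 0))%:E | m in Med nu])%E).
    rewrite -lee_pdivrMl ?expR_gt0//; apply: le_ereal_inf_tmp => _ [m mm <-].
    have mM0 : m <= M0.
      rewrite leNgt; apply/negP => M0m; case: mm => _.
      rewrite leNgt => /negP; apply; apply: le_lt_trans FM0.
      rewrite nuE; apply: le_measure; rewrite ?inE.
      - by rewrite -[X in measurable X]setTI; exact: mcF.
      - rewrite -[X in measurable X]setTI.
        by apply: (mF _ [set s | M0 <= s]) => //; rewrite -set_itvcy.
      - move=> x /=; rewrite in_itv/= andbT /clip le_max le_min.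
        move=> /orP[|/andP[_]]; last by apply: le_trans; exact: ltW.
        by move=> mr; lra.
    rewrite (@ge0_integral_image _ _ _ X _ (qm_meas X) nu (clip r \o F))//=;
      last exact: measurable_expmax.
    have mmin : measurable_fun [set: X]
        (fun x => (expR (lam * Num.min n%:R (F x)))%:E).
      apply/measurable_EFinP; apply: measurableT_comp => //.
      by apply: measurable_funM => //; exact: measurable_minr.
    rewrite -ge0_integralZl//=.
    apply: ge0_le_integral => //.
    - exact: measurable_funeM.
    - exact: (measurableT_comp (measurable_expmax lam m) mcF).
    move=> x _; rewrite -EFinM lee_fin -expRN -expRD ler_expR -mulrN -mulrDr.
    rewrite ler_wpM2l// le_max; apply/orP; left.
    rewrite addrC lerB// /clip le_max; apply/orP; right.
    by rewrite le_min ge_min ler_nat leqnSn /= ge_min lexx orbT.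
  rewrite lee_wpmul2l ?lee_fin ?expR_ge0//.
  apply: le_ereal_sup_tmp; eexists; first by exists r.
  by apply: ereal_sup_ubound; exists nu => //; exists X.
have limE x : limn (fun n => (expR (lam * Num.min n%:R (F x)))%:E) =
    (expR (lam * F x))%:E.
  apply: lim_near_cst => //; near=> n; rewrite min_r//.
  by near: n; exact: nbhs_infty_ger.
have : (+oo <= (expR (lam * M0))%:E * Eexp lam P)%E.
  rewrite -Foo; under eq_integral do rewrite -limE.
  apply: cvge_le (cvg_monotone_convergence _ _ _ _) => //.
  - by apply: nearW => n; exact: clipE.
  - move=> n; apply/measurable_EFinP; apply: measurableT_comp => //.
    by apply: measurable_funM => //; exact: measurable_minr.
  - move=> x _ k l kl; rewrite lee_fin ler_expR ler_wpM2l// le_min !ge_min.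
    by rewrite ler_nat kl lexx orbT.
rewrite leye_eq => /eqP; apply/eqP; rewrite lt_eqF//.
by rewrite lte_mul_pinfty ?lee_fin ?expR_ge0.
Unshelve. all: by end_near. Qed.

(* The truncations [clip n \o F] are admissible and their variances converge
   to that of F by dominated convergence. *)
Lemma Vdir_ge (P : qm_family R) X (F : X -> R) :
  P X -> Lip1 (qm_dist X) F ->
  (qm_meas X).-integrable [set: X] (EFin \o F) ->
  (qm_meas X).-integrable [set: X] (EFin \o (fun x => F x ^+ 2)) ->
  ((\int[qm_meas X]_x (F x ^+ 2) - (\int[qm_meas X]_x F x) ^+ 2)%:E
    <= Vdir P)%E.
Proof.
move=> PX LF iF iF2.
have X1 := qm_meas_setT (qm_spaceP X).
have mF := measurable_Lip1 LF.
pose f n : X -> R := clip n.+1%:R \o F.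
have obsf n : observable n.+1%:R (f n) by exact: observable_clip.
have mf n : measurable_fun [set: X] (f n) by case: (obsf n).
have bf n x : - n.+1%:R <= f n x <= n.+1%:R by case: (obsf n).
have VP n : ((\int[qm_meas X]_x (f n x ^+ 2) -
    (\int[qm_meas X]_x f n x) ^+ 2)%:E <= Vdir P)%E.
  have [nu nuM nuE] := qm_M1_law (obsf n).
  rewrite -(@variance_image _ _ _ (qm_meas X) X1 (f n) nu)//.
  - apply: le_ereal_sup_tmp; eexists; first by exists n.+1%:R; first exact: (ltr0Sn R n).
    by apply: ereal_sup_ubound; exists nu => //; exists X.
  - exact: (bounded_integrable X1 (mf n) (bf n)).
  - exact: (bounded_integrable_sqr X1 (mf n) (bf n)).
have fF x : f n x @[n --> \oo] --> F x.
  apply: cvg_near_cst; near=> n; rewrite /f/= clip_id//.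
  rewrite -ler_norml (@le_trans _ _ n%:R)// ?ler_nat//.
  by near: n; exact: nbhs_infty_ger.
have absf n x : `|f n x| <= `|F x|.
  have := clip_dist n.+1%:R (F x) 0.
  by rewrite subr0 (@clip_id _ n.+1%:R 0) ?subr0// oppr_le0 !ler0n.
have cv (g : nat -> X -> R) (G : X -> R) :
    (forall n, measurable_fun [set: X] (g n)) ->
    (qm_meas X).-integrable [set: X] (EFin \o G) ->
    (forall x, g n x @[n --> \oo] --> G x) -> (forall n x, `|g n x| <= `|G x|) ->
    \int[qm_meas X]_x g n x @[n --> \oo] --> \int[qm_meas X]_x G x.
  move=> mg iG gG gle.
  have [|||||_ _] := @dominated_convergence _ _ _ (qm_meas X) [set: X] measurableT
    (fun n x => (g n x)%:E) (EFin \o G) (abse \o (EFin \o G)).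
  - by move=> n; exact/measurable_EFinP.
  - exact: measurable_int iG.
  - by apply: aeW => x _; apply: cvg_EFin; [exact: nearW|exact: gG].
  - exact: integrable_abse.
  - by apply: aeW => x n _; rewrite /= lee_fin.
  - move=> H; apply: fine_cvg; rewrite /Rintegral fineK.
      by apply: H.
    exact: integrable_fin_num.
pose v n := \int[qm_meas X]_x (f n x ^+ 2) - (\int[qm_meas X]_x f n x) ^+ 2.
have vV : v n @[n --> \oo] -->
    \int[qm_meas X]_x (F x ^+ 2) - (\int[qm_meas X]_x F x) ^+ 2.
  apply: cvgB.
    apply: (cv (fun n x => f n x ^+ 2)) => // [n|x|n x].
    - exact: measurable_funX.
    - by rewrite expr2; under eq_fun do rewrite expr2; apply: cvgM; exact: fF.
    - by rewrite !normrX ler_pXn2r ?nnegrE.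
  rewrite expr2; under eq_fun do rewrite expr2.
  by apply: cvgM; apply: cv.
have vVe : (v n)%:E @[n --> \oo] -->
    (\int[qm_meas X]_x (F x ^+ 2) - (\int[qm_meas X]_x F x) ^+ 2)%:E.
  by apply: cvg_EFin => //; exact: nearW.
by apply: cvge_le vVe; apply: nearW => n; exact: VP.
Unshelve. all: by end_near. Qed.

End pyramid_invariants.

(** * Variances under Box closure *)

Section variance_closure.
Local Open Scope classical_set_scope.
Context {R : realType}.

(** A variance is at most the second moment about any point. The assumption can thus use a center
    [a] adapted to each observable of a model, and the same center is used for the observable of
    X. *)
Lemma Vdir_le (C : qm_data R -> Prop) (P : qm_family R) (v : R) :
  (forall Y : qm_space R, P Y -> exists2 Z, C Z & qm_le Y Z) ->
  (forall Z, C Z -> qm_meas Z [set: Z] = 1%E) ->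
  (forall (Z : qm_data R) (G : Z -> R) r, C Z -> observable r G ->
     exists a, (\int[qm_meas Z]_z ((G z - a) ^+ 2)%:E <= v%:E)%E) ->
  (Vdir (box_closure P) <= v%:E)%E.
Proof.
move=> PC C1 Cv; apply: ge_ereal_sup => _ [r /= r0 <-].
apply: ge_ereal_sup => _ [nu [X clX /qm_M1_observable[F oF nuE]] <-].
have [mF LF Fr] := oF.
have X1 := qm_meas_setT (qm_spaceP X).
have iF := bounded_integrable X1 mF Fr.
have iF2 := bounded_integrable_sqr X1 mF Fr.
rewrite (variance_image X1 mF iF iF2 nuE).
(* For s, t and a' in [-r, r] with |s - t| <= e, (s - a')^2 is at most (t - a')^2 + 4 r e + e^2, and
   it is always at most 4 r^2, which is paid on a set of mass at most e. *)
pose g (e : R) := v + (4 * r * e + e * e) + (4 * r * r) * e.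
have -> : v%:E = (g 0)%:E by rewrite /g !mulr0 !addr0.
apply: (@le_at_right0 _ _ g 1) => //.
  by apply: differentiable_continuous; apply/derivable1_diffP; exact: ex_derive.
move=> e e0 _.
have [Z CZ [G oG FG]] := model_transfer PC clX oF e0.
have [mG LG Gr] := oG.
have [a Ga] := Cv Z G r CZ oG.
(* Clipping brings the center no farther from the values of G, which lie in [-r, r], and makes the
   error terms independent of the model. *)
set a' := clip r a.
have ar : - r <= a' <= r by apply: clip_itv; exact: ltW.
apply: (@le_trans _ _ (\int[qm_meas X]_x ((F x - a') ^+ 2)%:E)%E).
  rewrite (integral_sqrB X1 a' iF iF2) lee_fin -subr_ge0.
  rewrite (_ : _ - _ = (a' - \int[qm_meas X]_x F x) ^+ 2) ?sqr_ge0//; ring.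
have msqr c : measurable_fun setT (fun t : R => ((t - a') ^+ 2 + c)%:E).
  apply/measurable_EFinP; apply: measurable_funD => //; apply: measurable_funX.
  exact: measurable_funB.
pose c := 4 * r * e + e * e.
have c0 : 0 <= c by rewrite addr_ge0 ?mulr_ge0// ltW.
apply: (@le_trans _ _ (\int[qm_meas Z]_z ((G z - a') ^+ 2 + c)%:E +
    (4 * r * r * e)%:E)%E).
  have := FG (fun s => ((s - a') ^+ 2 + 0)%:E) (fun s => ((s - a') ^+ 2 + c)%:E)
    (4 * r * r).
  under eq_integral do rewrite addr0.
  apply => //.
  - by move=> s; rewrite lee_fin addr0 sqr_ge0.
  - by move=> s; rewrite lee_fin addr_ge0// sqr_ge0.
  - move=> s /andP[? ?]; move: ar => /andP[? ?]; rewrite lee_fin addr0.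
    by rewrite expr2; nra.
  - move=> s t /andP[? ?] /andP[? ?]; move: ar => /andP[? ?].
    rewrite ler_norml => /andP[? ?]; rewrite lee_fin addr0 !expr2 /c.
    nra.
have msq b : measurable_fun [set: Z] (fun z => ((G z - b) ^+ 2)%:E).
  apply/measurable_EFinP; apply: measurable_funX; exact: measurable_funB.
rewrite [g e]/(v + c + 4 * r * r * e) EFinD leeD2r//.
under eq_integral do rewrite EFinD.
rewrite ge0_integralD//; last by move=> z _; rewrite lee_fin sqr_ge0.
rewrite -[leRHS]/(v%:E + c%:E)%E; apply: leeD; last first.
  by rewrite integral_cst// C1// mule1.
apply: le_trans Ga; apply: ge0_le_integral => //.
- by move=> z _; rewrite lee_fin sqr_ge0.
- move=> z _; rewrite lee_fin -real_normK ?num_real// -[leRHS]real_normK ?num_real//.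
  rewrite ler_pXn2r ?nnegrE//.
  by rewrite -{1}(clip_id (Gr z)); exact: clip_dist.
Qed.
End variance_closure.

(** * Integration against a measure given by a density *)

Section density.
Local Open Scope classical_set_scope.
Local Open Scope ereal_scope.
Import HBNNSimple.

Lemma ge0_integral_density d (T : measurableType d) (R : realType)
    (mu nu : {measure set T -> \bar R}) (p : T -> R) (f : T -> \bar R) :
  measurable_fun [set: T] p -> (forall x, 0 <= p x)%R ->
  (forall A, measurable A -> nu A = \int[mu]_(x in A) (p x)%:E) ->
  measurable_fun [set: T] f -> (forall x, 0 <= f x) ->
  \int[nu]_x f x = \int[mu]_x (f x * (p x)%:E).
Proof.
move=> mp p0 nuE mf f0.
have mp' : measurable_fun [set: T] (EFin \o p) by exact/measurable_EFinP.
pose f_ := nnsfun_approx measurableT mf.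
have f_f x : (f_ n x)%:E @[n --> \oo] --> f x.
  by apply: cvg_nnsfun_approx => // *; exact: f0.
transitivity (limn (fun n => \int[nu]_x (f_ n x)%:E)).
  rewrite -monotone_convergence//.
  - by apply: eq_integral => x _; apply/esym/cvg_lim.
  - by move=> n; exact/measurable_EFinP/measurable_funP.
  - by move=> n y _; rewrite lee_fin.
  - by move=> y _ m n mn; rewrite lee_fin; exact/lefP/nd_nnsfun_approx.
transitivity (limn (fun n => \int[mu]_x ((f_ n x)%:E * (p x)%:E))); last first.
  rewrite -monotone_convergence//.
  - apply: eq_integral => x _; apply/cvg_lim => //.
    by apply: cvgeZr => //; exact: f_f.
  - move=> n; apply: emeasurable_funM => //.
    exact/measurable_EFinP/measurable_funP.
  - by move=> n y _; rewrite mule_ge0// lee_fin.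
  - move=> y _ m n mn; rewrite lee_wpmul2r ?lee_fin//.
    exact/lefP/nd_nnsfun_approx.
congr (limn _); apply/funext => n.
have mfn k : measurable (f_ n @^-1` [set k]) by exact: measurable_sfunP.
transitivity (\sum_(k \in range (f_ n))
    \int[nu]_x (k * \1_(f_ n @^-1` [set k]) x)%:E).
  under eq_integral do rewrite fimfunE -fsumEFin//.
  rewrite ge0_integral_fsum//; last 2 first.
  - by move=> y; exact/measurable_EFinP/measurable_funM.
  - by move=> y x _; rewrite nnfun_muleindic_ge0.
transitivity (\sum_(k \in range (f_ n))
    \int[mu]_x ((k * \1_(f_ n @^-1` [set k]) x)%:E * (p x)%:E)); last first.
  rewrite -ge0_integral_fsum//; last 2 first.
  - move=> k; apply: emeasurable_funM => //.
    exact/measurable_EFinP/measurable_funM.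
  - move=> k x _; apply: mule_ge0; last by rewrite lee_fin.
    by rewrite EFinM nnfun_muleindic_ge0.
  apply: eq_integral => x _.
  rewrite [in RHS]fimfunE -fsumEFin// ge0_mule_fsuml//.
  by move=> k; rewrite EFinM nnfun_muleindic_ge0.
apply: eq_fsbigr => k; rewrite inE => -[x _ fxk].
have k0 : (0 <= k)%R by rewrite -fxk.
under eq_integral do rewrite EFinM.
rewrite ge0_integralZl//; last first.
  exact/measurable_EFinP/measurable_indic.
rewrite integral_indic// setIT nuE//.
under [RHS]eq_integral do rewrite EFinM -muleA.
rewrite ge0_integralZl//; last by move=> ? _; rewrite mule_ge0// lee_fin.
  congr (_ * _); rewrite integral_mkcond; apply: eq_integral => y _.
  by rewrite /patch indicE; case: ifPn => _; rewrite ?mul1e ?mul0e.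
by apply: emeasurable_funM => //; exact/measurable_EFinP/measurable_indic.
Qed.
End density.

(** * Gaussian pyramids *)

Section prekopa_leindler.
Local Open Scope classical_set_scope.
Context {R : realType}.
Notation mu := (@lebesgue_measure R).

(** Layer-cake formula: both sides are the area of {(x, t) : 0 < t < min (f x) 1}, computed by
    Tonelli in the two orders. *)
Lemma integral_superlevel (f : R -> R) :
  measurable_fun [set: R] f -> (forall x, 0 <= f x) ->
  (\int[mu]_(t in `]0%R, 1%R[) mu [set x | (t < f x)%R] =
   \int[mu]_x (Num.min (f x) 1)%:E)%E.
Proof.
move=> mf f0.
pose D : set (R * R) := [set z | 0 < z.2 < Num.min (f z.1) 1].
have inD x t : ((x, t) \in D) = (0 < t < Num.min (f x) 1).
  by apply/idP/idP; rewrite inE.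
have mD : measurable (D : set (measurableTypeR R * measurableTypeR R)).
  rewrite (_ : D = ((fun z => 0 < z.2) @^-1` [set true]) `&`
    ((fun z => z.2 < Num.min (f z.1) 1) @^-1` [set true])); last first.
    by apply/seteqP; split=> z; rewrite /D/=; [move=> /andP|move=> /andP].
  apply: measurableI; rewrite -[X in measurable X]setTI.
    by apply: measurable_fun_ltr.
  apply: measurable_fun_ltr => //; apply: measurable_minr => //.
  exact: measurableT_comp.
have mind : measurable_fun [set: measurableTypeR R * measurableTypeR R]
    (fun z => (\1_D z)%:E : \bar R).
  by apply/measurable_EFinP; exact: measurable_indic.
have ind0 z : (0 <= (\1_D z)%:E :> \bar R)%E by rewrite lee_fin.
transitivity (\int[mu]_t \int[mu]_x (\1_D (x, t))%:E)%E; last first.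
  rewrite -(fubini_tonelli (fun z : measurableTypeR R * measurableTypeR R => (\1_D z)%:E))//.
  apply: eq_integral => x _.
  transitivity (\int[mu]_t (\1_(`]0%R, (Num.min (f x) 1)[%classic : set R) t)%:E)%E.
    by apply: eq_integral => t _; rewrite !indicE /D !mem_setE.
  rewrite integral_indic//= setIT lebesgue_measure_itv/= lte_fin.
  have : 0 <= Num.min (f x) 1 by rewrite le_min f0 ler01.
  by rewrite le_eqVlt => /predU1P[<-|->]; rewrite ?ltxx// oppr0 adde0.
rewrite integral_mkcond; apply: eq_integral => t _; rewrite /patch.
case: ifPn; rewrite !(inE, notin_setE)/= in_itv/=.
  move=> /andP[t0 t1].
  transitivity (\int[mu]_x (\1_[set x | t < f x] x)%:E)%E; last first.
    apply: eq_integral => x _; rewrite !indicE inD t0 lt_min t1 andbT.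
    by congr (nat_of_bool _)%:R%:E; apply/idP/idP; rewrite inE.
  rewrite integral_indic ?setIT//.
  rewrite -[X in measurable X]setTI.
  by apply: (mf _ [set s | t < s]) => //; rewrite -set_itvoy.
move=> /negP nt; apply/esym; apply: integral0_eq => x _.
rewrite indicE memNset// /D/= => /andP[t0]; rewrite lt_min => /andP[_ t1].
by move: nt; rewrite t0 t1.
Qed.

Lemma lebesgue_measure_diam (E : set R) : measurable E -> E !=set0 ->
  has_sup E -> has_inf E -> (mu E <= (sup E - inf E)%:E)%E.
Proof.
move=> mE E0 hs hi.
have -> : (sup E - inf E)%:E = mu `[inf E, sup E]%classic.
  rewrite lebesgue_measure_itv/= lte_fin; have [x Ex] := E0.
  have : inf E <= sup E.
    by apply: (@le_trans _ _ x); [apply: ge_inf; case: hi|apply: ub_le_sup; case: hs].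
  by rewrite le_eqVlt => /predU1P[->|->]; rewrite ?ltxx ?subrr.
apply: le_measure; rewrite ?inE// => x Ex /=; rewrite in_itv/=.
by apply/andP; split; [apply: ge_inf => //; case: hi|apply: ub_le_sup => //; case: hs].
Qed.

(** A one-dimensional Brunn-Minkowski inequality. Since I is a bounded interval, A and B are
    bounded, and I contains the open interval between the midpoint of their infima and that of their
    suprema. The measures of A and B are at most their diameters. *)
Lemma measure_superlevel_midpoint (A B I : set R) (M : R) :
  measurable A -> measurable B -> measurable I -> A !=set0 -> B !=set0 ->
  is_interval I -> (forall z, I z -> `|z| <= M) ->
  (forall x y, A x -> B y -> I ((x + y) / 2)) ->
  (mu A + mu B <= 2%:E * mu I)%E.
Proof.
move=> mA mB mI [a Aa] [b Bb] itvI IM ABI.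
have bA x : A x -> `|x| <= 2 * M + `|b|.
  move=> Ax; have := IM _ (ABI x b Ax Bb); have := ler_norm b; have := ler_norm (- b).
  by rewrite normrN !ler_norml => ? ? /andP[? ?]; apply/andP; split; lra.
have bB y : B y -> `|y| <= 2 * M + `|a|.
  move=> By; have := IM _ (ABI a y Aa By); have := ler_norm a; have := ler_norm (- a).
  by rewrite normrN !ler_norml => ? ? /andP[? ?]; apply/andP; split; lra.
have sA : has_sup A.
  by split; [exists a|exists (2 * M + `|b|) => x /bA; rewrite ler_norml => /andP[]].
have iA : has_inf A.
  by split; [exists a|exists (- (2 * M + `|b|)) => x /bA; rewrite ler_norml => /andP[]].
have sB : has_sup B.
  by split; [exists b|exists (2 * M + `|a|) => x /bB; rewrite ler_norml => /andP[]].
have iB : has_inf B.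
  by split; [exists b|exists (- (2 * M + `|a|)) => x /bB; rewrite ler_norml => /andP[]].
pose l := (inf A + inf B) / 2; pose u := (sup A + sup B) / 2.
have luI : (`]l, u[ `<=` I)%classic.
  move=> z /=; rewrite in_itv/= => /andP[lz zu].
  have e0 : 0 < z - l by lra.
  have e1 : 0 < u - z by lra.
  have [x Ax xe] := inf_adherent e0 iA; have [y By ye] := inf_adherent e0 iB.
  have [x' Ax' xe'] := sup_adherent e1 sA; have [y' By' ye'] := sup_adherent e1 sB.
  apply: (itvI _ _ (ABI x y Ax By) (ABI x' y' Ax' By')).
  by rewrite /l /u in xe ye xe' ye' *; apply/andP; split; lra.
have lu : l <= u.
  have : inf A <= sup A.
    by apply: (@le_trans _ _ a); [apply: ge_inf => //; case: iA|apply: ub_le_sup => //; case: sA].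
  have : inf B <= sup B.
    by apply: (@le_trans _ _ b); [apply: ge_inf => //; case: iB|apply: ub_le_sup => //; case: sB].
  by rewrite /l /u; lra.
apply: (@le_trans _ _ ((sup A - inf A)%:E + (sup B - inf B)%:E)%E).
  by apply: leeD; apply: lebesgue_measure_diam => //; [exists a|exists b].
apply: (@le_trans _ _ (2%:E * mu `]l, u[)%E).
  rewrite lebesgue_measure_itv/= lte_fin.
  move: lu; rewrite le_eqVlt => /predU1P[lu|lu].
    by rewrite lu ltxx mule0 -EFinD lee_fin; rewrite /l /u in lu; lra.
  by rewrite lu -EFinB -EFinM -EFinD lee_fin /l /u; lra.
by rewrite lee_pmul2l// le_measure ?inE.
Qed.

(* Both functions are rescaled to have supremum 1; then the level sets of f and
   g at each t < 1 are nonempty, their midpoints lie in that of h, and the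
   inequality follows by integrating over t and by AM-GM. *)
Lemma prekopa_leindler (f g h : R -> R) :
  measurable_fun [set: R] f -> measurable_fun [set: R] g ->
  measurable_fun [set: R] h ->
  (forall x, 0 <= f x) -> (forall x, 0 <= g x) -> (forall x, 0 <= h x) ->
  (exists A, forall x, f x <= A) -> (exists B, forall x, g x <= B) ->
  (forall t, 0 < t -> is_interval [set x | t < h x]) ->
  (forall t, 0 < t -> exists M, forall x, t < h x -> `|x| <= M) ->
  (\int[mu]_x (h x)%:E < +oo)%E ->
  (forall x y, f x * g y <= h ((x + y) / 2) ^+ 2) ->
  (\int[mu]_x (f x)%:E * \int[mu]_x (g x)%:E <= (\int[mu]_x (h x)%:E) ^+ 2)%E.
Proof.
move=> mf mg mh f0 g0 h0 [Mf fM] [Mg gM] itvh bh hoo fgh.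
have ih0 : (0 <= \int[mu]_x (h x)%:E)%E by apply: integral_ge0 => x _; rewrite lee_fin.
have [[x0 fx0]|nf] := pselect (exists x, 0 < f x); last first.
  rewrite (_ : (\int[mu]_x (f x)%:E = 0)%E) ?mul0e ?expe_ge0//.
  apply: integral0_eq => x _; congr EFin; apply/eqP.
  by rewrite eq_le f0 andbT leNgt; apply/negP => fx; apply: nf; exists x.
have [[y0 gy0]|ng] := pselect (exists x, 0 < g x); last first.
  rewrite (_ : (\int[mu]_x (g x)%:E = 0)%E) ?mule0 ?expe_ge0//.
  apply: integral0_eq => x _; congr EFin; apply/eqP.
  by rewrite eq_le g0 andbT leNgt; apply/negP => gx; apply: ng; exists x.
have sf : has_sup (range f) by split; [exists (f x0), x0|exists Mf => _ [x _ <-]].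
have sg : has_sup (range g) by split; [exists (g y0), y0|exists Mg => _ [x _ <-]].
pose A := sup (range f); pose B := sup (range g).
have fA x : f x <= A by apply: ub_le_sup; [case: sf|exists x].
have gB x : g x <= B by apply: ub_le_sup; [case: sg|exists x].
have A0 : 0 < A by apply: lt_le_trans (fA x0).
have B0 : 0 < B by apply: lt_le_trans (gB y0).
pose s := Num.sqrt (A * B).
have s0 : 0 < s by rewrite sqrtr_gt0 mulr_gt0.
have s2 : s ^+ 2 = A * B by rewrite sqr_sqrtr// ltW// mulr_gt0.
pose f' x := f x / A; pose g' x := g x / B; pose h' x := h x / s.
have mf' : measurable_fun [set: R] f' by exact: measurable_funM.
have mg' : measurable_fun [set: R] g' by exact: measurable_funM.
have mh' : measurable_fun [set: R] h' by exact: measurable_funM.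
have f'0 x : 0 <= f' x by rewrite divr_ge0// ltW.
have g'0 x : 0 <= g' x by rewrite divr_ge0// ltW.
have h'0 x : 0 <= h' x by rewrite divr_ge0// ltW.
have mlev (k : R -> R) t : measurable_fun [set: R] k -> measurable [set x | t < k x].
  move=> mk; rewrite -[X in measurable X]setTI.
  by apply: (mk _ [set s | t < s]) => //; rewrite -set_itvoy.
have fgh' t : 0 < t -> t < 1 -> (mu [set x | (t < f' x)%R] +
    mu [set x | (t < g' x)%R] <= 2%:E * mu [set x | (t < h' x)%R])%E.
  move=> t0 t1; have ts0 : 0 < t * s by rewrite mulr_gt0.
  have h'E z : (t < h' z) = (t * s < h z) by rewrite /h' ltr_pdivlMr.
  have [M hM] := bh _ ts0.
  apply: (@measure_superlevel_midpoint _ _ _ M); do ?exact: mlev.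
  (* As A is a supremum, f takes a value above A - A (1 - t) = t A. *)
  - have e0 : 0 < A * (1 - t) by rewrite mulr_gt0// subr_gt0.
    have [_ [x _ <-] fx] := sup_adherent e0 sf.
    by exists x; rewrite /f'/= ltr_pdivlMr//; rewrite -/A in fx; lra.
  - have e0 : 0 < B * (1 - t) by rewrite mulr_gt0// subr_gt0.
    have [_ [x _ <-] fx] := sup_adherent e0 sg.
    by exists x; rewrite /g'/= ltr_pdivlMr//; rewrite -/B in fx; lra.
  - by under eq_set do rewrite h'E; exact: itvh.
  - by move=> z /=; rewrite h'E; exact: hM.
  move=> x y /=; rewrite h'E !ltr_pdivlMr// => fx gy.
  rewrite -(@ltr_pXn2r _ 2) ?nnegrE//; last exact: ltW.
  apply: lt_le_trans (fgh x y); rewrite exprMn s2.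
  rewrite (_ : _ * _ = (t * A) * (t * B)); last by ring.
  by rewrite ltr_pM// mulr_ge0// ltW.
have mmu (k : R -> R) : measurable_fun [set: R] k ->
    measurable_fun [set: R] (fun t => mu [set x | (t < k x)%R]).
  move=> mk; pose D : set (measurableTypeR R * measurableTypeR R) :=
    [set z | z.2 < k z.1].
  have mD : measurable D.
    rewrite (_ : D = (fun z => z.2 < k z.1) @^-1` [set true]); last by apply/seteqP; split.
    rewrite -[X in measurable X]setTI; apply: measurable_fun_ltr => //.
    exact: measurableT_comp.
  have := measurable_fun_ysection mu mD.
  congr measurable_fun; apply/funext => t /=; congr (mu _).
  by apply/seteqP; split=> x; rewrite /ysection/= inE.
have key : (\int[mu]_x (f' x)%:E + \int[mu]_x (g' x)%:E <=
    2%:E * \int[mu]_x (h' x)%:E)%E.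
  (* Truncation at 1 changes neither f' nor g', which are at most 1, and it can only decrease the
     integral of h'. *)
  have min1 (k : R -> R) : (forall x, k x <= 1) ->
      (\int[mu]_x (Num.min (k x) 1)%:E = \int[mu]_x (k x)%:E)%E.
    by move=> k1; apply: eq_integral => x _; rewrite min_l.
  rewrite -(min1 f') => [|x]; last by rewrite /f' ler_pdivrMr// mul1r.
  rewrite -(min1 g') => [|x]; last by rewrite /g' ler_pdivrMr// mul1r.
  rewrite -!integral_superlevel// -ge0_integralD//; last 2 first.
  - exact: (measurable_funTS (mmu _ mf')).
  - exact: (measurable_funTS (mmu _ mg')).
  apply: (@le_trans _ _ (2%:E * \int[mu]_x (Num.min (h' x) 1)%:E)%E).
    rewrite -integral_superlevel// -ge0_integralZl//; last first.
      exact: (measurable_funTS (mmu _ mh')).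
    apply: ge0_le_integral => //.
    - by move=> t _; rewrite adde_ge0.
    - apply: measurable_funTS; apply: emeasurable_funD.
        exact: (mmu _ mf').
      exact: (mmu _ mg').
    - by apply: measurable_funeM; exact: (measurable_funTS (mmu _ mh')).
    - by move=> t /=; rewrite in_itv/= => /andP[]; exact: fgh'.
  rewrite lee_pmul2l//; apply: ge0_le_integral => //.
  - by move=> x _; rewrite lee_fin le_min h'0 ler01.
  - by apply/measurable_EFinP; exact: measurable_minr.
  - exact/measurable_EFinP.
  - by move=> x _; rewrite lee_fin ge_min lexx.
have scale (k : R -> R) c : measurable_fun [set: R] k -> (forall x, 0 <= k x) -> 0 < c ->
    (\int[mu]_x (k x / c)%:E = c^-1%:E * \int[mu]_x (k x)%:E)%E.
  move=> mk k0 c0; rewrite -ge0_integralZl//; first last.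
  - by rewrite lee_fin invr_ge0 ltW.
  - by move=> x _; rewrite lee_fin.
  - exact/measurable_EFinP.
  by apply: eq_integral => x _; rewrite -EFinM mulrC.
move: key; rewrite !scale//; move: ih0 hoo.
have : (0 <= \int[mu]_x (f x)%:E)%E by apply: integral_ge0 => x _; rewrite lee_fin.
have : (0 <= \int[mu]_x (g x)%:E)%E by apply: integral_ge0 => x _; rewrite lee_fin.
case: (\int[mu]_x (h x)%:E)%E => [c| |]//.
have pV (k : R) : 0 < k -> (0 < k^-1%:E :> \bar R)%E by move=> ?; rewrite lte_fin invr_gt0.
(* If the integral of f or of g were infinite, [key] would fail, its right side being finite. *)
case: (\int[mu]_x (f x)%:E)%E => [a| |]; case: (\int[mu]_x (g x)%:E)%E => [b| |]//;
  rewrite ?(gt0_muley (pV _ A0)) ?(gt0_muley (pV _ B0)) -?EFinM ?addye ?addey//.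
move=> b0 a0 c0 _; rewrite -!EFinD !lee_fin => abc.
rewrite !lee_fin in a0 b0 c0.
set p := A^-1 * a in abc; set q := B^-1 * b in abc; set w := s^-1 * c in abc.
have -> : a * b = s ^+ 2 * (p * q).
  by rewrite s2 /p /q mulrACA mulVKf// ?gt_eqF//; field; rewrite !gt_eqF.
have -> : c = s * w by rewrite /w mulVKf// gt_eqF.
have p0 : 0 <= p by rewrite mulr_ge0// invr_ge0 ltW.
have q0 : 0 <= q by rewrite mulr_ge0// invr_ge0 ltW.
rewrite (_ : _ * (s * w) = s ^+ 2 * (w * w)); last by ring.
rewrite ler_pM2l ?exprn_gt0//.
have := sqr_ge0 (p - q); rewrite !expr2; nra.
Qed.

End prekopa_leindler.

Section property_tau.
Local Open Scope classical_set_scope.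
Context {R : realType}.
Local Notation mR := (measurableTypeR R).

(* Maurey's property (tau), in multiplicative form: with F = exp(f) and
   G = exp(-g), the hypothesis is f x <= g y + w x y. *)
Definition property_tau d (T : measurableType d) (mu : {measure set T -> \bar R})
    (w : T -> T -> R) : Prop :=
  forall F G : T -> \bar R,
    measurable_fun [set: T] F -> measurable_fun [set: T] G ->
    (forall x, 0 <= F x)%E -> (forall x, 0 <= G x)%E ->
    (forall x y, F x * G y <= (expR (w x y))%:E)%E ->
    (\int[mu]_x F x * \int[mu]_x G x <= 1)%E.

(** For fixed x and y, the property of nu applies to the fibre of F over x divided by exp (w x y)
    and to the fibre of G over y. Its conclusion is exactly the hypothesis of the property of mu for
    the partial integrals. *)
Lemma property_tau_prod d d' (T : measurableType d) (U : measurableType d')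
    (mu : probability T R) (nu : probability U R) w w' :
  property_tau mu w -> property_tau nu w' ->
  property_tau (mu \x nu)%E (fun x y => w x.1 y.1 + w' x.2 y.2).
Proof.
move=> tau tau' F G mF mG F0 G0 FG.
rewrite !fubini_tonelli1//; apply: tau.
- exact: measurable_fun_fubini_tonelli_F.
- exact: measurable_fun_fubini_tonelli_F.
- by move=> x; exact: integral_ge0.
- by move=> x; exact: integral_ge0.
move=> x y; rewrite /fubini_F.
set c := expR (w x y); have c0 : 0 < c by exact: expR_gt0.
have mFx : measurable_fun [set: U] (fun u => F (x, u)).
  exact: measurableT_comp.
have mGy : measurable_fun [set: U] (fun u => G (y, u)).
  exact: measurableT_comp.
have := tau' (fun u => c^-1%:E * F (x, u))%E (fun u => G (y, u)).
rewrite ge0_integralZl//; last by rewrite lee_fin invr_ge0 ltW.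
rewrite -muleA lee_pdivrMl// mule1; apply => //.
- exact: measurable_funeM.
- by move=> u; rewrite mule_ge0// lee_fin invr_ge0 ltW.
- move=> u u'; rewrite -muleA lee_pdivrMl// -EFinM -expRD.
  exact: FG (x, u) (y, u').
Qed.

Lemma property_tau_image d d' (T : measurableType d) (U : measurableType d')
    (mu : {measure set T -> \bar R}) (nu : {measure set U -> \bar R})
    (p : T -> U) w w' :
  measurable_fun [set: T] p ->
  (forall A, measurable A -> nu A = mu (p @^-1` A)) ->
  (forall x y, w' (p x) (p y) = w x y) ->
  property_tau mu w -> property_tau nu w'.
Proof.
move=> mp nuE w'E tau F G mF mG F0 G0 FG.
rewrite !(ge0_integral_image mp nuE)//; apply: tau => //.
- exact: measurableT_comp.
- exact: measurableT_comp.
- by move=> x y; rewrite -w'E.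
Qed.

(** Prekopa-Leindler is applied to F phi, G phi and phi, where phi is the density. By the
    parallelogram identity, phi x phi y = phi ((x + y) / 2)^2 exp (- (x - y)^2 / (4 s^2)), and s <=
    1 makes this exponential absorb exp ((x - y)^2 / 4). *)
Lemma normal_prob_tau (s : R) : 0 < s <= 1 ->
  property_tau (normal_prob 0 s) (fun x y => (x - y) ^+ 2 / 4).
Proof.
move=> /andP[s0 s1] F G mF mG F0 G0 FG.
have sn0 : s != 0 by rewrite gt_eqF.
pose phi := normal_pdf 0 s : R -> R.
have mphi : measurable_fun [set: R] phi by exact: measurable_normal_pdf.
have phi0 x : 0 <= phi x by exact: normal_pdf_ge0.
have dens (H : R -> \bar R) : measurable_fun [set: mR] H -> (forall x, 0 <= H x)%E ->
    (\int[normal_prob 0 s]_x H x =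
     \int[lebesgue_measure]_x (H x * (phi x)%:E))%E.
  move=> mH H0.
  exact: (@ge0_integral_density _ mR R lebesgue_measure (normal_prob 0 s) phi H).
have [[x0 Fx0]|nF] := pselect (exists x, 0 < F x)%E; last first.
  rewrite (_ : \int[_]_x F x = 0)%E ?mul0e//; apply: integral0_eq => x _.
  by apply/eqP; rewrite eq_le F0 andbT leNgt; apply/negP => h; apply: nF; exists x.
have [[y0 Gy0]|nG] := pselect (exists y, 0 < G y)%E; last first.
  rewrite (_ : \int[_]_x G x = 0)%E ?mule0//; apply: integral0_eq => x _.
  by apply/eqP; rewrite eq_le G0 andbT leNgt; apply/negP => h; apply: nG; exists x.
(* G is positive at y0, so an infinite F x would violate the bound on F x * G y0. *)
have Ffin x : F x \is a fin_num.
  rewrite ge0_fin_numE// ltNge leye_eq; apply/negP => /eqP Foo.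
  by have := FG x y0; rewrite Foo gt0_mulye.
have Gfin y : G y \is a fin_num.
  rewrite ge0_fin_numE// ltNge leye_eq; apply/negP => /eqP Goo.
  by have := FG x0 y; rewrite Goo gt0_muley.
pose f x := fine (F x) * phi x; pose g x := fine (G x) * phi x.
have FE x : F x = (fine (F x))%:E by rewrite fineK.
have GE x : G x = (fine (G x))%:E by rewrite fineK.
have mfine (H : R -> \bar R) : measurable_fun [set: mR] H ->
  measurable_fun [set: R] (fun x => fine (H x)).
  by move=> mH; exact: measurableT_comp.
have f0 x : 0 <= f x by rewrite mulr_ge0// fine_ge0.
have g0 x : 0 <= g x by rewrite mulr_ge0// fine_ge0.
have mf : measurable_fun [set: R] f by apply: measurable_funM => //; exact: mfine.
have mg : measurable_fun [set: R] g by apply: measurable_funM => //; exact: mfine.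
pose i := (s ^+ 2)^-1.
have phiE x : phi x = normal_peak s * expR (- (x ^+ 2 * i / 2)).
  rewrite /phi normal_pdfE//= /normal_fun subr0 mulNr -[s ^+ 2 *+ 2]mulr_natr.
  by rewrite invfM mulrA.
have peak0 : 0 < normal_peak s by exact: normal_peak_gt0.
have FGr x y : fine (F x) * fine (G y) <= expR ((x - y) ^+ 2 / 4).
  by rewrite -lee_fin EFinM -FE -GE.
have s2 : s ^+ 2 <= 1 by rewrite expr_le1// ltW.
have s20 : 0 < s ^+ 2 by rewrite exprn_gt0.
have i1 : 1 <= i by rewrite invf_ge1.
(* bound on phi(x) exp((x-y)^2/4), from (x-y)^2 <= 2x^2 + 2y^2 and s <= 1 *)
have phib x y : phi x * expR ((x - y) ^+ 2 / 4) <= normal_peak s * expR (y ^+ 2 / 2).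
  rewrite phiE -[leLHS]mulrA -expRD ler_pM2l// ler_expR.
  have := sqr_ge0 (x + y); have := sqr_ge0 x; rewrite !expr2; nra.
rewrite !dens//; under eq_integral do rewrite FE -EFinM.
under [X in (_ * X)%E]eq_integral do rewrite GE -EFinM.
have int1 : (\int[lebesgue_measure]_x (phi x)%:E = 1)%E by exact: integral_normal_pdf.
have := @prekopa_leindler R f g phi mf mg mphi f0 g0 phi0.
rewrite int1 expe2 mule1; apply.
(* F x is at most exp ((x - y0)^2 / 4) / G y0, and [phib] bounds the product of the numerator with
   phi x. *)
- exists (normal_peak s * expR (y0 ^+ 2 / 2) / fine (G y0)) => x.
  have Gy : 0 < fine (G y0) by rewrite -lte_fin -GE.
  rewrite ler_pdivlMr// /f mulrAC; apply: le_trans (phib x y0).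
  by rewrite mulrC ler_wpM2l.
- exists (normal_peak s * expR (x0 ^+ 2 / 2) / fine (F x0)) => y.
  have Fx : 0 < fine (F x0) by rewrite -lte_fin -FE.
  rewrite ler_pdivlMr// /g mulrAC; apply: le_trans (phib y x0).
  by rewrite mulrC ler_wpM2l// mulrC -sqrrN opprB.
- have mono a b : a ^+ 2 <= b ^+ 2 -> phi b <= phi a.
    move=> ab; rewrite !phiE ler_pM2l// ler_expR lerN2 !ler_wpM2r//; lra.
  move=> t t0 x y /= tx ty z /andP[xz zy].
  have [z0|z0] := leP 0 z.
    by apply: lt_le_trans ty _; apply: mono; rewrite !expr2; nra.
  by apply: lt_le_trans tx _; apply: mono; rewrite !expr2; nra.
(* From t exp u < peak and u <= exp u one gets u <= peak / t. Moreover x^2 <= 2 u since s <= 1, and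
   |x|^2 <= 2 c implies |x| <= 2 c + 1. *)
- move=> t t0; exists (2 * (normal_peak s / t) + 1) => x.
  rewrite phiE expRN ltr_pdivlMr ?expR_gt0//.
  set u := x ^+ 2 * i / 2 => tu.
  have ux : x ^+ 2 <= 2 * u.
    rewrite /u; set v := x ^+ 2; have : 0 <= v by rewrite sqr_ge0.
    nra.
  have ut : u <= normal_peak s / t.
    rewrite ler_pdivlMr// mulrC; apply: le_trans (ltW tu).
    by rewrite ler_pM2l//; have := expR_ge1Dx u; lra.
  move: ux; rewrite -real_normK ?num_real// expr2.
  have := normr_ge0 x; nra.
- by rewrite ltry.
move=> x y; rewrite /f /g.
apply: (@le_trans _ _ (expR ((x - y) ^+ 2 / 4) * (phi x * phi y))).
  by rewrite mulrACA ler_wpM2r// mulr_ge0.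
set z := (x + y) / 2; rewrite !phiE exprMn.
rewrite (_ : expR _ * _ = normal_peak s ^+ 2 * (expR ((x - y) ^+ 2 / 4) *
  (expR (- (x ^+ 2 * i / 2)) * expR (- (y ^+ 2 * i / 2))))); last by ring.
rewrite ler_pM2l ?exprn_gt0// [expR _ ^+ 2]expr2 -!expRD ler_expR /z.
have := sqr_ge0 (x - y); rewrite !expr2; nra.
Qed.

End property_tau.

Section gaussian_concentration.
Local Open Scope classical_set_scope.
Context {R : realType}.
Local Notation mR := (measurableTypeR R).

Lemma sqdist_ge0 k (z z' : k.-tuple R) : 0 <= sqdist z z'.
Proof. by apply: sumr_ge0 => i _; exact: sqr_ge0. Qed.

Lemma sqdistC k (z z' : k.-tuple R) : sqdist z z' = sqdist z' z.
Proof. by apply: eq_bigr => i _; rewrite -sqrrN opprB. Qed.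

Lemma sqdist_tcons k (x y : mR * k.-tuple mR) :
  sqdist (tcons x) (tcons y) = (x.1 - y.1) ^+ 2 + sqdist x.2 y.2.
Proof.
rewrite /sqdist big_ord_recl; congr (_ + _).
by apply: eq_bigr => i _; rewrite !tnthS.
Qed.

Lemma std_gauss_tau k :
  property_tau (@std_gauss R k) (fun z z' => sqdist z z' / 4).
Proof.
elim: k => [|k IHk].
  move=> F G mF mG F0 G0 /(_ [tuple] [tuple]).
  rewrite /sqdist big_ord0 mul0r expR0 /= => FG.
  by rewrite !integral_dirac// !diracT !mul1e.
have s1 : 0 < (1 : R) <= 1 by rewrite ltr01 lexx.
have tau := property_tau_prod (normal_prob_tau s1) IHk.
apply: (property_tau_image (p := @tcons R k) _ _ _ tau) => // x y.
by rewrite sqdist_tcons mulrDl.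
Qed.

Lemma gauss_qm_tau q k : property_tau (qm_meas (@gauss_qm R q k))
  (fun x y => ((x.1 - y.1) ^+ 2 + sqdist x.2 y.2) / 4).
Proof.
have s01 : 0 < Num.sqrt (2^-1 : R) <= 1.
  rewrite sqrtr_gt0 invr_gt0 ltr0n/= -[leRHS]sqrtr1 ler_wsqrtr//.
  by rewrite invf_le1// ler1n.
have := property_tau_prod (normal_prob_tau s01) (@std_gauss_tau k).
move=> tau F G mF mG F0 G0 FG; apply: tau => // x y.
by rewrite -mulrDl.
Qed.

(** As q <= 1, the directed distance is at most 2 D with D the Euclidean distance, and 2 lam D <=
    D^2 / 4 + 4 lam^2. Property (tau) thus applies to exp (lam (G - m)) divided by exp (4 lam^2). *)
Lemma gauss_qm_laplace q k (G : gauss_qm q k -> R) (lam m : R) :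
  0 <= q <= 1 -> 0 <= lam -> measurable_fun [set: gauss_qm q k] G ->
  Lip1 (qm_dist (gauss_qm q k)) G ->
  (\int[qm_meas (gauss_qm q k)]_x (expR (lam * (G x - m)))%:E *
   \int[qm_meas (gauss_qm q k)]_x (expR (- (lam * (G x - m))))%:E <=
   (expR (4 * lam ^+ 2))%:E)%E.
Proof.
move=> /andP[q0 q1] lam0 mG LG.
set mu := qm_meas _; set c := expR (4 * lam ^+ 2).
have c0 : 0 < c by exact: expR_gt0.
have me : measurable_fun [set: gauss_qm q k]
    (fun x => (expR (lam * (G x - m)))%:E).
  apply/measurable_EFinP; apply: measurableT_comp => //.
  by apply: measurable_funM => //; exact: measurable_funB.
have me' : measurable_fun [set: gauss_qm q k]
    (fun x => (expR (- (lam * (G x - m))))%:E).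
  apply/measurable_EFinP; apply: measurableT_comp => //.
  apply: measurableT_comp => //.
  by apply: measurable_funM => //; exact: measurable_funB.
have := @gauss_qm_tau q k (fun x => (c^-1)%:E * (expR (lam * (G x - m)))%:E)%E
   (fun x => (expR (- (lam * (G x - m))))%:E).
have ci0 : (0 <= c^-1%:E)%E by rewrite lee_fin invr_ge0 ltW.
rewrite ge0_integralZl//.
rewrite -muleA lee_pdivrMl// mule1; apply => //.
- exact: measurable_funeM.
- by move=> x; rewrite mule_ge0// lee_fin ?invr_ge0 ?expR_ge0// ltW.
move=> x y; rewrite -muleA lee_pdivrMl// -!EFinM lee_fin -!expRD ler_expR.
have := LG y x; rewrite /= /gauss_dist -/mu.
set D2 := ((y.1 - x.1) ^+ 2 + sqdist y.2 x.2).
have -> : (x.1 - y.1) ^+ 2 + sqdist x.2 y.2 = D2.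
  by rewrite /D2 sqdistC -sqrrN opprB.
have D20 : 0 <= D2 by rewrite addr_ge0 ?sqr_ge0 ?sqdist_ge0.
set D := Num.sqrt D2; have <- : D ^+ 2 = D2 by rewrite sqr_sqrtr.
have D0 : 0 <= D by exact: sqrtr_ge0.
have xyD : `|x.1 - y.1| <= D.
  rewrite -sqrtr_sqr ler_wsqrtr// /D2 -sqrrN opprB lerDl; exact: sqdist_ge0.
move: xyD; rewrite ler_norml => /andP[_ xyD] LGxy.
have h : G x - G y <= 2 * D by nra.
have : lam * (G x - G y) <= lam * (2 * D) by rewrite ler_wpM2l.
have := sqr_ge0 (D / 2 - 2 * lam); rewrite !expr2; nra.
Qed.

(** On {G <= m} the function exp (- lam (G - m)) is at least 1, so its integral is at least 1/4; the
    product bound then controls the other integral. The value 1/4 is a choice below the mass 1/2 of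
    a median, which leaves room for the Box error. *)
Lemma gauss_qm_exp q k (G : gauss_qm q k -> R) (lam m : R) :
  0 <= q <= 1 -> 0 <= lam -> measurable_fun [set: gauss_qm q k] G ->
  Lip1 (qm_dist (gauss_qm q k)) G ->
  ((4^-1)%:E < qm_meas (gauss_qm q k) [set x | (G x <= m)%R])%E ->
  (\int[qm_meas (gauss_qm q k)]_x (expR (lam * Num.max (G x - m) 0))%:E <=
   (1 + 4 * expR (4 * lam ^+ 2))%:E)%E.
Proof.
move=> q01 lam0 mG LG Pm.
have := gauss_qm_laplace m q01 lam0 mG LG.
set mu := qm_meas _ in Pm *; set c := expR (4 * lam ^+ 2).
have mu1 : mu [set: gauss_qm q k] = 1%E by exact: probability_setT.
have me : measurable_fun [set: gauss_qm q k]
    (fun x => (expR (lam * (G x - m)))%:E).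
  apply/measurable_EFinP; apply: measurableT_comp => //.
  by apply: measurable_funM => //; exact: measurable_funB.
have me' : measurable_fun [set: gauss_qm q k]
    (fun x => (expR (- (lam * (G x - m))))%:E).
  apply/measurable_EFinP; apply: measurableT_comp => //.
  apply: measurableT_comp => //.
  by apply: measurable_funM => //; exact: measurable_funB.
set a := (\int[mu]_x (expR (lam * (G x - m)))%:E)%E.
set b := (\int[mu]_x (expR (- (lam * (G x - m))))%:E)%E => ab.
have mm : measurable [set x | G x <= m].
  rewrite -[X in measurable X]setTI.
  by apply: (mG _ [set s | s <= m]) => //; rewrite -set_itvNyc.
have b4 : ((4^-1)%:E <= b)%E.
  apply: (le_trans (ltW Pm)).
  rewrite -[leLHS]mul1e -[leLHS]integral_cst//.
  apply: (@le_trans _ _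
    (\int[mu]_(x in [set x | (G x <= m)%R]) (expR (- (lam * (G x - m))))%:E)%E).
    apply: ge0_le_integral => //.
    - exact: measurable_funTS.
    - move=> x /= xm; rewrite lee_fin -expR0 ler_expR oppr_ge0.
      by rewrite mulr_ge0_le0// subr_le0.
  by apply: ge0_subset_integral => // x _; rewrite lee_fin expR_ge0.
have a0 : (0 <= a)%E by apply: integral_ge0 => x _; rewrite lee_fin expR_ge0.
have ac : (a <= (4 * c)%:E)%E.
  have : (a * (4^-1)%:E <= c%:E)%E.
    by apply: le_trans ab; rewrite lee_wpmul2l.
  by rewrite lee_pdivrMr// -EFinM mulrC.
rewrite EFinD; apply: (@le_trans _ _ (\int[mu]_x (1 + (expR (lam * (G x - m)))%:E))%E).
  apply: ge0_le_integral => //.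
  - exact: (measurableT_comp (measurable_expmax lam m) mG).
  - by apply: emeasurable_funD.
  move=> x _; rewrite -EFinD lee_fin.
  have [Gm|Gm] := leP (G x - m) 0; last by rewrite lerDr.
  by rewrite mulr0 expR0 lerDl expR_ge0.
rewrite ge0_integralD//; apply: leeD => //.
by rewrite integral_cst// mu1 mule1.
Qed.

Lemma Eexp_pyrG (q lam : R) : 0 <= q <= 1 -> 0 <= lam ->
  (Eexp lam (pyrG q) < +oo)%E.
Proof.
move=> q01 lam0.
apply: (@le_lt_trans _ _ (1 + 4 * expR (4 * lam ^+ 2))%:E); last by rewrite ltry.
apply: Eexp_le => X F r m clX oF Fm.
apply: (@closure_exp_le R (fun Z => exists k, Z = gauss_qm q k)
  (fun Y => exists k, qm_down (gauss_qm q k) Y) _ lam 4^-1) oF _ => //.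
- by move=> Y [k YZ]; exists (gauss_qm q k) => //; exists k.
- by move=> Z G m' [k kZ]; subst Z => -[mG LG _]; exact: gauss_qm_exp.
- by apply: lt_le_trans Fm; rewrite lte_fin ltf_pV2 ?posrE// ltr_nat.
Qed.

Lemma Lambda_pyrG (q : R) : 0 <= q <= 1 -> Lambda (pyrG q) = +oo%E.
Proof.
move=> q01; apply/eqyP => A A0.
apply: ereal_sup_ubound; exists A => //; split => //.
by apply: Eexp_pyrG => //; exact: ltW.
Qed.

End gaussian_concentration.

(** * Quotients on the line *)

Section line.
Local Open Scope classical_set_scope.
Context {R : realType} (K : set R) (x0 : {x : R | `[< K x >]}).

(** The point [x0] is kept as a parameter of the type because the pointed structure on this subset
    of the line depends on it. *)
Definition line : Type := let _ := x0 in {x : R | `[< K x >]}.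

HB.instance Definition _ := Choice.on line.
HB.instance Definition _ := isPointed.Build line x0.

Definition line_val (x : line) : R := val x.

Definition line_dist (x y : line) : R := Num.max (line_val y - line_val x) 0.

Definition mline := g_sigma_algebraType (dopen line_dist).

HB.instance Definition _ := Measurable.on mline.

Lemma dsym_line x y : dsym line_dist x y = `|line_val x - line_val y|.
Proof.
rewrite /dsym /line_dist; set a := line_val x; set b := line_val y.
by have [?|?] := lerP a b; case: (leP (b - a) 0) => ?; case: (leP (a - b) 0) => ?;
  rewrite /Num.max; case: ifPn; rewrite -?leNgt => ?; lra.
Qed.

Lemma line_valP (x : line) : K (line_val x).
Proof. by apply/asboolP; exact: (valP x). Qed.

Definition line_in (x : R) : mline := insubd x0 x.

Lemma line_inK x : K x -> line_val (line_in x) = x.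
Proof. by move=> /asboolP Kx; rewrite /line_val /line_in val_insubd Kx. Qed.

Lemma line_separable : dseparable line_dist.
Proof.
(* For each rational and each n, choose a point of K within 1 / (n + 1) of the rational, and [x0] if
   there is none: the rationals themselves need not lie in K. *)
pose c (i : rat * nat) : line :=
  xget x0 [set x : line | `|line_val x - ratr i.1| < i.2.+1%:R^-1].
exists (range c).
  by apply: (sub_countable (card_image_le _ _)); exact: countableP.
move=> x e e0.
pose n := Num.truncn (2 / e).
have ne : n.+1%:R^-1 < e / 2.
  rewrite -[e / 2]invrK ltf_pV2 ?posrE ?invr_gt0 ?divr_gt0// invfM invrK mulrC.
  by rewrite truncnS_gt.
have n0 : 0 < n.+1%:R^-1 :> R by [].
move: ne n0; set h : R := n.+1%:R^-1 => ne n0.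
have [q] := @rat_in_itvoo R (line_val x - h) (line_val x + h) ltac:(lra).
rewrite in_itv/= => /andP[q1 q2].
exists (c (q, n)); first by exists (q, n).
have : `|line_val (c (q, n)) - ratr q| < h.
  rewrite /c; case: xgetP => [y _ /=//|/(_ x)] /=; case.
  by rewrite -/h ltr_norml; apply/andP; split; lra.
rewrite dsym_line ltr_norml => /andP[? ?].
by rewrite ltr_norml; apply/andP; split; lra.
Qed.

Lemma line_complete : closed K -> dcomplete line_dist.
Proof.
move=> cK u uc.
have : cvg ((line_val \o u) n @[n --> \oo]).
  apply/cauchy_cvgP; apply: cauchy_exP => e /= e0; have [N uN] := uc e e0.
  exists (line_val (u N)); exists N => // n /= Nn.
  by have := uN N n (leqnn N) Nn; rewrite dsym_line.
move=> /cvg_ex[l ul].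
have Kl : K l.
  apply: (closed_cvg K cK _ l ul); apply: nearW => n /=; exact: line_valP.
exists (line_in l).
have -> : (fun n => dsym line_dist (u n) (line_in l)) =
    (fun n => `|(line_val \o u) n - l|).
  by apply/funext => n; rewrite dsym_line line_inK.
rewrite -(normr0 R) -(subrr l); apply: cvg_norm.
by apply: cvgB => //; exact: cvg_cst.
Qed.

Lemma is_qm_space_line (mu : {measure set mline -> \bar R}) :
  closed K -> mu [set: mline] = 1%E ->
  (forall (x : line) e, 0 < e -> (0 < mu [set y | (`|line_val x - line_val y| < e)%R])%E) ->
  is_qm_space (QmData (line_dist : mline -> mline -> R) mu).
Proof.
move=> cK mu1 mu0; split=> //=.
- by move=> x y; rewrite /line_dist le_max lexx orbT.
- by move=> x; rewrite /line_dist subrr maxxx.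
- move=> x y z; rewrite /line_dist.
  case: (leP (line_val z - line_val x) 0) => ?; case: (leP (line_val y - line_val x) 0) => ?;
  case: (leP (line_val z - line_val y) 0) => ?; lra.
- move=> x y; rewrite dsym_line => /eqP; rewrite normr_eq0 subr_eq0 => /eqP.
  exact: val_inj.
- exact: line_complete.
- exact: line_separable.
- move=> U oU [x Ux]; have [e e0 xe] := oU x Ux.
  apply: (lt_le_trans (mu0 x e e0)); apply: le_measure; rewrite ?inE.
  - apply: sub_gen_smallest => y /= xy.
    exists (e - `|line_val x - line_val y|); first by rewrite subr_gt0.
    move=> z; rewrite dsym_line => yz.
    have := ler_distD (line_val y) (line_val x) (line_val z); lra.
  - exact: sub_gen_smallest.
  - by move=> y /= xy; apply: xe; rewrite dsym_line.
Qed.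

End line.

Section line_quotient.
Local Open Scope classical_set_scope.
Context {R : realType}.

(* A real-valued 1-Lipschitz function all of whose values lie in the support of
   its law exhibits that support, with the distance (y - x)_+, as a quotient. *)
Lemma line_quotient (Z : qm_data R) (F : Z -> R) :
  measurable_fun [set: Z] F -> qm_meas Z [set: Z] = 1%E ->
  (forall x y, Num.max (F y - F x) 0 <= qm_dist Z x y) ->
  (forall z e, 0 < e -> (0 < qm_meas Z [set z' | (`|F z - F z'| < e)%R])%E) ->
  exists (Y : qm_space R) (H : Y -> R),
    [/\ qm_le Y Z, Lip1 (qm_dist Y) H &
        forall phi, measurable_fun setT phi -> (forall s, 0 <= phi s)%E ->
          (\int[qm_meas Y]_y phi (H y) = \int[qm_meas Z]_z phi (F z))%E].
Proof.
move=> mF Z1 LF F0.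
have mball x e : measurable [set z | `|x - F z| < e].
  rewrite -[X in measurable X]setTI.
  apply: (mF _ [set y | `|x - y| < e]) => //.
  by apply: open_measurable; exact: ball_open.
(* K is the support of the law of F. It is closed, hence complete, and every ball around one of its
   points is charged, which gives full support. *)
pose K := [set x : R | forall e, 0 < e -> (0 < qm_meas Z [set z | (`|x - F z| < e)%R])%E].
have cK : closed K.
  move=> x clx e e0; have e2 : 0 < e / 2 by rewrite divr_gt0.
  have [y [Ky xy]] := clx _ (nbhsx_ballx x (e / 2) e2).
  apply: (lt_le_trans (Ky _ e2)); apply: le_measure; rewrite ?inE//.
  move=> z /= yz; move: xy; rewrite /ball/= => xy.
  by have := ler_distD y x (F z); lra.
have KF z : K (F z) by exact: F0.
have KF' : `[< K (F point) >] by exact/asboolP.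
pose x0 : {x : R | `[< K x >]} := exist _ (F point) KF'.
pose lv : line x0 -> R := @line_val R K x0.
pose ld : line x0 -> line x0 -> R := @line_dist R K x0.
have dsymE x y : dsym ld x y = `|lv x - lv y| by exact: dsym_line.
pose p (z : Z) : mline x0 := line_in x0 (F z).
have pF z : lv (p z) = F z by exact: (line_inK x0 (KF z)).
have mp : measurable_fun [set: Z] p.
  apply: (@measurability _ _ _ (mline x0) setT _ (dopen ld)) => //.
  move=> _ [U oU <-]; rewrite setTI.
  (* V is the union of the real intervals around points of U whose trace on K lies in U; it is open
     and has the same preimage as U. *)
  pose V := [set x : R | exists2 y, U y & exists2 e, 0 < e &
    (forall z, dsym ld y z < e -> U z) /\ `|lv y - x| < e].
  rewrite (_ : p @^-1` U = F @^-1` V); last first.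
    apply/seteqP; split=> [z /= Uz|z /= [y Uy [e e0 [He ye]]]].
      have [e e0 He] := oU _ Uz; exists (p z) => //; exists e => //; split=> //.
      by rewrite pF subrr normr0.
    by apply: He; rewrite dsymE pF.
  rewrite -[X in measurable X]setTI; apply: mF => //.
  apply: open_measurable; rewrite openE => x [y Uy [e e0 [He ye]]].
  apply/nbhs_ballP; exists (e - `|lv y - x|) => /=; first by rewrite subr_gt0.
  move=> x' xx'; exists y => //; exists e => //; split=> //.
  by move: xx'; rewrite /ball/=; have := ler_distD x (lv y) x'; lra.
have [nu nuE] := exists_law Z1 mp.
have nu1 : nu [set: mline x0] = 1%E by exact: probability_setT.
have qY : is_qm_space (QmData (ld : mline x0 -> mline x0 -> R) nu).
  apply: is_qm_space_line => // x e e0.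
  suff : (0 < nu [set y | (`|lv x - lv y| < e)%R])%E by [].
  rewrite nuE.
  rewrite (_ : _ @^-1` _ = [set z | `|lv x - F z| < e]).
    exact: (line_valP x).
  by apply/seteqP; split=> z /=; rewrite pF.
exists (QmSpace qY), lv; split=> /=.
- exists p; split=> [//|A _|x y]; first exact: nuE.
  rewrite -[leLHS]/(Num.max (lv (p y) - lv (p x)) 0).
  by rewrite !pF.
- by move=> x y; rewrite /= /line_dist le_max lexx.
move=> phi mphi phi0.
have mH : measurable_fun [set: mline x0] (lv : _ -> measurableTypeR R).
  apply: (@measurable_Lip1 _ (QmSpace qY)) => x y.
  by rewrite /= -[leRHS]/(Num.max (lv y - lv x) 0) le_max lexx.
rewrite (@ge0_integral_image _ _ _ Z (mline x0) (qm_meas Z) nu p)//.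
- by under eq_integral do rewrite pF.
- by move=> A _; exact: nuE.
- exact: measurableT_comp.
Qed.

End line_quotient.

(** * Directed stars *)

Section exponential_law.
Local Open Scope classical_set_scope.
Context {R : realType}.
Local Notation mR := (measurableTypeR R).
Local Notation mu := (@lebesgue_measure R).

Lemma exp_law_measure : exists E : {measure set mR -> \bar R},
  (forall A, exponential_prob 1 A = E A) /\ E [set: mR] = 1%E.
Proof.
have [E EE] : exists E : {measure set mR -> \bar R},
    forall A, exponential_prob 1 A = E A.
  by unshelve eexists (exponential_prob 1 : {measure set mR -> \bar R}).
by exists E; split=> //; rewrite -EE; exact: integral_exponential_pdf.
Qed.

Lemma exp_pdf_ge0 (s : R) : 0 <= exponential_pdf 1 s.
Proof. exact: exponential_pdf_ge0. Qed.

Lemma exp_pdfE (s : R) : 0 <= s -> exponential_pdf 1 s = expR (- s).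
Proof. by move=> s0; rewrite exponential_pdfE// mul1r mulN1r. Qed.

Lemma exp_pdf_itvcy (s : R) : 0 <= s ->
  (\int[mu]_(t in `[s, +oo[) (exponential_pdf 1 t)%:E = (expR (- s))%:E)%E.
Proof.
move=> s0; transitivity (\int[mu]_(t in `[s, +oo[) (expR (- t))%:E)%E.
  apply: eq_integral => t; rewrite inE/= in_itv/= andbT => st.
  by rewrite exp_pdfE// (le_trans s0).
rewrite (@ge0_continuous_FTC2y _ (fun t => expR (- t)) (fun t => - expR (- t)) _ 0).
- by rewrite EFinN oppeK add0e.
- by move=> t _; exact: expR_ge0.
- apply: continuous_subspaceT => t.
  by apply: differentiable_continuous; apply/derivable1_diffP; exact: ex_derive.
- by rewrite -oppr0; apply: cvgN; exact: cvgr_expR.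
- by move=> t _; exact: ex_derive.
- apply: cvg_at_right_filter.
  suff : {for s, continuous (fun z : R => - expR (- z))} by [].
  by apply: differentiable_continuous; apply/derivable1_diffP; exact: ex_derive.
- move=> t _; rewrite derive1E.
  apply: derive_val; apply: is_derive_eq; rewrite /GRing.scale/=; ring.
Qed.

(** Formally this is integration by parts with (f^2)' = 2 f f' <= 4 f. As f need not be
    differentiable, exp (- s) is written as the integral of exp (- t) over t >= s, and Tonelli
    reduces the claim to comparing f(t)^2 with 4 times the integral of f over [0, t]. *)
Lemma exp_law_sqr_le (f : R -> R) :
  measurable_fun [set: R] f -> (forall s, 0 <= f s) -> f 0 = 0 ->
  (forall s t, 0 <= s -> s <= t -> f t - f s <= 2 * (t - s)) ->
  (\int[mu]_s ((f s ^+ 2)%:E * (exponential_pdf 1 s)%:E) <=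
   4%:E * \int[mu]_s ((f s)%:E * (exponential_pdf 1 s)%:E))%E.
Proof.
move=> mf f0 f00 Lf.
have mpdf : measurable_fun [set: R] (exponential_pdf (1 : R)).
  exact: measurable_exponential_pdf.
pose D : set (R * R) := [set z | 0 <= z.1 <= z.2].
have inD s t : ((s, t) \in D) = (0 <= s <= t) by apply/idP/idP; rewrite inE.
have mD : measurable (D : set (mR * mR)).
  rewrite (_ : D = ((fun z => 0 <= z.1) @^-1` [set true]) `&`
    ((fun z => z.1 <= z.2) @^-1` [set true])); last first.
    by apply/seteqP; split=> z; rewrite /D/=; [move=> /andP|move=> /andP].
  by apply: measurableI; rewrite -[X in measurable X]setTI;
    apply: measurable_fun_ler.
pose h (z : mR * mR) := ((f z.1 * \1_D z * exponential_pdf 1 z.2)%:E : \bar R).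
have mh : measurable_fun [set: mR * mR] h.
  apply/measurable_EFinP; apply: measurable_funM; last exact: measurableT_comp.
  by apply: measurable_funM; [exact: measurableT_comp|exact: measurable_indic].
have h0 z : (0 <= h z)%E by rewrite lee_fin !mulr_ge0// exp_pdf_ge0.
pose pdf1 (s : R) : R := exponential_pdf 1 s.
have pdf_lt0 t : t < 0 -> pdf1 t = 0 by exact: lt0_exponential_pdf.
have int_t s : (\int[mu]_t h (s, t) = (f s)%:E * (exponential_pdf 1 s)%:E)%E.
  have [s0|s0] := ltP s 0.
    rewrite -/(pdf1 s) pdf_lt0// mule0; apply: integral0_eq => t _.
    by rewrite /h/= indicE inD leNgt s0/= mulr0 mul0r.
  rewrite exp_pdfE// -exp_pdf_itvcy// [in RHS]integral_mkcond -ge0_integralZl//.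
  - apply: eq_integral => t _; rewrite /h/= indicE inD s0/= /patch.
    have -> : (t \in `[s, +oo[%classic) = (s <= t).
      by apply/idP/idP; rewrite inE/= in_itv/= andbT.
    by case: ifPn => _; rewrite ?mule0 ?mulr1// mulr0 mul0r.
  - apply/measurable_restrict => //; apply: measurable_funTS.
    exact/measurable_EFinP.
  - move=> t _; rewrite /patch; case: ifPn => // _.
    by rewrite lee_fin exp_pdf_ge0.
  - by rewrite lee_fin.
(* integrating over s first, f >= f t - 2 (t - s) bounds the integral below by
   the area of a triangle *)
have int_s t : ((f t ^+ 2)%:E * (exponential_pdf 1 t)%:E <=
    4%:E * \int[mu]_s h (s, t))%E.
  have [t0|t0] := ltP t 0.
    rewrite -/(pdf1 t) pdf_lt0// mule0 mule_ge0// integral_ge0//.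
  set a := t - f t / 2.
  have a0 : 0 <= a by have := Lf 0 t (lexx 0) t0; rewrite /a f00; lra.
  have at_ : a <= t by have := f0 t; rewrite /a; lra.
  rewrite -EFinM.
  apply: (@le_trans _ _ (4%:E * \int[mu]_(s in `[a, t])
      ((2 * s - 2 * a) * exponential_pdf 1 t)%:E)%E).
    move: at_; rewrite le_eqVlt => /predU1P[ta|ta].
      have ft0 : f t = 0 by move: ta; rewrite /a; lra.
      rewrite ft0 expr0n mul0r mule_ge0// integral_ge0// => s /=.
      rewrite in_itv/= => /andP[? ?]; rewrite lee_fin mulr_ge0 ?exp_pdf_ge0//; lra.
    pose A (s : R) := (s * s - 2 * a * s) * exponential_pdf 1 t.
    rewrite (@continuous_FTC2 _ _ A _ _ ta).
    - rewrite -EFinB -EFinM lee_fin /A.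
      rewrite [leRHS](_ : _ = (2 * (t - a)) ^+ 2 * exponential_pdf 1 t); last by ring.
      by rewrite (_ : 2 * (t - a) = f t)// /a; lra.
    - apply: continuous_subspaceT => x.
      by apply: differentiable_continuous; apply/derivable1_diffP; exact: ex_derive.
    - split.
      + by move=> x _; exact: ex_derive.
      + apply: cvg_at_right_filter; suff : {for a, continuous A} by [].
        by apply: differentiable_continuous; apply/derivable1_diffP; exact: ex_derive.
      + apply: cvg_at_left_filter; suff : {for t, continuous A} by [].
        by apply: differentiable_continuous; apply/derivable1_diffP; exact: ex_derive.
    - move=> x _; rewrite derive1E; apply: derive_val.
      by apply: is_derive_eq; rewrite /GRing.scale/=; ring.
  rewrite lee_pmul2l// integral_mkcond; apply: ge0_le_integral => //.
  - move=> s _; rewrite /patch; case: ifPn => //; rewrite inE/= in_itv/=.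
    by move=> /andP[? ?]; rewrite lee_fin mulr_ge0 ?exp_pdf_ge0//; lra.
  - apply/measurable_restrict => //; apply: measurable_funTS.
    apply/measurable_EFinP; apply: measurable_funM => //.
    by apply: measurable_funB => //; exact: measurable_funM.
  - exact: measurableT_comp.
  move=> s _; rewrite /patch; case: ifPn => //; rewrite inE/= in_itv/=.
  move=> /andP[as_ st]; rewrite lee_fin indicE inD st (le_trans a0 as_)/= mulr1.
  apply: ler_wpM2r; first exact: exp_pdf_ge0.
  by have := Lf s t (le_trans a0 as_) st; rewrite /a; lra.
have -> : (\int[mu]_s ((f s)%:E * (exponential_pdf 1 s)%:E) =
    \int[mu]_t \int[mu]_s h (s, t))%E.
  rewrite -(fubini_tonelli h mh h0).
  by apply: eq_integral => s _; rewrite int_t.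
rewrite -ge0_integralZl//; last 2 first.
- exact: measurable_fun_fubini_tonelli_G.
- by move=> t _; exact: integral_ge0.
apply: ge0_le_integral => //.
- by move=> s _; rewrite -EFinM lee_fin mulr_ge0 ?sqr_ge0 ?exp_pdf_ge0.
- apply/measurable_EFinP; apply: measurable_funM => //; exact: measurable_funX.
- apply: measurable_funeM; exact: measurable_fun_fubini_tonelli_G.
Qed.

End exponential_law.

(** * Upper bounds for stars, leg by leg *)

Section star_model.
Local Open Scope classical_set_scope.
Context {R : realType}.
Local Notation mR := (measurableTypeR R).
Local Notation mu := (@lebesgue_measure R).

Lemma integral_star_law m (p : 'I_m.+1 -> {posnum R}) (f : mstar m -> \bar R) :
  measurable_fun [set: mstar m] f -> (forall x, 0 <= f x)%E ->
  (\int[star_law p]_x f x =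
   \sum_(i < m.+1) (p i)%:num%:E *
     \int[mu]_s (f (star_proj i s) * (exponential_pdf 1 s)%:E))%E.
Proof.
move=> mf f0.
have [E [EE E1]] := @exp_law_measure R.
have nuP i := exists_law E1 (@measurable_star_proj R m i).
pose nu i : probability (mstar m) R := sval (cid (nuP i)).
have nuE i A : nu i A = E (@star_proj R m i @^-1` A) by rewrite /nu; case: cid.
have p0 i : 0 <= (p i)%:num by [].
pose ms (k : nat) : {measure set (mstar m) -> \bar R} :=
  mscale (NngNum (p0 (inord k))) (nu (inord k)).
transitivity (\int[msum ms m.+1]_x f x)%E.
  apply: eq_measure_integral => A mA _; rewrite /= /star_law /msum.
  apply: eq_bigr => i _; rewrite /ms /mscale/= inord_val EE.
  by congr (_ * _)%E; exact/esym/nuE.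
rewrite ge0_integral_measure_sum//; apply: eq_bigr => i _.
rewrite /ms ge0_integral_mscale//= inord_val; congr (_ * _)%E.
transitivity (\int[E]_s f (star_proj i s))%E.
  apply: (@ge0_integral_image _ _ _ mR (mstar m) E (nu i) (@star_proj R m i)) => //.
    exact: measurable_star_proj.
  by move=> A _; exact: nuE.
apply: (@ge0_integral_density _ mR R mu E (exponential_pdf 1)).
- exact: measurable_exponential_pdf.
- exact: exp_pdf_ge0.
- by move=> A _; rewrite -EE.
- exact: (measurableT_comp mf (@measurable_star_proj R m i)).
- by move=> s; exact: f0.
Qed.

Section star_bounds.
Variables (m : nat) (p : 'I_m.+1 -> {posnum R}).
Hypothesis p1 : \sum_(i < m.+1) (p i)%:num = 1.

Lemma star_law_setT : star_law p [set: mstar m] = 1%E.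
Proof.
have [E [EE E1]] := @exp_law_measure R.
rewrite /star_law (eq_bigr (fun i => (p i)%:num%:E)) => [|i _]; last first.
  by rewrite preimage_setT EE E1 mule1.
by rewrite sumEFin p1.
Qed.

Lemma integral_star_law_le (f g : mstar m -> \bar R) (c : R) :
  measurable_fun [set: mstar m] f -> measurable_fun [set: mstar m] g ->
  (forall x, 0 <= f x)%E -> (forall x, 0 <= g x)%E -> 0 <= c ->
  (forall i, \int[mu]_s (f (star_proj i s) * (exponential_pdf 1 s)%:E) <=
    c%:E * \int[mu]_s (g (star_proj i s) * (exponential_pdf 1 s)%:E))%E ->
  (\int[star_law p]_x f x <= c%:E * \int[star_law p]_x g x)%E.
Proof.
move=> mf mg f0 g0 c0 fg; rewrite !integral_star_law//.
have int0 i : (0 <= \int[mu]_s (g (star_proj i s) * (exponential_pdf 1 s)%:E))%E.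
  by apply: integral_ge0 => s _; rewrite mule_ge0// lee_fin exp_pdf_ge0.
rewrite ge0_sume_distrr; last by move=> i _; rewrite mule_ge0.
apply: lee_sum => i _; rewrite muleCA; apply: lee_wpmul2l => //.
Qed.

Variables (G : @mstar R m -> R).
Hypotheses (mG : measurable_fun [set: @mstar R m] G) (LG : Lip1 (@star_dist R m) G).

Let o : @mstar R m := star_center m.

(** The directed distance from any point to the center is 0. *)
Lemma star_center_le x : G o <= G x.
Proof.
have xge : 0 <= height x by have /andP[] := valP x.
rewrite -subr_le0; apply: (le_trans (LG x o)); rewrite /star_dist.
have -> : height o = 0 by [].
by rewrite mulr0 sub0r; case: ifP => // _; rewrite max_r ?mulr0// oppr_le0.
Qed.

Lemma star_leg_le i s t : 0 <= s -> s <= t ->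
  G (star_proj i t) - G (star_proj i s) <= 2 * (t - s).
Proof.
move=> s0 st; apply: (le_trans (LG _ _)).
rewrite /star_dist !star_projE !star_proj_leg.
rewrite (max_l s0) (max_l (le_trans s0 st)) max_l ?subr_ge0//.
(* At s = 0 the projected point is the center, whose leg is [ord0], possibly different from i; the
   distance is 2 t in both cases. *)
case: (ltgtP s 0) s0 st => // [s0 _ st|-> _ t0].
  by rewrite (lt_le_trans s0 st) eqxx.
by rewrite subr0; case: ifP.
Qed.

Lemma star_proj0 i : star_proj i 0 = o.
Proof.
apply: val_inj; rewrite /star_proj val_insubd /= lexx eqxx /=.
by case: eqP => [->|].
Qed.

Let u i s := G (star_proj i s) - G o.

Let u_le i s : 0 <= s -> u i s <= 2 * s.
Proof.
move=> s0; have := star_leg_le i (lexx 0) s0.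
by rewrite star_proj0 subr0.
Qed.

Let mGs i : measurable_fun [set: mR] (fun s : mR => G (star_proj i s)).
Proof. exact: (measurableT_comp mG (@measurable_star_proj R m i)). Qed.

(** Since the center minimizes G, positive mass below c forces G o <= c, hence (G - c)_+ <= 2 s on
    every leg. Then exp (2 lam s) exp (- s) is 1 / (1 - 2 lam) times the exponential density of rate
    1 - 2 lam. *)
Lemma star_exp_le lam c : 0 <= lam < 2^-1 ->
  (0 < star_law p [set x | (G x <= c)%R])%E ->
  (\int[star_law p]_x (expR (lam * Num.max (G x - c) 0))%:E <=
   ((1 - 2 * lam)^-1)%:E)%E.
Proof.
move=> /andP[lam0 lam2] Pc.
have rate0 : 0 < 1 - 2 * lam by lra.
have oc : G o <= c.
  rewrite leNgt; apply/negP => co; move: Pc.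
  rewrite (_ : [set x | _] = set0) ?measure0 ?ltxx//.
  apply/seteqP; split=> // x /= xc.
  by have := star_center_le x; rewrite leNgt (le_lt_trans xc).
have -> : (((1 - 2 * lam)^-1)%:E =
    ((1 - 2 * lam)^-1)%:E * \int[star_law p]_x cst 1 x)%E.
  rewrite [X in (_ * X)%E](_ : _ = 1%E) ?mule1//.
  by rewrite integral_cst// mul1e; exact: star_law_setT.
apply: integral_star_law_le => //.
- exact: (measurableT_comp (measurable_expmax lam c) mG).
- by rewrite invr_ge0 ltW.
move=> i; have -> : (\int[mu]_s (cst 1 (star_proj i s) *
    (exponential_pdf 1 s)%:E) = 1)%E.
  by under eq_integral do rewrite mul1e; exact: integral_exponential_pdf.
have mpdf r : measurable_fun [set: mR] (fun s => (exponential_pdf (r : R) s)%:E).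
  by apply/measurable_EFinP; exact: measurable_exponential_pdf.
rewrite mule1 -[leRHS]mule1 -(integral_exponential_pdf rate0) -ge0_integralZl//.
- apply: ge0_le_integral => //.
  + by move=> s _; rewrite -EFinM lee_fin mulr_ge0 ?expR_ge0 ?exp_pdf_ge0.
  + apply: emeasurable_funM => //.
    exact: (measurableT_comp (measurable_expmax lam c) (mGs i)).
  + exact: measurable_funeM.
  move=> s _; rewrite -!EFinM lee_fin.
  have [s0|s0] := ltP s 0.
    by rewrite !lt0_exponential_pdf// !mulr0.
  rewrite exp_pdfE// exponential_pdfE// mulrA mulVf ?gt_eqF// mul1r -expRD ler_expR.
  have us := u_le i s0.
  have : Num.max (G (star_proj i s) - c) 0 <= 2 * s.
    by rewrite ge_max mulr_ge0// andbT (le_trans _ us)// lerB.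
  by move=> /(ler_wpM2l lam0); lra.
- by move=> s _; rewrite lee_fin exponential_pdf_ge0// ltW.
- by rewrite lee_fin invr_ge0 ltW.
Qed.

(* With u = G - G(center) >= 0 one has E u^2 <= 4 E u, hence
   Var u <= 4 E u - (E u)^2 <= 4. *)
Lemma star_variance_le r : (forall x, - r <= G x <= r) ->
  exists a, (\int[star_law p]_x ((G x - a) ^+ 2)%:E <= 4%:E)%E.
Proof.
move=> Gr; pose v x := G x - G o.
have mv : measurable_fun [set: @mstar R m] v by exact: measurable_funB.
have v0 x : 0 <= v x by rewrite subr_ge0; exact: star_center_le.
have vr x : - (2 * r) <= v x <= 2 * r.
  by have /andP[? ?] := Gr x; have /andP[? ?] := Gr o; rewrite /v; apply/andP; split; lra.
have m1 := star_law_setT.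
have iv := bounded_integrable m1 mv vr.
have iv2 := bounded_integrable_sqr m1 mv vr.
have v2 : (\int[star_law p]_x (v x ^+ 2)%:E <= 4%:E * \int[star_law p]_x (v x)%:E)%E.
  apply: integral_star_law_le => //.
  - by apply/measurable_EFinP; exact: measurable_funX.
  - exact/measurable_EFinP.
  - by move=> x; rewrite lee_fin sqr_ge0.
  move=> i; apply: (@exp_law_sqr_le _ (fun s => v (star_proj i s))) => //.
  - exact: (measurableT_comp mv (@measurable_star_proj R m i)).
  - by rewrite /v star_proj0 subrr.
  - move=> s t s0 st; rewrite /v opprB addrA subrK; exact: star_leg_le.
pose E1 := \int[star_law p]_x v x; pose E2 := \int[star_law p]_x (v x ^+ 2).
have E21 : E2 <= 4 * E1.
  rewrite -lee_fin EFinM /E1 /E2 /Rintegral !fineK//; exact: integrable_fin_num.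
exists (G o + E1).
under eq_integral do rewrite opprD addrA -/(v _).
rewrite (integral_sqrB m1 E1 iv iv2) lee_fin -/E1 -/E2.
have := sqr_ge0 (E1 - 2); rewrite !expr2; nra.
Qed.

End star_bounds.

Local Notation star_base := (fun Y : qm_space R => exists (m : nat)
  (p : 'I_m.+1 -> {posnum R}),
  \sum_(i < m.+1) (p i)%:num = 1 /\ qm_down (star_qm p) Y).

Let star_class (Z : qm_data R) := exists (m : nat) (p : 'I_m.+1 -> {posnum R}),
  \sum_(i < m.+1) (p i)%:num = 1 /\ Z = star_qm p.

Let star_baseP Y : star_base Y -> exists2 Z, star_class Z & qm_le Y Z.
Proof. by move=> [m [p [p1 YZ]]]; exists (star_qm p) => //; exists m, p. Qed.

Lemma pyrS_exp_le (X : qm_space R) (F : X -> R) r c lam :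
  pyrS X -> observable r F -> 0 <= lam < 2^-1 ->
  (0 < qm_meas X [set x | (F x <= c)%R])%E ->
  (\int[qm_meas X]_x (expR (lam * Num.max (F x - c) 0))%:E <=
   ((1 - 2 * lam)^-1)%:E)%E.
Proof.
move=> SX oF lam02 Fc.
apply: (@closure_exp_le R star_class star_base star_baseP lam 0) oF Fc => //.
  by case/andP: lam02.
move=> Z G c' [m [p [p1 ZE]]]; subst Z => -[mG LG _].
exact: star_exp_le.
Qed.

Lemma Vdir_pyrS_le : (Vdir (@pyrS R) <= 4%:E)%E.
Proof.
apply: (Vdir_le star_baseP).
  by move=> Z [m [p [p1 ZE]]]; subst Z; exact: star_law_setT.
move=> Z G r [m [p [p1 ZE]]]; subst Z => -[mG LG Gr].
exact: (star_variance_le p1 mG LG Gr).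
Qed.

Lemma Eexp_pyrS_le lam : 0 <= lam < 2^-1 ->
  (Eexp lam (@pyrS R) <= ((1 - 2 * lam)^-1)%:E)%E.
Proof.
move=> lam02; apply: Eexp_le => X F r c SX oF Fc.
apply: (pyrS_exp_le SX oF lam02); apply: lt_le_trans Fc.
by rewrite lte_fin invr_gt0.
Qed.

End star_model.

(** * Lower bounds for stars, from the star with one leg *)

Section star_lower.
Local Open Scope classical_set_scope.
Context {R : realType}.
Local Notation mR := (measurableTypeR R).
Local Notation mu := (@lebesgue_measure R).

Lemma cvg_pinfty0 (f : R -> R) (c : R) :
  (forall x, 1 <= x -> `|f x| <= c / x) -> f x @[x --> +oo] --> 0.
Proof.
move=> fc; apply/cvgr0Pnorm_le => e e0; near=> x.
have x1 : 1 <= x by near: x; apply: nbhs_pinfty_ge; rewrite num_real.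
apply: (le_trans (fc x x1)).
rewrite ler_pdivrMr ?(lt_le_trans ltr01)// mulrC -ler_pdivrMr//.
Unshelve. all: by end_near. Qed.

(** The law of H is known only through nonnegative continuous test functions. Integrability comes
    from the absolute value and the square, and the mean from the positive and negative parts. *)
Lemma Vdir_ge_line (P : qm_family R) (Y : qm_space R) (H : Y -> R)
    (D : set R) (F p : R -> R) :
  P Y -> Lip1 (qm_dist Y) H -> measurable (D : set mR) ->
  (forall s, D s -> 0 <= p s) ->
  (forall f : R -> R, continuous f -> (forall s, 0 <= f s) ->
    (\int[qm_meas Y]_y (f (H y))%:E = \int[mu]_(s in D) (f (F s) * p s)%:E)%E) ->
  mu.-integrable D (fun s => (F s * p s)%:E) ->
  mu.-integrable D (fun s => (F s ^+ 2 * p s)%:E) ->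
  ((\int[mu]_(s in D) (F s ^+ 2 * p s) -
     (\int[mu]_(s in D) (F s * p s)) ^+ 2)%R%:E <= Vdir P)%E.
Proof.
move=> PY LH mD p0 HE iF iF2; have mH := measurable_Lip1 LH.
have iH : (qm_meas Y).-integrable setT (EFin \o H).
  apply/integrableP; split; first exact/measurable_EFinP.
  rewrite (eq_integral (fun y => (`|H y|)%:E))// (HE Num.norm)//; last exact: norm_continuous.
  case/integrableP: iF => _; apply: le_lt_trans.
  rewrite le_eqVlt; apply/orP; left; apply/eqP; apply: eq_integral => s.
  by rewrite inE => Ds; rewrite abse_EFin normrM (ger0_norm (p0 _ Ds)).
have E2 : (\int[qm_meas Y]_y (H y ^+ 2)%:E =
    \int[mu]_(s in D) (F s ^+ 2 * p s)%:E)%E.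
  apply: (HE (fun s => s ^+ 2)); first exact: exprn_continuous.
  by move=> s; exact: sqr_ge0.
have E1 : (\int[qm_meas Y]_y (H y)%:E = \int[mu]_(s in D) (F s * p s)%:E)%E.
  rewrite integralE [RHS]integralE; congr (_ - _)%E.
    transitivity (\int[qm_meas Y]_y (Num.max (H y) 0)%:E)%E.
      by apply: eq_integral => y _; rewrite funeposE EFin_max.
    rewrite (HE (fun s => Num.max s 0)); last 2 first.
    - by move=> s; apply: continuous_max => //; exact: cvg_cst.
    - by move=> s; rewrite le_max lexx orbT.
    apply: eq_integral => s; rewrite inE => Ds; rewrite funeposE -EFin_max.
    by rewrite maxr_pMl ?p0// mul0r.
  transitivity (\int[qm_meas Y]_y (Num.max (- H y) 0)%:E)%E.
    by apply: eq_integral => y _; rewrite funenegE EFin_max.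
  rewrite (HE (fun s => Num.max (- s) 0)); last 2 first.
  - by move=> s; apply: continuous_max; [exact: opp_continuous|exact: cvg_cst].
  - by move=> s; rewrite le_max lexx orbT.
  apply: eq_integral => s; rewrite inE => Ds; rewrite funenegE -EFinN -EFin_max.
  by rewrite maxr_pMl ?p0// mul0r mulNr.
have iH2 : (qm_meas Y).-integrable setT (fun y => (H y ^+ 2)%:E).
  apply/integrableP; split.
    by apply/measurable_EFinP; exact: measurable_funX.
  rewrite (eq_integral (fun y => (H y ^+ 2)%:E)); last first.
    by move=> y _; rewrite abse_EFin ger0_norm ?sqr_ge0.
  by rewrite E2; exact: integrable_lty iF2.
apply: le_trans (Vdir_ge PY LH iH iH2).
by rewrite /Rintegral E1 E2.
Qed.

(* -(a s^2 + b s + c) e^(-s) is an antiderivative of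
   (a s^2 + (b - 2 a) s + (c - b)) e^(-s). *)
Lemma exp_law_poly (a b c : R) :
  (forall s, 0 <= s -> 0 <= a * s ^+ 2 + (b - 2 * a) * s + (c - b)) ->
  (\int[mu]_(s in `[0%R, +oo[)
    ((a * s ^+ 2 + (b - 2 * a) * s + (c - b)) * expR (- s))%:E = c%:E)%E.
Proof.
move=> f0.
pose f (s : R) := (a * s ^+ 2 + (b - 2 * a) * s + (c - b)) * expR (- s).
pose F (s : R) := - ((a * s ^+ 2 + b * s + c) * expR (- s)).
rewrite (@ge0_continuous_FTC2y _ f F 0 0).
- by rewrite -EFinB /F oppr0 expR0; congr _%:E; ring.
- by move=> s s0; rewrite mulr_ge0 ?f0 ?expR_ge0.
- apply: continuous_subspaceT => x.
  by apply: differentiable_continuous; apply/derivable1_diffP; exact: ex_derive.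
(* The 6 is 3!: exp x >= 1 + x^3 / 6 gives x^2 exp (- x) <= 6 / x. *)
- apply: (@cvg_pinfty0 _ ((`|a| + `|b| + `|c|) * 6)) => x x1.
  have x0 : 0 < x by apply: lt_le_trans x1.
  rewrite /F normrN normrM (ger0_norm (expR_ge0 _)) expRN.
  rewrite ler_pdivrMr ?expR_gt0// -mulrA mulrAC -mulrA.
  have h1 : `|a * x ^+ 2 + b * x + c| <= (`|a| + `|b| + `|c|) * x ^+ 2.
    rewrite !mulrDl; apply: (le_trans (ler_normD _ _)); apply: lerD.
      apply: (le_trans (ler_normD _ _)); apply: lerD.
        by rewrite normrM (ger0_norm (sqr_ge0 x)).
      by rewrite normrM (gtr0_norm x0) ler_wpM2l// expr2; nra.
    by rewrite ler_peMr// expr2; nra.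
  apply: (le_trans h1); rewrite ler_wpM2l// ?addr_ge0//.
  have := expR_ge1Dxn 2 (ltW x0); rewrite -[3`!]/6%N => h2.
  rewrite -mulrA mulrC ler_pdivlMr// -exprSr.
  by have := expR_ge0 x; lra.
- by move=> x _; exact: ex_derive.
- apply: cvg_at_right_filter; suff : {for 0, continuous F} by [].
  by apply: differentiable_continuous; apply/derivable1_diffP; exact: ex_derive.
- move=> x _; rewrite derive1E; apply: derive_val.
  by apply: is_derive_eq; rewrite /GRing.scale/= /f; ring.
Qed.

Lemma exp_law_integralE (f : R -> R) :
  (\int[mu]_s ((f s)%:E * (exponential_pdf 1 s)%:E) =
   \int[mu]_(s in `[0%R, +oo[) (f s * expR (- s))%:E)%E.
Proof.
rewrite [in RHS]integral_mkcond; apply: eq_integral => s _; rewrite /patch.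
case: ifPn; rewrite !(inE, notin_setE)/= in_itv/= andbT => s0.
  by rewrite exp_pdfE// -EFinM.
by rewrite lt0_exponential_pdf ?mule0// ltNge; apply/negP.
Qed.

Let Z := @star_qm R 0 (fun=> 1%:pos).

Lemma pyrS_line : exists (Y : qm_space R) (H : Y -> R),
  [/\ pyrS Y, Lip1 (qm_dist Y) H &
    forall f : R -> R, measurable_fun [set: R] f -> (forall s, 0 <= f s) ->
      (\int[qm_meas Y]_y (f (H y))%:E =
       \int[mu]_(s in `[0%R, +oo[) (f (2 * s) * expR (- s))%:E)%E].
Proof.
pose F (x : Z) := 2 * height x.
have LF (x y : Z) : Num.max (F y - F x) 0 <= qm_dist Z x y.
  rewrite /= /star_dist (ord1 (leg x)) (ord1 (leg y)) eqxx.
  by rewrite maxr_pMr// mulrBr mulr0.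
have p1 : \sum_(i < 1) ((fun=> 1%:pos) i : {posnum R})%:num = 1 :> R by rewrite big_ord1.
have mF : measurable_fun [set: Z] F.
  apply: measurable_Lip1_dopen => [U oU|x y]; first exact: sub_gen_smallest.
  by apply: le_trans (LF x y); rewrite le_max lexx.
have Z1 : qm_meas Z [set: Z] = 1%E by exact: star_law_setT.
have F0 (z : Z) e : 0 < e -> (0 < qm_meas Z [set z' | (`|F z - F z'| < e)%R])%E.
  move=> e0; have h0 : 0 <= height z by have /andP[] := valP z.
  rewrite /= /star_law big_ord1 mul1e.
  set h := height z in h0 *.
  have [E [EE _]] := @exp_law_measure R.
  have mA : measurable (@star_proj R 0 ord0 @^-1` [set z' | `|F z - F z'| < e]).
    rewrite -[X in measurable X]setTI; apply: measurable_star_proj => //.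
    rewrite -[X in measurable X]setTI; apply: (mF _ [set y | `|F z - y| < e]) => //.
    by apply: open_measurable; exact: ball_open.
  (* On this interval 2 s stays within e / 2 of 2 h, and the exponential density is at least exp (-
     (h + e / 4)). *)
  apply: (@lt_le_trans _ _ (E `[h, (h + e / 4)]%classic)); last first.
    rewrite EE; apply: le_measure; rewrite ?inE// => s /=.
    rewrite in_itv/= => /andP[hs se]; rewrite /F star_projE max_l ?(le_trans h0)//.
    by rewrite -/h ltr_norml; apply/andP; split; lra.
  rewrite -EE /exponential_prob.
  apply: (@lt_le_trans _ _ (\int[mu]_(x in `[h, (h + e / 4)%R])
      (expR (- (h + e / 4)))%:E)%E).
    rewrite integral_cst//= lebesgue_measure_itv/= lte_fin ltrDl divr_gt0//.
    by rewrite -EFinB -EFinM lte_fin mulr_gt0 ?expR_gt0//; lra.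
  apply: ge0_le_integral => //.
  - apply: measurable_funTS; apply/measurable_EFinP.
    exact: measurable_exponential_pdf.
  - move=> s /=; rewrite in_itv/= => /andP[hs se].
    by rewrite lee_fin exp_pdfE ?(le_trans h0)// ler_expR lerN2.
have [Y [H [YZ LH HE]]] := line_quotient mF Z1 LF F0.
exists Y, H; split=> //.
  by apply: sub_box_closure; exists 0%N, (fun=> 1%:pos).
move=> f mf f0; rewrite (HE (EFin \o f)); last 2 first.
- exact/measurable_EFinP.
- by move=> s; rewrite lee_fin.
rewrite integral_star_law; last 2 first.
- by apply/measurable_EFinP; exact: (measurableT_comp mf mF).
- by move=> x; rewrite lee_fin.
rewrite big_ord1 mul1e -exp_law_integralE.
apply: eq_integral => s _; rewrite /F star_projE.
have [s0|s0] := ltP s 0; first by rewrite lt0_exponential_pdf// !mule0.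
by [].
Qed.

Lemma Eexp_pyrS_infty lam : 2^-1 <= lam -> Eexp lam (@pyrS R) = +oo%E.
Proof.
move=> lam2; have [Y [H [SY LH HE]]] := pyrS_line.
have lam0 : 0 <= lam by lra.
apply: (Eexp_infty lam0 SY LH).
rewrite (HE (fun s => expR (lam * s))); last 2 first.
- by apply: measurableT_comp => //; exact: measurable_funM.
- by move=> s; exact: expR_ge0.
apply/eqP; rewrite -leye_eq.
have <- : mu `[0%R, +oo[%classic = +oo%E by rewrite lebesgue_measure_itv/= ltry.
rewrite -[leLHS]mul1e -integral_cst//; apply: ge0_le_integral => //.
- by apply/measurable_EFinP; apply: measurable_funM; apply: measurable_funTS;
    apply: measurableT_comp => //; do ?exact: measurable_funM.
- move=> s /=; rewrite in_itv/= andbT => s0; rewrite lee_fin -expRD -[leLHS]expR0 ler_expR.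
  nra.
Qed.

Lemma Lambda_pyrS : Lambda (@pyrS R) = (2^-1)%:E.
Proof.
apply/eqP; rewrite eq_le; apply/andP; split.
  apply: ge_ereal_sup => _ [lam [lam0 Elam] <-]; rewrite lee_fin leNgt.
  by apply/negP => /ltW /Eexp_pyrS_infty E; rewrite E in Elam.
apply/lee_subgt0Pr => e e0.
(* The maximum with 1/4 keeps the order positive when e is large. *)
pose lam : R := Num.max (2^-1 - e) 4^-1.
have lam02 : 0 < lam < 2^-1.
  by rewrite /lam lt_max gt_max invr_gt0 ltr0n orbT /=; apply/andP; split; lra.
have /andP[lam0 lam2] := lam02.
apply: (@le_trans _ _ lam%:E); first by rewrite lee_fin /lam le_max lexx.
apply: ereal_sup_ubound; exists lam => //; split=> //.
apply: le_lt_trans (Eexp_pyrS_le _) _; first by rewrite (ltW lam0).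
by rewrite ltry.
Qed.

Lemma Vdir_pyrS : Vdir (@pyrS R) = 4%:E.
Proof.
apply/eqP; rewrite eq_le Vdir_pyrS_le/=.
have [Y [H [SY LH HE]]] := pyrS_line.
have p0 (s : R) : `[0, +oo[%classic s -> 0 <= expR (- s).
  by move=> _; exact: expR_ge0.
have I1 : (\int[mu]_(s in `[0%R, +oo[) (2 * s * expR (- s))%:E = 2%:E)%E.
  rewrite -(@exp_law_poly 0 2 2); last by move=> s s0; nra.
  by apply: eq_integral => s _; congr (_ * _)%:E; ring.
have I2 : (\int[mu]_(s in `[0%R, +oo[) ((2 * s) ^+ 2 * expR (- s))%:E = 8%:E)%E.
  rewrite -(@exp_law_poly 4 8 8); last by move=> s s0; nra.
  by apply: eq_integral => s _; congr (_ * _)%:E; ring.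
have mE : measurable_fun (`[0%R, +oo[%classic : set mR) (fun s : R => expR (- s)).
  by apply: measurable_funTS; exact: measurableT_comp.
have mS : measurable_fun (`[0%R, +oo[%classic : set mR) (fun s : R => 2 * s).
  by apply: measurable_funTS; exact: measurable_funM.
have int (g : R -> R) (c : R) : measurable_fun (`[0%R, +oo[%classic : set mR) g ->
    (forall s, 0 <= s -> 0 <= g s) ->
    (\int[mu]_(s in `[0%R, +oo[) (g s)%:E = c%:E)%E ->
    mu.-integrable `[0%R, +oo[%classic (EFin \o g).
  move=> mg g0 gc; apply/integrableP; split; first exact/measurable_EFinP.
  apply: le_lt_trans (ltry c); rewrite -gc le_eqVlt; apply/orP; left; apply/eqP.
  by apply: eq_integral => s; rewrite inE/= in_itv/= andbT => s0; rewrite ger0_norm ?g0.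
apply: le_trans (Vdir_ge_line SY LH _ p0 (fun f cf => HE f (continuous_measurable_fun cf)) _ _); first last.
- apply: (int _ 8) => //.
    by apply: measurable_funM => //; exact: measurable_funX.
  by move=> s s0; rewrite mulr_ge0 ?sqr_ge0 ?expR_ge0.
- apply: (int _ 2) => //; first exact: measurable_funM.
  by move=> s s0; rewrite !mulr_ge0 ?expR_ge0.
- exact: measurable_itv.
- by rewrite /Rintegral I1 I2/= lee_fin; lra.
Qed.

End star_lower.

(** * Logarithms of Gamma variables *)

Section real_line.
Local Open Scope classical_set_scope.
Context {R : realType}.
Local Notation mR := (measurableTypeR R).
Local Notation mu := (@lebesgue_measure R).

Let expand (n : nat) : set R := `[- n.+1%:R, n.+1%:R].

Let nd_expand : nondecreasing_seq expand.
Proof.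
move=> m n mn; rewrite subsetEset => x; rewrite /expand/= !in_itv/= => /andP[].
have : m.+1%:R <= n.+1%:R :> R by rewrite ler_nat.
by move=> ? ? ?; apply/andP; split; lra.
Qed.

Let expand_bound (x : R) n : (Num.truncn `|x| <= n)%N -> expand n x.
Proof.
rewrite truncn_le_nat => /ltW; rewrite /expand/= in_itv/=.
by rewrite ler_norml.
Qed.

Let bigcup_expand : \bigcup_n expand n = [set: R].
Proof.
by rewrite -subTset => x _; exists (Num.truncn `|x|) => //; exact: expand_bound.
Qed.

(** The substitution y = exp (a x + c) is made on the compact intervals [- (n + 1), n + 1] and their
    images, and both sides pass to the limit by monotone convergence. It is used with a = 1 for the
    Gamma integral and a = 1/2 for the chi density. *)
Lemma ge0_integral_exp_affine (f : R -> R) (a c : R) : 0 < a ->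
  (forall y, 0 < y -> {for y, continuous f}) -> (forall y, 0 < y -> 0 <= f y) ->
  (\int[mu]_(y in `]0%R, +oo[) (f y)%:E =
   \int[mu]_x (f (expR (a * x + c)) * (a * expR (a * x + c)))%:E)%E.
Proof.
move=> a0 cf f0; pose e (x : R) := expR (a * x + c).
have e'E (x : R) : is_derive x 1 e (a * e x).
  by apply: is_derive_eq; rewrite /GRing.scale/= /e; ring.
have ce (x : R) : {for x, continuous e}.
  by apply: differentiable_continuous; apply/derivable1_diffP; exact: ex_derive.
have De : e^`() = (fun x => a * e x).
  by apply/funext => x; rewrite derive1E; exact: derive_val.
have cDe : continuous e^`() by move=> x; rewrite De; apply: continuousM; [exact: cvg_cst|exact: ce].
pose E n := `[e (- n.+1%:R), e n.+1%:R]%classic.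
have bE : \bigcup_n E n = `]0%R, +oo[%classic.
  apply/seteqP; split=> [y [n _]|y].
    rewrite /E/= !in_itv/= andbT => /andP[+ _].
    by apply: lt_le_trans; exact: expR_gt0.
  rewrite /= in_itv/= andbT => y0; pose x := (ln y - c) / a.
  have xy : y = e x by rewrite /e /x mulrC divfK ?gt_eqF// subrK lnK.
  exists (Num.truncn `|x|) => //; have := @expand_bound x _ (leqnn _).
  rewrite /expand /E/= !in_itv/= => /andP[x1 x2]; rewrite xy.
  by rewrite !ler_expR !lerD2r !ler_pM2l// x1 x2.
have E0 n y : E n y -> 0 < y.
  by move=> Ey; have : (\bigcup_n E n) y by [exists n]; rewrite bE/= in_itv/= andbT.
have cg : continuous (fun x : R => f (e x) * (a * e x)).
  move=> x; apply: (@continuousM _ _ (f \o e) (fun x => a * e x)); last first.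
    by apply: continuousM; [exact: cvg_cst|exact: ce].
  by apply: continuous_comp; [exact: ce|apply: cf; exact: expR_gt0].
have := @ge0_nondecreasing_set_cvg_integral _ mR R E (EFin \o f) mu.
have := @ge0_nondecreasing_set_cvg_integral _ mR R expand
  (fun x => (f (e x) * (a * e x))%:E) mu.
rewrite bigcup_expand bE => c1 c2.
apply: (cvg_unique _ (c2 _ _ _ _)) => //.
- move=> m n mn; rewrite subsetEset => y; rewrite /E/= !in_itv/= => /andP[].
  have mn' : m.+1%:R <= n.+1%:R :> R by rewrite ler_nat.
  have le_e (u v : R) : u <= v -> e u <= e v.
    by move=> uv; rewrite /e ler_expR lerD2r ler_pM2l.
  move=> h1 h2; rewrite (le_trans h2 (le_e _ _ mn')) andbT.
  by apply: le_trans h1; apply: le_e; rewrite lerN2.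
- by move=> n; exact: measurable_itv.
- move=> n; apply/measurable_EFinP; apply: subspace_continuous_measurable_fun.
    exact: measurable_itv.
  by apply: continuous_in_subspaceT => y; rewrite inE => /E0; exact: cf.
- by move=> n y /E0 y0; rewrite lee_fin f0.
rewrite (_ : (fun n => _) = (fun n => \int[mu]_(x in expand n)
    (f (e x) * (a * e x))%:E)%E).
  apply: c1 => //.
  - by move=> n; exact: measurable_itv.
  - move=> n; apply/measurable_EFinP; apply: measurable_funTS.
    exact: continuous_measurable_fun cg.
  - by move=> n x _; rewrite lee_fin !mulr_ge0 ?f0 ?expR_ge0 ?expR_gt0// ltW.
apply/funext => n; rewrite /E (integration_by_substitution_increasing (F := e)).
- by apply: eq_integral => x _; rewrite /= De.
- by rewrite (@le_trans _ _ 0)// oppr_le0.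
- by move=> x y _ _ xy; rewrite ltr_expR ltrD2r ltr_pM2l.
- by move=> x _; exact: cDe.
- apply/cvg_ex; exists (e^`() (- n.+1%:R)); apply: cvg_at_right_filter; exact: cDe.
- apply/cvg_ex; exists (e^`() n.+1%:R); apply: cvg_at_left_filter; exact: cDe.
- split=> [x _||]; first exact: ex_derive.
  + by apply: cvg_at_right_filter; exact: ce.
  + by apply: cvg_at_left_filter; exact: ce.
- by apply: continuous_in_subspaceT => y; rewrite inE => /E0; exact: cf.
Qed.

Lemma integrable_oneDsqrV : mu.-integrable [set: R] (EFin \o (fun t => (1 + t ^+ 2)^-1)).
Proof.
have cf := @continuous_oneDsqrV R.
have f0 (t : R) : 0 <= (1 + t ^+ 2)^-1 by rewrite invr_ge0 addr_ge0 ?sqr_ge0.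
apply/integrableP; split.
  by apply/measurable_EFinP; exact: continuous_measurable_fun.
rewrite (_ : integral _ _ _ = \int[mu]_t ((1 + t ^+ 2)^-1)%:E)%E; last first.
  by apply: eq_integral => t _; rewrite /= ger0_norm.
rewrite (@ge0_symfun_integralT R (fun t => (1 + t ^+ 2)^-1))//; last first.
  by move=> t; rewrite /= sqrrN.
rewrite (_ : [set x | _] = `[0, +oo[%classic); last first.
  by apply/seteqP; split => x/=; rewrite in_itv/= andbT.
have := @integral0y_oneDsqr R; rewrite /oneDsqr => ->.
by rewrite -EFinM ltry.
Qed.

Lemma integrable_oneDsqr_dom (f : R -> R) (C : R) : continuous f ->
  (forall t, `|f t| <= C / (1 + t ^+ 2)) -> mu.-integrable [set: R] (EFin \o f).
Proof.
move=> cf fC; apply: (@le_integrable _ mR R mu setT measurableT _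
    (fun t : R => (C * (1 + t ^+ 2)^-1)%:E)) => //.
- by apply/measurable_EFinP; exact: continuous_measurable_fun.
- move=> t _; rewrite /= lee_fin; apply: (le_trans (fC t)); exact: ler_norm.
- under [X in _.-integrable _ X]eq_fun do rewrite EFinM.
  exact: integrableZl integrable_oneDsqrV.
Qed.

(** The integrals over [- (n + 1), n + 1] equal the increments of F, which tend to 0, and by
    dominated convergence they tend to the integral of f. *)
Lemma integral_derivative_eq0 (f F : R -> R) (C : R) :
  mu.-integrable [set: R] (EFin \o f) -> continuous f ->
  (forall t : R, is_derive t 1 F (f t)) ->
  (forall t, `|F t| <= C / (1 + t ^+ 2)) -> \int[mu]_t f t = 0.
Proof.
move=> fi cf dF FC.
have [|||||_ _ cv] := @dominated_convergence _ mR R mu setT measurableT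
    (fun n => (EFin \o f) \_ (expand n)) (EFin \o f) (abse \o (EFin \o f)).
- move=> n.
  have mE : measurable (expand n : set mR) by exact: measurable_itv.
  apply: (measurable_restrictT (EFin \o f : mR -> \bar R) mE).1.
  apply/measurable_EFinP; apply: measurable_funTS.
  exact: continuous_measurable_fun.
- by apply/measurable_EFinP; exact: continuous_measurable_fun.
- apply: aeW => x _; apply: cvg_near_cst; exists (Num.truncn `|x|) => //= n /= xn.
  by rewrite patchE mem_set//; exact: expand_bound.
- exact: integrable_abse.
- apply: aeW => x n _; rewrite patchE; case: ifPn => // _.
  by rewrite abse0 abse_ge0.
have cF t : {for t, continuous F}.
  by apply: differentiable_continuous; apply/derivable1_diffP; exact: ex_derive.
have I n : (\int[mu]_x ((EFin \o f) \_ (expand n)) x =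
    (F n.+1%:R - F (- n.+1%:R))%:E)%E.
  rewrite -integral_mkcond (continuous_FTC2 (F := F))//.
  - by rewrite (@lt_trans _ _ 0)// oppr_lt0.
  - exact: continuous_subspaceT.
  - split=> [x _||]; first exact: ex_derive.
    + by apply: cvg_at_right_filter; exact: cF.
    + by apply: cvg_at_left_filter; exact: cF.
  - by move=> x _; rewrite derive1E; exact: derive_val.
have C0 : 0 <= C by have := FC 0; rewrite expr0n addr0 divr1; exact: le_trans.
suff c0 : ((F n.+1%:R - F (- n.+1%:R))%:E @[n --> \oo] --> 0)%E.
  rewrite /Rintegral; suff -> : (\int[mu]_x (f x)%:E = 0)%E by [].
  by move: c0; rewrite -(funext I) => c0; exact: (cvg_unique _ cv c0).
apply: cvg_EFin; first exact: nearW.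
apply: (@squeeze_cvgr _ _ _ _ (fun n => - (2 * C * n.+1%:R^-1)) (fun n => 2 * C * n.+1%:R^-1)).
- apply: nearW => n; rewrite -ler_norml/= (le_trans (ler_normB _ _))//.
  have := FC n.+1%:R; have := FC (- n.+1%:R); rewrite sqrrN.
  have : (1 + n.+1%:R ^+ 2)^-1 <= n.+1%:R^-1 :> R.
    rewrite lef_pV2 ?posrE ?ltr_wpDr ?sqr_ge0 ?ltr01//.
    have : 1 <= n.+1%:R :> R by rewrite ler1n.
    by set h : R := n.+1%:R => h1; nra.
  set h : R := n.+1%:R^-1; set k := (1 + _)^-1 => kh.
  by have := ler_wpM2l C0 kh; lra.
- rewrite -oppr0; apply: cvgN; rewrite -[X in _ --> X](mulr0 (2 * C)).
  by apply: cvgMl_tmp; exact: cvg_harmonic.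
- rewrite -[X in _ --> X](mulr0 (2 * C)).
  by apply: cvgMl_tmp; exact: cvg_harmonic.
Qed.

End real_line.

Section log_gamma.
Local Open Scope classical_set_scope.
Context {R : realType}.
Local Notation mR := (measurableTypeR R).
Local Notation mu := (@lebesgue_measure R).
Implicit Types b t : R.

(** The unnormalized density of the logarithm of a Gamma variable of parameter b; its total mass is
    Gamma b. *)
Definition lgamma_pdf b t : R := expR (b * t - expR t).

Lemma lgamma_pdf_ge0 b t : 0 <= lgamma_pdf b t.
Proof. exact: expR_ge0. Qed.

Lemma continuous_lgamma_pdf b : continuous (lgamma_pdf b).
Proof.
by move=> t; apply: differentiable_continuous; apply/derivable1_diffP; exact: ex_derive.
Qed.

Lemma lgamma_pdfS b t : lgamma_pdf (b + 1) t = expR t * lgamma_pdf b t.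
Proof. by rewrite /lgamma_pdf -expRD; congr expR; ring. Qed.

(** The density decays like exp (- c |t|) with c = min b 1. One factor 1 + t^2 is meant to absorb
    t^j for j <= 2, the other to leave an integrable bound. *)
Lemma lgamma_pdf_le b : 0 < b ->
  exists C, forall t, (1 + t ^+ 2) ^+ 2 * lgamma_pdf b t <= C.
Proof.
move=> b0; pose c := Num.min b 1.
have c0 : 0 < c by rewrite /c lt_min b0 ltr01.
have [cb c1] : c <= b /\ c <= 1 by rewrite /c !ge_min !lexx orbT.
(* K is the maximum of (b + 1) t - exp t, so that b t - exp t <= K - t. *)
pose K := (b + 1) * (ln (b + 1) - 1).
have wK t : lgamma_pdf b t <= expR `|K| / expR (c * `|t|).
  rewrite -expRN -expRD ler_expR; have [t0|t0] := leP 0 t.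
    have b1 : 0 < b + 1 by lra.
    have := expR_ge1Dx (t - ln (b + 1)); rewrite expRB lnK// ler_pdivlMr//.
    have -> : (1 + (t - ln (b + 1))) * (b + 1) = (b + 1) * t - K.
      by rewrite /K; ring.
    have : c * t <= 1 * t by rewrite ler_wpM2r.
    by have := ler_norm K; rewrite (ger0_norm t0); lra.
  have : b * t <= c * t by rewrite ler_wnM2r// ltW.
  by have := expR_ge0 t; have := normr_ge0 K; rewrite (ltr0_norm t0); lra.
(* Chosen so that D (1 + (c t)^4 / 24) >= 2 + 2 t^4 >= (1 + t^2)^2, in view of the fourth-order
   bound on exp (c |t|). *)
pose D := 2 + 48 / c ^+ 4.
have D0 : 0 <= D by rewrite /D addr_ge0// divr_ge0// exprn_ge0// ltW.
exists (D * expR `|K|) => t.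
apply: (@le_trans _ _ ((1 + t ^+ 2) ^+ 2 * (expR `|K| / expR (c * `|t|)))).
  by rewrite ler_wpM2l ?sqr_ge0.
rewrite mulrA ler_pdivrMr ?expR_gt0// [leRHS]mulrAC ler_wpM2r ?expR_ge0//.
have := expR_ge1Dxn 3 (mulr_ge0 (ltW c0) (normr_ge0 t)).
have t4 : `|t| ^+ 4 = (t ^+ 2) ^+ 2.
  by rewrite -normrX ger0_norm ?exprn_even_ge0// -exprM.
rewrite -[4`!]/24%N exprMn t4 => h.
apply: le_trans (ler_wpM2l D0 h).
have -> : D * (1 + c ^+ 4 * (t ^+ 2) ^+ 2 / 24) =
    2 + 48 / c ^+ 4 + c ^+ 4 * (t ^+ 2) ^+ 2 / 12 + 2 * (t ^+ 2) ^+ 2.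
  by rewrite /D; field; rewrite gt_eqF.
have : 0 <= 48 / c ^+ 4 by rewrite divr_ge0// exprn_ge0// ltW.
have : 0 <= c ^+ 4 * (t ^+ 2) ^+ 2 / 12.
  by rewrite divr_ge0// mulr_ge0 ?sqr_ge0// exprn_ge0// ltW.
by have := sqr_ge0 (t ^+ 2 - 1); lra.
Qed.

Lemma lgamma_moment_le b j : 0 < b -> (j <= 2)%N ->
  exists C, forall t, `|t ^+ j * lgamma_pdf b t| <= C / (1 + t ^+ 2).
Proof.
move=> b0 j2; have [C HC] := lgamma_pdf_le b0; exists C => t.
have t2 : 0 < 1 + t ^+ 2 by rewrite ltr_wpDr ?sqr_ge0.
have h : `|t ^+ j| <= 1 + t ^+ 2.
  rewrite -(real_normK (num_real t)) normrX; have := normr_ge0 t.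
  by case: j j2 => [|[|[|//]]] _; rewrite ?expr0 ?expr1; set x := `|t| => x0; nra.
rewrite ler_pdivlMr// normrM (ger0_norm (lgamma_pdf_ge0 _ _)).
apply: le_trans (HC t); rewrite -mulrA (mulrC (lgamma_pdf b t)) mulrA.
by rewrite ler_wpM2r ?lgamma_pdf_ge0// expr2 ler_wpM2r// ltW.
Qed.

Lemma continuous_lgamma_moment b j : continuous (fun t => t ^+ j * lgamma_pdf b t).
Proof.
move=> t; apply: (@continuousM _ _ (fun t : R => t ^+ j) (lgamma_pdf b)).
  exact: exprn_continuous.
exact: continuous_lgamma_pdf.
Qed.

Lemma integrable_lgamma_moment b j : 0 < b -> (j <= 2)%N ->
  mu.-integrable [set: R] (fun t => (t ^+ j * lgamma_pdf b t)%:E).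
Proof.
move=> b0 /(lgamma_moment_le b0)[C HC].
by apply: integrable_oneDsqr_dom HC; exact: continuous_lgamma_moment.
Qed.

Definition lgamma_moment b j := \int[mu]_t (t ^+ j * lgamma_pdf b t).

(** The derivative of t^j [lgamma_pdf b t] integrates to 0, and its term in exp t shifts b to b + 1.
    For j = 0 this is the functional equation of Gamma. *)
Lemma lgamma_momentS b j : 0 < b -> (j <= 2)%N ->
  lgamma_moment (b + 1) j = b * lgamma_moment b j + j%:R * lgamma_moment b j.-1.
Proof.
move=> b0 j2; have b1 : 0 < b + 1 by lra.
have j2' : (j.-1 <= 2)%N by apply: leq_trans (leq_pred _) j2.
have [C HC] := lgamma_moment_le b0 j2.
have i1 := integrable_lgamma_moment b0 j2.
have i2 := integrable_lgamma_moment b0 j2'.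
have i3 := integrable_lgamma_moment b1 j2.
pose f1 t := b * (t ^+ j * lgamma_pdf b t).
pose f2 t := j%:R * (t ^+ j.-1 * lgamma_pdf b t).
pose f3 t := t ^+ j * lgamma_pdf (b + 1) t.
have i1' : mu.-integrable setT (EFin \o f1) := integrableZl measurableT b i1.
have i2' : mu.-integrable setT (EFin \o f2) := integrableZl measurableT (j%:R) i2.
have i3' : mu.-integrable setT (EFin \o f3) := i3.
have i12 : mu.-integrable setT (EFin \o (fun t => f1 t + f2 t)).
  exact: (integrableD measurableT i1' i2').
pose f t := f1 t + f2 t - f3 t.
have fi : mu.-integrable [set: R] (EFin \o f) by exact: (integrableB measurableT i12 i3).
have cf : continuous f.
  move=> t; apply: cvgB; last exact: continuous_lgamma_moment.
  apply: cvgD; (apply: cvgM; first exact: cvg_cst);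
    exact: continuous_lgamma_moment.
have df t : is_derive t 1 (fun t => t ^+ j * lgamma_pdf b t) (f t).
  have dw : is_derive t 1 (lgamma_pdf b) ((b - expR t) * lgamma_pdf b t).
    by rewrite /lgamma_pdf; apply: is_derive_eq; rewrite /GRing.scale/=; ring.
  have := is_deriveM (is_deriveX j (is_derive_id t (1 : R))) dw.
  rewrite (_ : id ^+ j * _ = fun t => t ^+ j * lgamma_pdf b t); last first.
    by apply/funext => x; rewrite [LHS]/GRing.mul/= fctE.
  move=> dp; apply: is_derive_eq.
  by rewrite /GRing.scale/= /f /f1 /f2 /f3 lgamma_pdfS fctE; ring.
have := integral_derivative_eq0 fi cf df HC.
rewrite (RintegralB measurableT i12 i3') (RintegralD measurableT i1' i2').
rewrite /f1 /f2 (RintegralZl b measurableT i1) (RintegralZl j%:R measurableT i2).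
by move=> /eqP; rewrite subr_eq0 => /eqP h; exact: esym h.
Qed.

Lemma lgamma_moment0_gt0 b : 0 < b -> 0 < lgamma_moment b 0.
Proof.
move=> b0; have bi := integrable_lgamma_moment b0 (leq0n 2).
rewrite /lgamma_moment -lte_fin /Rintegral fineK; last exact: integrable_fin_num bi.
apply: (@lt_le_trans _ _ (\int[mu]_(t in `[0%R, 1%R]) (expR (- expR 1))%:E)%E).
  rewrite integral_cst//= lebesgue_measure_itv/= lte_fin ltr01 oppr0 adde0 mule1.
  by rewrite lte_fin expR_gt0.
apply: (@le_trans _ _ (\int[mu]_(t in `[0%R, 1%R]) (t ^+ 0 * lgamma_pdf b t)%:E)%E).
  apply: ge0_le_integral => //=.
  - apply/measurable_EFinP; apply: measurable_funTS.
    by apply: continuous_measurable_fun; exact: continuous_lgamma_moment.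
  - move=> t; rewrite in_itv/= => /andP[t0 t1]; rewrite lee_fin expr0 mul1r ler_expR.
    have : expR t <= expR 1 by rewrite ler_expR.
    have : 0 <= b * t by rewrite mulr_ge0// ltW.
    by move=> h1 h2; lra.
apply: ge0_subset_integral => //=.
  apply/measurable_EFinP.
  by apply: continuous_measurable_fun; exact: continuous_lgamma_moment.
by move=> t _; rewrite lee_fin expr0 mul1r lgamma_pdf_ge0.
Qed.

(** The variance of the logarithm of a Gamma variable of parameter b, that is, the trigamma function
    at b. *)
Definition lgamma_variance b :=
  lgamma_moment b 2 / lgamma_moment b 0 - (lgamma_moment b 1 / lgamma_moment b 0) ^+ 2.

Lemma lgamma_variance_ge0 b : 0 < b -> 0 <= lgamma_variance b.
Proof.
move=> b0; have M0 := lgamma_moment0_gt0 b0.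
pose x := lgamma_moment b 1 / lgamma_moment b 0.
have i0 := integrable_lgamma_moment b0 (leq0n 2).
have i1 := integrable_lgamma_moment b0 (leqnSn 1).
have i2 := integrable_lgamma_moment b0 (leqnn 2).
pose f1 t := t ^+ 2 * lgamma_pdf b t.
pose f2 t := - 2 * x * (t ^+ 1 * lgamma_pdf b t).
pose f3 t := x ^+ 2 * (t ^+ 0 * lgamma_pdf b t).
have i1' : mu.-integrable setT (EFin \o f1) := i2.
have i2' : mu.-integrable setT (EFin \o f2) := integrableZl measurableT _ i1.
have i3' : mu.-integrable setT (EFin \o f3) := integrableZl measurableT _ i0.
have i12 : mu.-integrable setT (EFin \o (fun t => f1 t + f2 t)).
  exact: (integrableD measurableT i1' i2').
have : 0 <= \int[mu]_t (f1 t + f2 t + f3 t).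
  apply: Rintegral_ge0 => t _; rewrite (_ : _ + _ = (t - x) ^+ 2 * lgamma_pdf b t).
    by rewrite mulr_ge0 ?sqr_ge0 ?lgamma_pdf_ge0.
  by rewrite /f1 /f2 /f3; ring.
rewrite (RintegralD measurableT i12 i3') (RintegralD measurableT i1' i2').
rewrite /f2 /f3 (RintegralZl _ measurableT i1) (RintegralZl _ measurableT i0).
rewrite -!/(lgamma_moment b _) => h.
have : 0 <= (lgamma_moment b 2 + - 2 * x * lgamma_moment b 1 + x ^+ 2 * lgamma_moment b 0)
    / lgamma_moment b 0 by rewrite divr_ge0// ltW.
congr (0 <= _); rewrite /lgamma_variance /x; field.
by rewrite gt_eqF.
Qed.

Lemma lgamma_varianceS b : 0 < b ->
  lgamma_variance (b + 1) = lgamma_variance b - b ^- 2.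
Proof.
move=> b0; have M0 := lgamma_moment0_gt0 b0.
rewrite /lgamma_variance !lgamma_momentS//=.
by field; rewrite !gt_eqF.
Qed.

(** Applying the recursion n times leaves the variance at b + n, which is nonnegative. *)
Lemma lgamma_variance_ge b n : 0 < b ->
  \sum_(i < n) (b + i%:R) ^- 2 <= lgamma_variance b.
Proof.
elim: n b => [|n IH] b b0; first by rewrite big_ord0 lgamma_variance_ge0.
have b1 : 0 < b + 1 by lra.
have := IH _ b1; rewrite lgamma_varianceS// big_ord_recl addr0.
under eq_bigr do rewrite -addrA nat1r.
by rewrite -lerBrDl.
Qed.

End log_gamma.

(** * The sum of the inverse squares of the odd integers *)

Section basel.
Context {R : realType}.
Implicit Types x : R.

Lemma mul_cos_le_sin x : 0 <= x <= pi / 2 -> x * cos x <= sin x.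
Proof.
move=> /andP[x0 xpi]; pose f (y : R) := sin y - y * cos y.
have df (y : R) : is_derive y 1 f (y * sin y).
  by apply: is_derive_eq; rewrite /GRing.scale/=; ring.
have cf : continuous f.
  by move=> y; apply: differentiable_continuous; apply/derivable1_diffP; exact: ex_derive.
suff : f 0 <= f x by rewrite /f sin0 mul0r subr0 subr_ge0.
apply: (@ger0_derive1_le_cc R f 0 (pi / 2)) => //.
- move=> y; rewrite in_itv/= => /andP[y0 ypi].
  rewrite derive1E (@derive_val _ _ _ _ _ _ _ (df y)) mulr_ge0 ?ltW//.
  by rewrite sin_gt0_pi//; have := pi_gt0 R; move=> ?; apply/andP; split; lra.
- exact: continuous_subspaceT.
- by rewrite in_itv/= lexx (le_trans x0).
- by rewrite in_itv/= x0.
Qed.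

(** Equivalent to cot x <= 1 / x, since 1 / sin^2 = cot^2 + 1. *)
Lemma sin_sqrV_le x : 0 < x < pi / 2 -> sin x ^- 2 <= x ^- 2 + 1.
Proof.
move=> /andP[x0 xpi]; have := pi_gt0 R => pi0.
have s0 : 0 < sin x by apply: sin_gt0_pi; rewrite ?in_itv/= ?x0/=; lra.
have xc : x * cos x <= sin x by apply: mul_cos_le_sin; rewrite !ltW.
have c0 : 0 < cos x by apply: cos_gt0_pihalf; apply/andP; split; lra.
have -> : sin x ^- 2 = (cos x ^+ 2 + sin x ^+ 2) / sin x ^+ 2.
  by rewrite cos2Dsin2 mul1r.
rewrite -subr_ge0 (_ : _ - _ = (sin x ^+ 2 - (x * cos x) ^+ 2) / (x * sin x) ^+ 2).
  by rewrite divr_ge0 ?sqr_ge0// subr_ge0 lerXn2r// ?nnegrE ?mulr_ge0// ltW.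
by field; rewrite !gt_eqF.
Qed.

Lemma sin_sqrV_double x : 0 < x < pi / 2 ->
  sin x ^- 2 + sin (pi / 2 - x) ^- 2 = 4 * sin (2 * x) ^- 2.
Proof.
move=> /andP[x0 xpi]; have := pi_gt0 R => pi0.
have s0 : 0 < sin x by apply: sin_gt0_pi; apply/andP; split; lra.
have c0 : 0 < cos x by apply: cos_gt0_pihalf; apply/andP; split; lra.
rewrite [pi / 2 - x]addrC sinDpihalf cosN (mulr_natl x) sin_mulr2n.
have -> : 4 * (cos x * sin x *+ 2) ^- 2 =
    (cos x ^+ 2 + sin x ^+ 2) / (cos x * sin x) ^+ 2.
  by rewrite cos2Dsin2; field; rewrite !gt_eqF.
by field; rewrite !gt_eqF.
Qed.

Lemma sum_double_rev (f : nat -> R) N :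
  \sum_(k < N.*2) f k = \sum_(k < N) (f k + f (N.*2 - k.+1)%N).
Proof.
rewrite big_split/= -!(big_mkord xpredT) (big_cat_nat (n := N))//=; last first.
  by rewrite -addnn leq_addr.
congr (_ + _); rewrite big_nat_rev -{1}[N]add0n big_addn -addnn addnK.
by rewrite big_mkord; apply: eq_bigr => i _; congr f; have := ltn_ord i; lia.
Qed.

Let angle m k : R := (k.*2.+1)%:R * pi / (4 * 2 ^+ m).

Let angle_itv m k : (k < 2 ^ m)%N -> 0 < angle m k < pi / 2.
Proof.
move=> km; have := pi_gt0 R => pi0.
have m0 : 0 < 4 * 2 ^+ m :> R by rewrite mulr_gt0// exprn_gt0.
rewrite /angle divr_gt0 ?mulr_gt0//= ltr_pdivrMr//.
rewrite (_ : _ / 2 * _ = (2 ^ m).*2%:R * pi :> R).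
  by rewrite ltr_pM2r// ltr_nat -doubleS leq_double.
by rewrite -muln2 natrM natrX; field.
Qed.

(** The angles at stage m + 1 are symmetric about pi / 4 and their doubles are those at stage m.
    Pairing x with pi / 2 - x in the doubling identity therefore multiplies the sum by 4. *)
Let sum_sin_sqrV m : \sum_(k < 2 ^ m) sin (angle m k) ^- 2 = 2 * 4 ^+ m.
Proof.
elim: m => [|m IH].
  rewrite expn0 big_ord1 expr0 mulr1 /angle mul1r mulr1.
  have /sin_sqrV_double : 0 < (pi : R) / 4 < pi / 2.
    by have := pi_gt0 R; move=> ?; apply/andP; split; lra.
  rewrite (_ : pi / 2 - pi / 4 = pi / 4 :> R); last by field.
  rewrite (_ : 2 * (pi / 4) = pi / 2 :> R); last by field.
  by rewrite sin_pihalf expr1n invr1; lra.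
rewrite expnS mul2n (sum_double_rev (fun k => sin (angle m.+1 k) ^- 2)).
rewrite exprS mulrCA -IH mulr_sumr; apply: eq_bigr => k _.
have kE : 2 * angle m.+1 k = angle m k by rewrite /angle exprS; field; rewrite expf_neq0.
rewrite -kE -sin_sqrV_double; last first.
  apply: angle_itv; rewrite expnS mul2n -addnn; apply: leq_trans (ltn_ord k) _.
  exact: leq_addr.
congr (_ + sin _ ^- 2); rewrite /angle.
have -> : ((2 ^ m).*2 - k.+1).*2.+1%:R = 4 * 2 ^+ m - (k.*2.+1)%:R :> R.
  apply/eqP; rewrite eq_sym subr_eq -natrX -natrM -natrD; apply/eqP; congr _%:R.
  by have := ltn_ord k; lia.
by rewrite exprS; field; rewrite expf_neq0.
Qed.

(** The term k has angle (2 k + 1) pi / (4 2^m), whose inverse square is 4 4^m / pi^2 times (1/2 +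
    k)^(-2). Bounding 1 / sin^2 by this plus 1 costs 2^m in total, hence the error after division by
    4 4^m / pi^2. *)
Lemma sum_odd_sqrV_ge m :
  pi ^+ 2 / 2 - pi ^+ 2 / 4 / 2 ^+ m <= \sum_(k < 2 ^ m) (2^-1 + k%:R) ^- 2 :> R.
Proof.
have pi0 := pi_gt0 R; have m0 : 0 < 2 ^+ m :> R by rewrite exprn_gt0.
have : \sum_(k < 2 ^ m) sin (angle m k) ^- 2 <=
    \sum_(k < 2 ^ m) (4 * 4 ^+ m / pi ^+ 2 * (2^-1 + k%:R) ^- 2 + 1).
  apply: ler_sum => k _; apply: (le_trans (sin_sqrV_le (angle_itv (ltn_ord k)))).
  rewrite lerD2r le_eqVlt; apply/orP; left; apply/eqP.
  rewrite /angle -natr1 -muln2 natrM (_ : 4 ^+ m = 2 ^+ m * 2 ^+ m); last first.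
    by rewrite -exprMn; congr (_ ^+ _); ring.
  have k0 : 0 <= k%:R :> R by [].
  have k1 : 0 < k%:R * 2 + 1 :> R by lra.
  by field; rewrite ?gt_eqF//; lra.
rewrite sum_sin_sqrV big_split/= sumr_const card_ord -mulr_sumr.
set S := \sum_(_ < _) _; rewrite natrX.
have -> : 4 ^+ m = 2 ^+ m * 2 ^+ m :> R.
  by rewrite -exprMn; congr (_ ^+ _); ring.
set t := 2 ^+ m; move: pi0; move: (pi : R) => p p0 h.
have c0 : 0 < p ^+ 2 / (4 * (t * t)) :> R by rewrite divr_gt0 ?mulr_gt0// exprn_gt0.
have := ler_wpM2l (ltW c0) h.
have -> : p ^+ 2 / (4 * (t * t)) * (2 * (t * t)) = p ^+ 2 / 2 :> R.
  by field; rewrite gt_eqF.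
have -> : p ^+ 2 / (4 * (t * t)) * (4 * (t * t) / p ^+ 2 * S + t) =
    S + p ^+ 2 / 4 / t.
  by field; rewrite !gt_eqF.
by lra.
Qed.

End basel.

(** * Hyperbolic pyramids *)

Section hyperbolic.
Local Open Scope classical_set_scope.
Context {R : realType}.
Local Notation mR := (measurableTypeR R).
Local Notation mu := (@lebesgue_measure R).
Implicit Types b t : R.

Lemma powR_gt0E (x a : R) : 0 < x -> x `^ a = expR (a * ln x).
Proof. by move=> x0; rewrite /powR gt_eqF. Qed.

Lemma continuous_powR_expR (h : R -> R) (a c : R) : continuous h ->
  forall y, 0 < y -> {for y, continuous (fun y : R => c * y `^ a * expR (h y))}.
Proof.
move=> ch y y0; apply: continuousM.
  apply: continuousM; first exact: cvg_cst.
  apply: differentiable_continuous; apply/derivable1_diffP.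
  by apply: derivable_powR; rewrite in_itv/= y0.
by apply: continuous_comp; [exact: ch|exact: continuous_expR].
Qed.

Lemma GammaE b : Gamma b = lgamma_moment b 0.
Proof.
rewrite /Gamma /lgamma_moment /Rintegral.
have h : continuous (fun y : R => - y) by exact: opp_continuous.
rewrite (_ : integral _ _ _ =
    \int[mu]_(t in `]0%R, +oo[) (1 * t `^ (b - 1) * expR (- t))%:E)%E; last first.
  by apply: eq_integral => t _; rewrite mul1r.
rewrite (@ge0_integral_exp_affine R (fun y : R => 1 * y `^ (b - 1) * expR (- y)) 1 0 ltr01)//.
- congr fine; apply: eq_integral => t _; congr _%:E.
  rewrite powR_gt0E ?expR_gt0// expRK addr0 !mul1r -!expRD.
  by congr expR; ring.
- by move=> y y0; exact: continuous_powR_expR.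
- by move=> y y0; rewrite mul1r mulr_ge0 ?powR_ge0 ?expR_ge0.
Qed.

(** Change of variable t = ln (y^2 / 2): here y = exp (t / 2 + ln 2 / 2), with derivative y / 2. *)
Lemma chi_pdf_exp b t : 0 < Gamma b ->
  let y := expR (2^-1 * t + ln 2 / 2) in
  chi_pdf b y * (2^-1 * y) = lgamma_pdf b t / Gamma b.
Proof.
move=> G0 y; have ly : ln y = 2^-1 * t + ln 2 / 2 by rewrite expRK.
have y2 : y ^+ 2 / 2 = expR t.
  rewrite /y -expRM_natl (_ : 2 * _ = t + ln 2); last by field.
  by rewrite expRD lnK ?posrE//; field.
rewrite /chi_pdf y2 !powR_gt0E ?expR_gt0// ly.
have -> : 2^-1 * y = expR (2^-1 * t + ln 2 / 2 - ln 2).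
  by rewrite expRB lnK ?posrE// mulrC.
rewrite [LHS](_ : _ = expR ((1 - b) * ln 2) * expR ((2 * b - 1) * (2^-1 * t + ln 2 / 2)) *
    expR (- expR t) * expR (2^-1 * t + ln 2 / 2 - ln 2) / Gamma b); last by ring.
by congr (_ / _); rewrite -!expRD; congr expR; field.
Qed.

(* If y has law chi_{2b} then t = ln (y ^ 2 / 2) is the logarithm of a Gamma variable
   of parameter b, and - 2 ln y = - t - ln 2: this is the law of F. *)
Definition lgamma_law b d (T : measurableType d) (m : {measure set T -> \bar R})
    (F : T -> R) := forall f : R -> R, continuous f -> (forall s, 0 <= f s) ->
  (\int[m]_x (f (F x))%:E =
   \int[mu]_t (f (- t - ln 2) * (lgamma_pdf b t / Gamma b))%:E)%E.

Lemma Gamma_gt0 b : 0 < b -> 0 < Gamma b.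
Proof. by move=> b0; rewrite GammaE lgamma_moment0_gt0. Qed.

Lemma lgamma_density_ge0 b t : 0 < b -> 0 <= lgamma_pdf b t / Gamma b.
Proof. by move=> b0; rewrite divr_ge0 ?lgamma_pdf_ge0// ltW// Gamma_gt0. Qed.

Lemma integral_lgamma_density b : 0 < b ->
  (\int[mu]_t (lgamma_pdf b t / Gamma b)%:E = 1)%E.
Proof.
move=> b0; have G0 := Gamma_gt0 b0.
have i0 := integrable_lgamma_moment b0 (leq0n 2).
under eq_integral do rewrite mulrC EFinM.
rewrite ge0_integralZl_EFin//; last 3 first.
- by move=> t _; rewrite lee_fin lgamma_pdf_ge0.
- apply/measurable_EFinP; apply: continuous_measurable_fun.
  exact: continuous_lgamma_pdf.
- by rewrite invr_ge0 ltW.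
rewrite -[X in (_ * X)%E]fineK; last first.
  have := integrable_fin_num measurableT i0; congr (_ \is a fin_num).
  by apply: eq_integral => t _; rewrite expr0 mul1r.
rewrite (_ : fine _ = Gamma b); first by rewrite -EFinM mulVf// gt_eqF.
rewrite GammaE /lgamma_moment /Rintegral; congr fine.
by apply: eq_integral => t _; rewrite expr0 mul1r.
Qed.

Lemma lgamma_law_setT b d (T : measurableType d) (m : {measure set T -> \bar R})
    (F : T -> R) : 0 < b -> lgamma_law b m F -> m [set: T] = 1%E.
Proof.
move=> b0 /(_ (fun=> 1)) h.
have : (\int[m]_x (1 : R)%:E = 1)%E.
  rewrite h ?integral_lgamma_density//; last by move=> s; exact: cvg_cst.
  rewrite -[RHS](integral_lgamma_density b0).
  by apply: eq_integral => t _; rewrite mul1r.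
by rewrite integral_cst// mul1e.
Qed.

Lemma lgamma_law_ball b d (T : measurableType d) (m : {measure set T -> \bar R})
    (F : T -> R) (s e : R) : 0 < b -> measurable_fun [set: T] F ->
  lgamma_law b m F -> 0 < e -> (0 < m [set x | (`|s - F x| < e)%R])%E.
Proof.
move=> b0 mF lF e0.
set A := [set x | _].
have mA : measurable A.
  rewrite -[X in measurable X]setTI; apply: (mF _ [set y | `|s - y| < e]) => //.
  by apply: open_measurable; exact: ball_open.
(* A tent supported on the ball, because the law is only tested on continuous functions; its
   integral is at most e times the mass of the ball. *)
pose f (x : R) := Num.max (e - `|s - x|) 0.
have f0 x : 0 <= f x by rewrite /f le_max lexx orbT.
have cf : continuous f.
  move=> x; apply: (@continuous_max _ _ (fun x => e - `|s - x|) (fun=> 0)); last exact: cvg_cst.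
  apply: cvgB; first exact: cvg_cst.
  apply: cvg_norm; apply: cvgB; [exact: cvg_cst|exact: cvg_id].
have fA : (\int[m]_x (f (F x))%:E <= e%:E * m A)%E.
  rewrite -(setIT A) -integral_indic// -ge0_integralZl_EFin//; last 2 first.
  - exact/measurable_EFinP.
  - exact: ltW.
  apply: ge0_le_integral => //.
  - by move=> x _; rewrite lee_fin.
  - apply/measurable_EFinP; apply: measurableT_comp => //.
    exact: continuous_measurable_fun.
  - by apply: emeasurable_funM => //; exact/measurable_EFinP.
  move=> x _; rewrite -EFinM lee_fin indicE /f.
  have := normr_ge0 (s - F x).
  case: (boolP (x \in A)); rewrite !(inE, notin_setE)/= => h h0.
    by rewrite ge_max mulr1; apply/andP; split; lra.
  by rewrite mulr0 ge_max lexx andbT subr_le0 leNgt; apply/negP.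
have : (0 < \int[m]_x (f (F x))%:E)%E.
  pose u := - s - ln 2.
  rewrite lF//.
  (* A lower bound of the density on [u, u + e / 2], where - t - ln 2 is within e / 2 of s and the
     tent is at least e / 2. *)
  pose k := expR (- (b * (`|u| + e)) - expR (u + e)) / Gamma b.
  have k0 : 0 < k by rewrite divr_gt0 ?expR_gt0 ?Gamma_gt0.
  apply: (@lt_le_trans _ _ (\int[mu]_(t in `[u, (u + e / 2)%R]) (e / 2 * k)%:E)%E).
    rewrite integral_cst//= lebesgue_measure_itv/= lte_fin ltrDl divr_gt0//.
    rewrite -EFinD -EFinM lte_fin [ltRHS](_ : _ = e / 2 * k * (e / 2)); last by ring.
    have e2 : 0 < e / 2 by rewrite divr_gt0.
    exact: mulr_gt0 (mulr_gt0 e2 k0) e2.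
  have mg : measurable_fun [set: mR]
      (fun t => (f (- t - ln 2) * (lgamma_pdf b t / Gamma b))%:E).
    apply/measurable_EFinP; apply: measurable_funM.
      apply: measurableT_comp; first exact: continuous_measurable_fun.
      by apply: measurable_funB => //; exact: measurable_funN.
    apply: measurable_funM => //; apply: continuous_measurable_fun.
    exact: continuous_lgamma_pdf.
  apply: (@le_trans _ _ (\int[mu]_(t in `[u, (u + e / 2)%R])
      (f (- t - ln 2) * (lgamma_pdf b t / Gamma b))%:E)%E); last first.
    apply: ge0_subset_integral => //.
    by move=> t _; rewrite lee_fin mulr_ge0// lgamma_density_ge0.
  apply: ge0_le_integral => //.
  - by move=> t _; rewrite lee_fin mulr_ge0// ltW// divr_gt0.
  - exact: measurable_funTS.
  - move=> t /=; rewrite in_itv/= => /andP[ut tu]; rewrite lee_fin.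
    apply: ler_pM; [lra|exact: ltW| |].
      rewrite /f le_max; apply/orP; left.
      have : `|s - (- t - ln 2)| <= e / 2.
        by rewrite ler_norml; apply/andP; rewrite /u in ut tu; split; lra.
      by lra.
    rewrite /k ler_pM2r ?invr_gt0 ?Gamma_gt0// ler_expR.
    have : expR t <= expR (u + e) by rewrite ler_expR; lra.
    have : - (b * (`|u| + e)) <= b * t.
      rewrite -mulrN ler_pM2l//; have := ler_norm (- u); rewrite normrN; lra.
    by lra.
move=> h; have : (0 < e%:E * m A)%E := lt_le_trans h fA.
by rewrite pmule_rgt0 ?lte_fin.
Qed.

Section half_plane.
Variable b : R.
Hypothesis b0 : 0 < b.

Let Z := @hor_qm R b 0.
Let F (x : Z) : R := - (2 * ln (posval x.2)).

(** With c = (u / v + v / u) / 2 = cosh (ln (u / v)), arcosh c is at least the absolute value of ln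
    (u / v). The added term ln (u / v) then gives the factor 2. *)
Let F_Lip (x y : Z) : Num.max (F y - F x) 0 <= qm_dist Z x y.
Proof.
rewrite /= /hor_dist /F; set u := posval x.2; set v := posval y.2.
have u0 : 0 < u by exact: (valP x.2).
have v0 : 0 < v by exact: (valP y.2).
rewrite /sqdist big_ord0 add0r lnM ?posrE ?invr_gt0// lnV ?posrE//.
have -> : (u ^+ 2 + v ^+ 2) / (2 * u * v) = (u / v + v / u) / 2.
  by field; rewrite !gt_eqF.
set c := (_ + _) / 2.
have sq : Num.sqrt (c ^+ 2 - 1) = `|(u / v - v / u) / 2|.
  rewrite -sqrtr_sqr; congr Num.sqrt; rewrite /c.
  by field; rewrite !gt_eqF.
have uv0 : 0 < u / v by rewrite divr_gt0.
have vu0 : 0 < v / u by rewrite divr_gt0.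
have n1 := ler_norm ((u / v - v / u) / 2).
have n2 : (v / u - u / v) / 2 <= `|(u / v - v / u) / 2|.
  by rewrite -normrN; apply: le_trans (ler_norm _); lra.
have h1 : ln u - ln v <= arcosh c.
  rewrite -ln_div ?posrE// /arcosh ler_ln ?posrE ?sq /c//; lra.
have h2 : ln v - ln u <= arcosh c.
  rewrite -ln_div ?posrE// /arcosh ler_ln ?posrE ?sq /c//; lra.
by rewrite ge_max; apply/andP; split; lra.
Qed.

Let measurable_posval : measurable_fun [set: mposreal] (@posval R).
Proof.
by move=> _ B mB; rewrite setTI; exists B => //; rewrite setTI.
Qed.

Let mF : measurable_fun [set: Z] F.
Proof.
apply: measurable_funN; apply: measurable_funM => //.
apply: measurableT_comp; first exact: measurable_ln.
by apply: measurableT_comp => //; exact: measurable_snd.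
Qed.

Let F_law : lgamma_law b (qm_meas Z) F.
Proof.
move=> f cf f0.
have mf : measurable_fun [set: R] f by exact: continuous_measurable_fun.
have mlf : measurable_fun [set: mR] (fun y => (f (- (2 * ln y)))%:E).
  apply/measurable_EFinP; apply: measurableT_comp => //.
  by apply: measurable_funN; apply: measurable_funM => //; exact: measurable_ln.
have chiE A : measurable A -> chi_law b A = qm_meas Z (snd @^-1` A).
  move=> mA; rewrite -setTX.
  have -> : qm_meas Z ([set: 0.-tuple mR] `*` A) =
      (@std_gauss R 0 [set: _] * chi_law b A)%E by exact: product_measure2E.
  by rewrite probability_setT mul1e.
transitivity (\int[chi_law b]_y (f (- (2 * ln (posval y))))%:E)%E.
  apply: esym; apply: (ge0_integral_image (p := snd) (mu := qm_meas Z) _ chiE).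
  - exact: measurable_snd.
  - exact: (measurableT_comp mlf measurable_posval).
  - by move=> y; rewrite lee_fin.
(* The image of [chi_law] on the whole line has the chi density extended by 0. *)
pose pdf (y : mR) : R := if 0 < y then chi_pdf b y else 0.
have chi_pdf_ge0 y : 0 <= chi_pdf b y.
  by rewrite /chi_pdf !mulr_ge0 ?powR_ge0 ?expR_ge0// invr_ge0 ltW// Gamma_gt0.
have mpdf : measurable_fun [set: mR] pdf.
  rewrite (_ : pdf = fun y => chi_pdf b y * \1_(`]0, +oo[%classic : set mR) y).
    apply: measurable_funM; last exact: measurable_indic.
    apply: measurable_funM.
      by apply: measurable_funM => //; exact: measurable_powR.
    apply: measurableT_comp => //; apply: measurableT_comp => //.
    by apply: measurable_funM => //; exact: measurable_funX.
  apply/funext => y; rewrite /pdf indicE mem_setE in_itv/= andbT.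
  by case: ifP; rewrite ?mulr1 ?mulr0.
have pdf0 y : 0 <= pdf y by rewrite /pdf; case: ifP.
have chiD A : measurable A ->
    pushforward (chi_law b) (@posval R) A = (\int[mu]_(y in A) (pdf y)%:E)%E.
  move=> mA; rewrite /pushforward /chi_law.
  rewrite (_ : _ @` _ = A `&` `]0, +oo[); last first.
    apply/seteqP; split=> [_ [y Ay <-]|y [Ay]].
      by split=> //=; rewrite in_itv/= andbT; exact: (valP y).
    by rewrite /= in_itv/= andbT => y0; exists (Sub y y0 : @posreal R).
  rewrite integral_mkcondr; apply: eq_integral => y _; rewrite /patch /pdf.
  by rewrite mem_setE in_itv/= andbT; case: ifP.
rewrite -(@ge0_integral_image R _ _ _ _ (chi_law b)
  (pushforward (chi_law b) (@posval R)) _ _ measurable_posval _ mlf)//; last first.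
  by move=> y; rewrite lee_fin.
rewrite (ge0_integral_density mpdf pdf0 chiD mlf); last first.
  by move=> y; rewrite lee_fin.
transitivity (\int[mu]_(y in `]0%R, +oo[)
    (f (- (2 * ln y)) * chi_pdf b y)%:E)%E.
  rewrite [RHS]integral_mkcond; apply: eq_integral => y _; rewrite /patch /pdf.
  by rewrite mem_setE in_itv/= andbT; case: ifP => _; rewrite ?mulr0 ?mule0// EFinM.
have half0 : 0 < 2^-1 :> R by rewrite invr_gt0.
rewrite (@ge0_integral_exp_affine R (fun y => f (- (2 * ln y)) * chi_pdf b y)
  2^-1 (ln 2 / 2) half0).
- apply: eq_integral => t _; congr _%:E.
  rewrite -mulrA chi_pdf_exp ?Gamma_gt0// expRK; congr (f _ * _).
  by field.
- move=> y y0; apply: continuousM.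
    apply: continuous_comp; last exact: cf.
    by apply: cvgN; apply: cvgM; [exact: cvg_cst|exact: continuous_ln].
  apply: continuous_powR_expR y0 => x.
  by apply: differentiable_continuous; apply/derivable1_diffP; exact: ex_derive.
- by move=> y y0; rewrite mulr_ge0.
Qed.

Lemma pyrH_line : exists (Y : qm_space R) (H : Y -> R),
  [/\ pyrH b Y, Lip1 (qm_dist Y) H & lgamma_law b (qm_meas Y) H].
Proof.
have [Y [H [YZ LH HE]]] := line_quotient mF (lgamma_law_setT b0 F_law) F_Lip
  (fun z e => lgamma_law_ball (F z) b0 mF F_law).
exists Y, H; split=> //; first by apply: sub_box_closure; exists 0%N.
move=> f cf f0; rewrite (HE (EFin \o f)).
- exact: F_law.
- by apply/measurable_EFinP; exact: continuous_measurable_fun.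
- by move=> s; rewrite lee_fin.
Qed.

(** The factor exp (- b t) cancels exp (b t) in the density. What remains is a constant times exp (-
    exp t), bounded below on ]-oo, 0]. *)
Lemma Eexp_pyrH_infty : Eexp b (pyrH b) = +oo%E.
Proof.
have [Y [H [HY LH HE]]] := pyrH_line.
apply: (Eexp_infty (ltW b0) HY LH).
rewrite (HE (fun s => expR (b * s))); last 2 first.
- by move=> s; apply: continuous_comp; [exact: mulrl_continuous|exact: continuous_expR].
- by move=> s; exact: expR_ge0.
apply/eqP; rewrite -leye_eq.
pose c := expR (- (b * ln 2) - 1) / Gamma b.
have c0 : 0 < c by rewrite divr_gt0 ?expR_gt0 ?Gamma_gt0.
have <- : (c%:E * mu `]-oo, 0%R]%classic = +oo)%E.
  by rewrite lebesgue_measure_itv/= ltNyr gt0_muley ?lte_fin.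
rewrite -integral_cst//.
have mg : measurable_fun [set: mR]
    (fun t => (expR (b * (- t - ln 2)) * (lgamma_pdf b t / Gamma b))%:E).
  apply/measurable_EFinP; apply: measurable_funM.
    apply: measurableT_comp => //; apply: measurable_funM => //.
    by apply: measurable_funB => //; exact: measurable_funN.
  apply: measurable_funM => //; apply: continuous_measurable_fun.
  exact: continuous_lgamma_pdf.
have g0 t : 0 <= expR (b * (- t - ln 2)) * (lgamma_pdf b t / Gamma b).
  by rewrite mulr_ge0 ?expR_ge0// lgamma_density_ge0.
apply: (@le_trans _ _ (\int[mu]_(t in `]-oo, 0%R])
    (expR (b * (- t - ln 2)) * (lgamma_pdf b t / Gamma b))%:E)%E); last first.
  by apply: ge0_subset_integral => // t _; rewrite lee_fin.
apply: ge0_le_integral => //.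
- by move=> t _; rewrite lee_fin ltW.
- exact: measurable_funTS.
- move=> t /=; rewrite in_itv/= => t0; rewrite lee_fin mulrA -expRD /c.
  rewrite ler_pM2r ?invr_gt0 ?Gamma_gt0// ler_expR.
  have : expR t <= 1 by rewrite -expR0 ler_expR.
  by lra.
Qed.

(* In the star pyramid the truncations of H at levels -r and r would have
   exponential moments above -r that are bounded in r. *)
Lemma pyrH_neq_pyrS : pyrH b <> @pyrS R.
Proof.
move=> HS; have [Y [H [HY LH HE]]] := pyrH_line.
rewrite HS in HY.
have mH : measurable_fun [set: Y] H := measurable_Lip1 LH.
(* Since min (H, 0) <= clip r H, the product exp (r / 4) g(H) is below the exponential of order 1/4
   of the truncation above -r. Order 1/4 gives the star bound 1 / (1 - 1/2) = 2. *)
pose g (s : R) := expR (4^-1 * Num.min s 0).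
have g0 s : 0 <= g s by exact: expR_ge0.
have mg : measurable_fun [set: Y] (fun y => (g (H y))%:E).
  apply/measurable_EFinP; apply: (measurableT_comp (f := g)) mH.
  have h : measurable_fun [set: mR] (fun s : mR => 4^-1 * Num.min s 0).
    by apply: measurable_funM => //; exact: measurable_minr.
  exact: (measurableT_comp (@measurable_expR R) h).
have mball (s : R) : measurable [set y : Y | `|s - H y| < 1].
  rewrite -[X in measurable X]setTI; apply: (mH _ [set y | `|s - y| < 1]) => //.
  by apply: open_measurable; exact: ball_open.
pose kap := (\int[qm_meas Y]_y (g (H y))%:E)%E.
have kap0 : (0 < kap)%E.
  have h0 := lgamma_law_ball 0 b0 mH HE ltr01.
  apply: (@lt_le_trans _ _ ((expR (- 4^-1))%:E *
      qm_meas Y [set y | (`|0 - H y| < 1)%R])%E).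
    by rewrite mule_gt0// lte_fin expR_gt0.
  rewrite -integral_cst//.
  apply: (@le_trans _ _ (\int[qm_meas Y]_(y in [set y | (`|0 - H y| < 1)%R])
      (g (H y))%:E)%E); last first.
    by apply: ge0_subset_integral => // y _; rewrite lee_fin.
  apply: ge0_le_integral => //.
  - by move=> y _; rewrite lee_fin expR_ge0.
  - exact: measurable_funTS.
  - move=> y /=; rewrite sub0r normrN ltr_norml => /andP[h1 h2].
    rewrite lee_fin ler_expR; have : - 1 <= Num.min (H y) 0.
      by rewrite le_min; apply/andP; split; lra.
    by lra.
have kap_le r : 0 <= r -> ((expR (4^-1 * r))%:E * kap <= 2%:E)%E.
  move=> r0; have oF := observable_clip r0 LH.
  have Fc : (0 < qm_meas Y [set y | (clip r (H y) <= - r)%R])%E.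
    (* The ball of radius 1 around - r - 1 lies below - r, so the lowest level of the truncation has
       positive mass. *)
    apply: lt_le_trans (lgamma_law_ball (- r - 1) b0 mH HE ltr01) _.
    apply: le_measure; rewrite ?inE//.
    - rewrite (_ : [set y | (clip _ _ <= _)%R] = (clip r \o H) @^-1` `]-oo, (- r)%R]).
        rewrite -[X in measurable X]setTI.
        exact: (measurableT_comp (measurable_clip r) mH).
      by apply/seteqP; split=> y /=; rewrite in_itv.
    - move=> y /=; rewrite ltr_norml => /andP[h1 h2].
      by rewrite /clip ge_max lexx/= ge_min; apply/orP; right; lra.
  have l4 : 0 <= (4^-1 : R) < 2^-1 by apply/andP; split; lra.
  have := pyrS_exp_le HY oF l4 Fc.
  rewrite (_ : (1 - 2 * 4^-1)^-1 = 2 :> R); last by field.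
  apply: le_trans; rewrite -ge0_integralZl_EFin//; last first.
    by move=> y _; rewrite lee_fin.
  apply: ge0_le_integral => //.
  - by move=> y _; rewrite -EFinM lee_fin mulr_ge0 ?expR_ge0.
  - by apply: emeasurable_funM.
  - apply/measurable_EFinP; apply: measurableT_comp => //.
    apply: measurable_funM => //; apply: measurable_maxr => //.
    by apply: measurable_funB => //; exact: (measurableT_comp (measurable_clip r) mH).
  - move=> y _; rewrite -EFinM lee_fin -expRD ler_expR/=.
    have c1 : Num.min (H y) 0 <= clip r (H y).
      rewrite /clip le_max !le_min; apply/orP; right.
      by rewrite !ge_min lexx r0 !orbT.
    have : clip r (H y) - - r <= Num.max (clip r (H y) - - r) 0 by rewrite le_max lexx.
    by lra.
have := kap_le 0 (lexx _); rewrite mulr0 expR0 mul1e => kap2.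
have kfin : kap \is a fin_num.
  by rewrite ge0_fin_numE ?(le_lt_trans kap2) ?ltry ?ltW.
move: kap0 kap_le; rewrite -(fineK kfin) lte_fin; move: (fine kap) => k k0 kap_le.
(* With r = 8 / k, exp (r / 4) k >= (1 + 2 / k) k = k + 2 > 2. *)
have /kap_le : 0 <= 8 / k by rewrite divr_ge0// ltW.
rewrite -EFinM lee_fin; apply/negP; rewrite -ltNge.
have := expR_ge1Dx (4^-1 * (8 / k)).
rewrite -(ler_pM2r k0) (_ : (1 + _) * k = k + 2); last by field; rewrite gt_eqF.
by lra.
Qed.

Lemma Vdir_pyrH_ge : ((lgamma_variance b)%:E <= Vdir (pyrH b))%E.
Proof.
have [Y [H [HY LH HE]]] := pyrH_line; have G0 := Gamma_gt0 b0.
pose l := ln 2 : R.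
pose p t := lgamma_pdf b t / Gamma b.
have p0 t : [set: R] t -> 0 <= p t by move=> _; exact: lgamma_density_ge0.
have i0 := integrable_lgamma_moment b0 (leq0n 2).
have i1 := integrable_lgamma_moment b0 (leqnSn 1).
have i2 := integrable_lgamma_moment b0 (leqnn 2).
(* The moments of - t - ln 2 are expanded in those of t; the sign and the translation leave the
   variance unchanged. *)
pose comb (x y z : R) t := x * (t ^+ 2 * lgamma_pdf b t) +
  y * (t ^+ 1 * lgamma_pdf b t) + z * (t ^+ 0 * lgamma_pdf b t).
have icomb x y z : mu.-integrable setT (EFin \o comb x y z) /\
    \int[mu]_t comb x y z t = x * lgamma_moment b 2 + y * lgamma_moment b 1 +
      z * lgamma_moment b 0.
  pose f1 t := x * (t ^+ 2 * lgamma_pdf b t).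
  pose f2 t := y * (t ^+ 1 * lgamma_pdf b t).
  pose f3 t := z * (t ^+ 0 * lgamma_pdf b t).
  have j1 : mu.-integrable setT (EFin \o f1) := integrableZl measurableT _ i2.
  have j2 : mu.-integrable setT (EFin \o f2) := integrableZl measurableT _ i1.
  have j3 : mu.-integrable setT (EFin \o f3) := integrableZl measurableT _ i0.
  have j12 : mu.-integrable setT (EFin \o (fun t => f1 t + f2 t)).
    exact: (integrableD measurableT j1 j2).
  split; first exact: (integrableD measurableT j12 j3).
  have := RintegralD measurableT j12 j3; rewrite (RintegralD measurableT j1 j2).
  rewrite /f1 /f2 /f3 (RintegralZl _ measurableT i2) (RintegralZl _ measurableT i1).
  by rewrite (RintegralZl _ measurableT i0).
pose G := Gamma b.
have E1 : (fun t => (- t - l) * p t) = comb 0 (- G^-1) (- (l / G)).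
  by apply/funext => t; rewrite /comb /p -/G; ring.
have E2 : (fun t => (- t - l) ^+ 2 * p t) = comb G^-1 (2 * l / G) (l ^+ 2 / G).
  by apply/funext => t; rewrite /comb /p -/G; ring.
apply: le_trans (Vdir_ge_line (F := fun t => - t - l) HY LH measurableT p0 HE _ _).
- have := (icomb 0 (- G^-1) (- (l / G))).2; rewrite -E1 => ->.
  have := (icomb G^-1 (2 * l / G) (l ^+ 2 / G)).2; rewrite -E2 => ->.
  rewrite lee_fin le_eqVlt; apply/orP; left; apply/eqP.
  rewrite /lgamma_variance /G GammaE; field.
  by rewrite -GammaE gt_eqF.
- by have := (icomb 0 (- G^-1) (- (l / G))).1; rewrite -E1.
- by have := (icomb G^-1 (2 * l / G) (l ^+ 2 / G)).1; rewrite -E2.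
Qed.

End half_plane.

Lemma le_of_subr_exp2 (x c y : R) :
  (forall m, x - c / 2 ^+ m <= y) -> x <= y.
Proof.
move=> h; rewrite leNgt; apply/negP => yx.
have e0 : 0 < x - y by rewrite subr_gt0.
pose m := Num.truncn (c / (x - y)).
have : c / (x - y) < 2 ^+ m.+1.
  apply: (lt_le_trans (truncnS_gt _)); rewrite -/m -natrX ler_nat.
  exact: ltnW (ltn_expl _ _).
have p0 : 0 < 2 ^+ m.+1 :> R by rewrite exprn_gt0.
rewrite ltr_pdivrMr// => lt_c.
have := h m.+1; rewrite lerBlDr -lerBlDl ler_pdivlMr// mulrC.
by rewrite leNgt lt_c.
Qed.

Lemma lgamma_variance_half : pi ^+ 2 / 2 <= lgamma_variance (2^-1 : R).
Proof.
apply: (@le_of_subr_exp2 _ (pi ^+ 2 / 4)) => m.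
apply: (le_trans (sum_odd_sqrV_ge m)).
by apply: (lgamma_variance_ge (2 ^ m)); rewrite invr_gt0.
Qed.

Lemma Vdir_pyrH_half : ((pi ^+ 2 / 2)%:E <= Vdir (@pyrH R 2^-1))%E.
Proof.
apply: le_trans (Vdir_pyrH_ge _); last by rewrite invr_gt0.
by rewrite lee_fin lgamma_variance_half.
Qed.

End hyperbolic.

Theorem proposition7p5 (R : realType) :
  (forall q b : R, 0 <= q <= 1 -> 0 < b ->
     [/\ pyrG q <> pyrH b, pyrG q <> pyrS & pyrH b <> pyrS]) /\
  [/\ forall q : R, 0 <= q <= 1 -> Lambda (pyrG q) = +oo%E,
      Lambda (@pyrS R) = (2^-1)%:E,
      Vdir (@pyrS R) = 4%:E &
      ((pi ^+ 2 / 2)%:E <= Vdir (@pyrH R 2^-1))%E].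
Proof.
split=> [q b q01 b0|].
  split=> [GH|GS|].
  - by have := Eexp_pyrG q01 (ltW b0); rewrite GH Eexp_pyrH_infty.
  - by have := Lambda_pyrG q01; rewrite GS Lambda_pyrS.
  - exact: pyrH_neq_pyrS.
split; [exact: Lambda_pyrG|exact: Lambda_pyrS|exact: Vdir_pyrS|].
exact: Vdir_pyrH_half.
Qed.
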